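(* Let $w$ be an input word of length $N$ over an alphabet $\Sigma$ that is identified with a subset of $\{1,\ldots,N^c\}$ for a constant $c$. Algorithm Main (described in the context) runs in time $O(N)$ and returns an SLP generating $w$ of size $O(\ell + \ell\log(N/\ell))$, where $\ell$ is the size of the LZ77 factorisation of $w$ computed in its first step. Consequently its approximation ratio is $O(1+\log(N/g))$, where $g$ is the size of a smallest SLP generating $w$.
   Context: Words are indexed from $1$; $w[i\,..\,j]$ is the subword from position $i$ to $j$. An LZ77 factorisation of $w$ is a representation $w=f_1f_2\cdots f_\ell$ where each $f_i$ is either a single letter (a free letter) or a factor: $f_i=w[j\,..\,j+|f_i|-1]$ for some $j\le |f_1\cdots f_{i-1}|$, and $w[j\,..\,j+|f_i|-1]$ is the definition of $f_i$. Its size is $\ell$. A factor may have length $1$. An SLP (straight-line programme) is a context-free grammar in Chomsky normal form generating exactly one word, with nonterminals $X_1,\ldots,X_g$ and rules $X_i\to a$ (a letter) or $X_i\to X_jX_k$ with $j,k<i$; its size is the number $g$ of nonterminals. A pairing of $w$ assigns to every position a value $\mathrm{pair}[i]\in\{L,R,N\}$ (first of a pair, second of a pair, unpaired), such that $\mathrm{pair}[i]=L$ iff $\mathrm{pair}[i+1]=R$. The factorisation is stored by arrays: $\mathrm{pocz}[i]=j$ if a factor (of the factorisation) starts at position $i$ and its definition starts at $j$, otherwise $\mathrm{pocz}[i]=\mathrm{false}$; $\mathrm{kon}[i]=\mathrm{true}$ iff position $i$ is the last position of a factor. Procedure Pairing: set $\mathrm{pair}[1]=N$, $i=2$. While $i\le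 |w|$: (A) if $\mathrm{pocz}[i]\ne\mathrm{false}$: (a) if $\mathrm{kon}[i]$, set $\mathrm{pocz}[i]=\mathrm{kon}[i]=\mathrm{false}$; (b) else if $\mathrm{pocz}[i]=i-1$, set $\mathrm{pocz}[i+1]=i-1$ and $\mathrm{pocz}[i]=\mathrm{false}$; (c) else if $\mathrm{pair}[\mathrm{pocz}[i]]\ne L$, set $\mathrm{pocz}[i+1]=\mathrm{pocz}[i]+1$ and $\mathrm{pocz}[i]=\mathrm{false}$; (d) else let $j=\mathrm{pocz}[i]$ and repeat {$\mathrm{pair}[i]=\mathrm{pair}[j]$; $i{+}{+}$; $j{+}{+}$} until $\mathrm{kon}[i-1]$; then while $\mathrm{pair}[i-1]\ne R$ do {$i{-}{-}$; $\mathrm{kon}[i-1]=\mathrm{true}$; $\mathrm{kon}[i]=\mathrm{false}$; $\mathrm{pair}[i]=N$}. (B) Then, if $\mathrm{pocz}[i]=\mathrm{false}$ (for the current $i$): if $\mathrm{pair}[i-1]=N$ set $\mathrm{pair}[i-1]=L$, $\mathrm{pair}[i]=R$, otherwise set $\mathrm{pair}[i]=N$; and $i{+}{+}$. Procedure Replace (given a pairing): scan $w$ left to right with pointer $i$ in $w$ and pointer $i'$ in the new word $w'$ (both start at $1$), recording $\mathrm{pos}[i]=i'$ for each position $i$ that is not second in a pair. If position $i$ starts a factor with definition starting at $j$, the new factor in $w'$ starts at $i'$ with definition starting at $\mathrm{pos}[j]$, and its letters are copied one by one from $w'$ starting at $\mathrm{pos}[j]$: each copied letter advances $i'$ by $1$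 and advances $i$ by $2$ if $\mathrm{pair}[i]=L$ and by $1$ otherwise, until the end of the factor in $w$ is passed; the last written position of $w'$ is marked as the end of the new factor. If position $i$ is a free letter: if unpaired it is copied to $w'[i']$ (advance $i,i'$ by $1$); if paired (with $i+1$) then $w'[i']$ is set to a fresh letter $c$ (a new letter, with a rule $c\to w[i]w[i+1]$ recorded), and $i$ advances by $2$, $i'$ by $1$. Algorithm Main: compute a smallest LZ77 factorisation of $w$; while $|w|>1$, compute a pairing by Pairing and then replace $w$ (and its factorisation) by the output of Replace; finally output the grammar whose nonterminals are the letters of $\Sigma$ and the fresh letters, with rule $c\to ab$ for each fresh letter $c$ introduced for a pair $ab$. *)

(* Defs.v *)
From Stdlib Require Import Arith String List.
Import ListNotations.

(** * Words, LZ77 factorisations, straight-line programmes *)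

Definition word := list nat.

(** The [l] letters of [w] starting at the 1-based position [j]. *)
Definition subword (w : word) (j l : nat) : word := firstn l (skipn (j - 1) w).

Inductive phrase :=
| Free (a : nat)
| Factor (j l : nat). (* definition starts at the 1-based position [j], length [l] *)

Definition phrase_word (w : word) (f : phrase) : word :=
  match f with
  | Free a => [a]
  | Factor j l => subword w j l
  end.

Definition unfactor (w : word) (F : list phrase) : word :=
  concat (map (phrase_word w) F).

(** The definition of a factor only has to start before the factor: it may
    overlap the factor itself. *)
Definition is_lz77 (w : word) (F : list phrase) : Prop :=
  w = unfactor w F /\
  forall F1 j l F2, F = F1 ++ Factor j l :: F2 ->
    1 <= j <= length (unfactor w F1) /\ 1 <= l /\ j + l - 1 <= length w.

Definition smallest_lz77 (w : word) (F : list phrase) : Prop :=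
  is_lz77 w F /\ forall F', is_lz77 w F' -> length F <= length F'.

Inductive rhs :=
| Ter (a : nat)
| Bin (Y Z : nat).

(** Nonterminals carry arbitrary names; the rule at place [i] of the list is the
    rule of the [i]-th nonterminal. *)
Record slp := SLP { slp_rules : list (nat * rhs); slp_start : nat }.

Definition slp_size (G : slp) : nat := length (slp_rules G).

Definition slp_wf (G : slp) : Prop :=
  NoDup (map fst (slp_rules G)) /\
  forall R1 X Y Z R2, slp_rules G = R1 ++ (X, Bin Y Z) :: R2 ->
    In Y (map fst R1) /\ In Z (map fst R1).

Inductive derives (R : list (nat * rhs)) : nat -> word -> Prop :=
| derives_ter X a : In (X, Ter a) R -> derives R X [a]
| derives_bin X Y Z u v :
    In (X, Bin Y Z) R -> derives R Y u -> derives R Z v -> derives R X (u ++ v).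

Definition slp_generates (G : slp) (w : word) : Prop :=
  slp_wf G /\ derives (slp_rules G) (slp_start G) w.

Definition smallest_slp (w : word) (G : slp) : Prop :=
  slp_generates G w /\ forall G', slp_generates G' w -> slp_size G <= slp_size G'.

(** * A unit-cost word RAM

    The machine is given as a while-language over natural-number registers and
    finitely many zero-initialised arrays.  It can only handle numbers below the
    word bound [W]: an evaluation that meets a number [>= W] is stuck.  A step is
    one assignment or one test; a program is fixed before its input, so its
    expressions have bounded size. *)

Inductive aop := OpAdd | OpSub | OpMul | OpDiv | OpMod.

Inductive aexp :=
| Lit (m : nat)
| Var (x : string)
| Get (a : string) (e : aexp)
| Op (o : aop) (e1 e2 : aexp).

Inductive bexp :=
| BEq (e1 e2 : aexp)
| BLe (e1 e2 : aexp)
| BNot (b : bexp).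

Inductive com :=
| Skip
| Asg (x : string) (e : aexp)
| Put (a : string) (e1 e2 : aexp)
| Seq (c1 c2 : com)
| If (b : bexp) (c1 c2 : com)
| While (b : bexp) (c : com).

Definition Repeat_until (c : com) (b : bexp) : com := Seq c (While (BNot b) c).

Record state := State { var : string -> nat; arr : string -> nat -> nat }.

Definition set_var (s : state) (x : string) (v : nat) : state :=
  State (fun y => if String.eqb y x then v else var s y) (arr s).

Definition set_arr (s : state) (a : string) (i v : nat) : state :=
  State (var s)
    (fun b j => if (String.eqb b a && Nat.eqb j i)%bool then v else arr s b j).

Definition op_eval (o : aop) : nat -> nat -> nat :=
  match o with
  | OpAdd => Nat.add
  | OpSub => Nat.sub
  | OpMul => Nat.mul
  | OpDiv => Nat.div
  | OpMod => Nat.modulo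
  end.

Definition fit (W v : nat) : option nat := if Nat.ltb v W then Some v else None.

Fixpoint aeval (W : nat) (s : state) (e : aexp) : option nat :=
  match e with
  | Lit m => fit W m
  | Var x => fit W (var s x)
  | Get a e =>
      match aeval W s e with
      | Some i => fit W (arr s a i)
      | None => None
      end
  | Op o e1 e2 =>
      match aeval W s e1, aeval W s e2 with
      | Some v1, Some v2 => fit W (op_eval o v1 v2)
      | _, _ => None
      end
  end.

Fixpoint beval (W : nat) (s : state) (b : bexp) : option bool :=
  match b with
  | BEq e1 e2 =>
      match aeval W s e1, aeval W s e2 with
      | Some v1, Some v2 => Some (Nat.eqb v1 v2)
      | _, _ => None
      end
  | BLe e1 e2 =>
      match aeval W s e1, aeval W s e2 with
      | Some v1, Some v2 => Some (Nat.leb v1 v2)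
      | _, _ => None
      end
  | BNot b => option_map negb (beval W s b)
  end.

(** [exec W c s t s']: with word bound [W], program [c] started in [s] halts in
    [s'] after [t] steps. *)
Inductive exec (W : nat) : com -> state -> nat -> state -> Prop :=
| exec_skip s : exec W Skip s 1 s
| exec_asg x e s v :
    aeval W s e = Some v -> exec W (Asg x e) s 1 (set_var s x v)
| exec_put a e1 e2 s i v :
    aeval W s e1 = Some i -> aeval W s e2 = Some v ->
    exec W (Put a e1 e2) s 1 (set_arr s a i v)
| exec_seq c1 c2 s t1 s1 t2 s2 :
    exec W c1 s t1 s1 -> exec W c2 s1 t2 s2 -> exec W (Seq c1 c2) s (t1 + t2) s2
| exec_if b (bv : bool) c1 c2 s t s' :
    beval W s b = Some bv -> exec W (if bv then c1 else c2) s t s' ->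
    exec W (If b c1 c2) s (S t) s'
| exec_while_end b c s :
    beval W s b = Some false -> exec W (While b c) s 1 s
| exec_while_step b c s t1 s1 t2 s2 :
    beval W s b = Some true -> exec W c s t1 s1 -> exec W (While b c) s1 t2 s2 ->
    exec W (While b c) s (S (t1 + t2)) s2.

(** Word bound on inputs of length [N] for words of [k * log (N + 1)] bits. *)
Definition word_bound (k N : nat) : nat := (N + 1) ^ k.

(** * The algorithm *)

Declare Scope prog_scope.
Delimit Scope prog_scope with prog.
Bind Scope prog_scope with aexp bexp com.
Coercion Lit : nat >-> aexp.
Coercion Var : string >-> aexp.
Notation "a .[ e ]" := (Get a e)
  (at level 2, left associativity, e at level 80, format "a .[ e ]") : prog_scope.
Notation "a .[ e1 <- e2 ]" := (Put a e1 e2)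
  (at level 2, left associativity, e1 at level 80, e2 at level 80,
   format "a .[ e1  <-  e2 ]") : prog_scope.
Notation "x <- e" := (Asg x e) (at level 90, e at level 80) : prog_scope.
Notation "c1 ;; c2" := (Seq c1 c2) (at level 96, right associativity) : prog_scope.
Infix "+" := (Op OpAdd) : prog_scope.
Infix "-" := (Op OpSub) : prog_scope.
Infix "=?" := BEq : prog_scope.
Infix "<=?" := BLe : prog_scope.
Notation "e1 <>? e2" := (BNot (BEq e1 e2)) (at level 70) : prog_scope.

Local Open Scope string_scope.
Local Open Scope prog_scope.

(** The current word is [w.[1]], ..., [w.[n]].  Positions start at 1, so 0 encodes
    [false] in [pocz]; in [kon], 0 and 1 encode [false] and [true]. *)
Definition pN : nat := 0.
Definition pL : nat := 1.
Definition pR : nat := 2.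

Definition pairing : com :=
  "pair".[1 <- pN] ;;
  "i" <- 2 ;;
  While ("i" <=? "n") (
    If ("pocz".["i"] <>? 0)
      (If ("kon".["i"] =? 1)
         ("pocz".["i" <- 0] ;; "kon".["i" <- 0])
      (If ("pocz".["i"] =? "i" - 1)
         ("pocz".["i" + 1 <- "i" - 1] ;; "pocz".["i" <- 0])
      (If ("pair".["pocz".["i"]] <>? pL)
         ("pocz".["i" + 1 <- "pocz".["i"] + 1] ;; "pocz".["i" <- 0])
         ("j" <- "pocz".["i"] ;;
          Repeat_until
            ("pair".["i" <- "pair".["j"]] ;; "i" <- "i" + 1 ;; "j" <- "j" + 1)
            ("kon".["i" - 1] =? 1) ;;
          While ("pair".["i" - 1] <>? pR)
            ("i" <- "i" - 1 ;;
             "kon".["i" - 1 <- 1] ;;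
             "kon".["i" <- 0] ;;
             "pair".["i" <- pN])))))
      Skip ;;
    If ("pocz".["i"] =? 0)
      (If ("pair".["i" - 1] =? pN)
         ("pair".["i" - 1 <- pL] ;; "pair".["i" <- pR])
         ("pair".["i" <- pN]) ;;
       "i" <- "i" + 1)
      Skip).

(** Moves [i'] to the next position of the new word, not marked so far. *)
Definition advance' : com :=
  "i'" <- "i'" + 1 ;; "pocz'".["i'" <- 0] ;; "kon'".["i'" <- 0].

(** Primed names belong to the new word; [fresh] is the next unused letter; the
    rule [c -> a b] is recorded as [left.[c] = a] and [right.[c] = b]. *)
Definition replace : com :=
  "i" <- 1 ;;
  "i'" <- 0 ;; advance' ;;
  While ("i" <=? "n") (
    If ("pocz".["i"] <>? 0)
      ("j'" <- "pos".["pocz".["i"]] ;;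
       "pocz'".["i'" <- "j'"] ;;
       Repeat_until
         ("pos".["i" <- "i'"] ;;
          "w'".["i'" <- "w'".["j'"]] ;;
          "j'" <- "j'" + 1 ;;
          advance' ;;
          If ("pair".["i"] =? pL) ("i" <- "i" + 2) ("i" <- "i" + 1))
         ("kon".["i" - 1] =? 1) ;;
       "kon'".["i'" - 1 <- 1])
      ("pos".["i" <- "i'"] ;;
       If ("pair".["i"] =? pL)
         ("w'".["i'" <- "fresh"] ;;
          "left".["fresh" <- "w".["i"]] ;;
          "right".["fresh" <- "w".["i" + 1]] ;;
          "fresh" <- "fresh" + 1 ;;
          "i" <- "i" + 2)
         ("w'".["i'" <- "w".["i"]] ;;
          "i" <- "i" + 1) ;;
       advance')) ;;
  "n" <- "i'" - 1 ;;
  "i" <- 1 ;;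
  While ("i" <=? "n") (
    "w".["i" <- "w'".["i"]] ;;
    "pocz".["i" <- "pocz'".["i"]] ;;
    "kon".["i" <- "kon'".["i"]] ;;
    "i" <- "i" + 1).

(** Lists the letters of the input word without repetition in [sigma.[1]], ...,
    [sigma.[nsigma]] and makes the letters above them available as fresh ones. *)
Definition alphabet : com :=
  "i" <- 1 ;;
  While ("i" <=? "n") ("seen".["w".["i"] <- 0] ;; "i" <- "i" + 1) ;;
  "nsigma" <- 0 ;;
  "base" <- 0 ;;
  "i" <- 1 ;;
  While ("i" <=? "n") (
    If ("seen".["w".["i"]] =? 0)
      ("seen".["w".["i"] <- 1] ;;
       "nsigma" <- "nsigma" + 1 ;;
       "sigma".["nsigma" <- "w".["i"]] ;;
       If ("base" <=? "w".["i"]) ("base" <- "w".["i"] + 1) Skip)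
      Skip ;;
    "i" <- "i" + 1) ;;
  "fresh" <- "base".

(** [lz] is the subroutine computing the LZ77 factorisation. *)
Definition main (lz : com) : com :=
  lz ;; alphabet ;; While (2 <=? "n") (pairing ;; replace).

Local Close Scope prog_scope.
Local Close Scope string_scope.
Local Open Scope list_scope.

Definition init (w : word) : state :=
  State (fun x => if String.eqb x "n" then length w else 0)
    (fun a i =>
       if (String.eqb a "w" && Nat.leb 1 i)%bool then nth (i - 1) w 0 else 0).

Definition output (s : state) : slp :=
  SLP
    (map (fun i => (arr s "sigma" i, Ter (arr s "sigma" i)))
         (seq 1 (var s "nsigma")) ++
     map (fun c => (c, Bin (arr s "left" c) (arr s "right" c)))
         (seq (var s "base") (var s "fresh" - var s "base")))
    (arr s "w" 1).

Definition stores_word (s : state) (w : word) : Prop :=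
  var s "n" = length w /\
  forall i, 1 <= i <= length w -> arr s "w" i = nth (i - 1) w 0.

Definition stores_lz77 (s : state) (w : word) (F : list phrase) : Prop :=
  forall F1 f F2, F = F1 ++ f :: F2 ->
    let b := length (unfactor w F1) + 1 in
    match f with
    | Free _ => arr s "pocz" b = 0 /\ arr s "kon" b = 0
    | Factor j l =>
        let e := b + l - 1 in
        arr s "pocz" b = j /\ (forall i, b < i <= e -> arr s "pocz" i = 0) /\
        arr s "kon" e = 1 /\ (forall i, b <= i < e -> arr s "kon" i = 0)
    end.

(** Nonempty words of length [N] over [{1, ..., N ^ c}]. *)
Definition admissible (c : nat) (w : word) : Prop :=
  w <> [] /\ Forall (fun a => 1 <= a <= length w ^ c) w.

(** [lz] computes a smallest LZ77 factorisation in linear time. *)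
Definition linear_lz77 (c : nat) (lz : com) : Prop :=
  exists T k : nat, forall w, admissible c w ->
    exists t s F,
      exec (word_bound k (length w)) lz (init w) t s /\
      t <= T * length w /\
      stores_word s w /\ smallest_lz77 w F /\ stores_lz77 s w F.

(* Main.v *)
Require Import Defs.
From Stdlib Require Import String Arith Lia Lra Bool.
From Stdlib Require Import Reals List.
Import ListNotations.

(** A smallest factorisation is computed with McCreight's suffix tree algorithm: the
    longest prefix of the suffix at [i] that occurs before [i] is the head of that suffix,
    and greedy parsing is optimal.  Arrays come zero-initialised with polynomially many
    cells, so the children of a node are found by direct addressing, for any alphabet.

    Pairing never leaves two consecutive letters unpaired, so a round shrinks the word to
    at most two thirds; hence the linear time.  A pair replaced by a fresh letter consists
    of two free letters and their number drops by one, while a factor releases at most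
    five free letters per round.  After [r] rounds there are thus at most [l + 5 l r] fresh
    letters, and later ones are bounded by the length [(2/3)^r N] of the remaining word;
    take [r] of order [log (N / l)].  Finally an SLP of size [g] yields a factorisation
    into at most [g] phrases, and [x + x log (N / x)] increases for [x <= N]. *)

Local Open Scope string_scope.
Local Open Scope list_scope.
Local Open Scope nat_scope.

(** * Running programs *)

(** The subroutine [lz] is arbitrary: beyond the stored word and factorisation nothing is known of
    the memory it leaves, and the later phases have to be correct for any other contents. The size
    bound is derived for every [r] at once, so that the choice of [r] is left to real analysis.

    In the suffix tree at most one link is missing, that of the branching node created last; its
    target is met or created by the next descent.

    The delicate accounting is in pairing: a factor releases its letters one by one while its
    definition moves, and the letter before it may still turn from unpaired into the first of a
    pair. So every factor owns five credits, and the invariant records how many of them the factor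
    at the front of the scan has spent.

    Monotonicity of [x + x log (N / x)] does not reach a smallest grammar with more than [N]
    nonterminals, as a word of many different letters has. There the trivial bound [2 N] on the
    output decides; this case fixes the constant 18, while the other estimates need only 15. *)

Fixpoint ev (s : state) (e : aexp) : nat :=
  match e with
  | Lit m => m
  | Var x => var s x
  | Get a e => arr s a (ev s e)
  | Op o e1 e2 => op_eval o (ev s e1) (ev s e2)
  end.

(** Registers and cells carry no condition: in a [bounded] state their contents fit already, so only
    literals and results of operations remain to be checked. *)
Fixpoint safe (W : nat) (s : state) (e : aexp) : Prop :=
  match e with
  | Lit m => m < W
  | Var _ => True
  | Get _ e => safe W s e
  | Op o e1 e2 =>
      safe W s e1 /\ safe W s e2 /\ op_eval o (ev s e1) (ev s e2) < W
  end.

Fixpoint bev (s : state) (b : bexp) : bool :=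
  match b with
  | BEq e1 e2 => Nat.eqb (ev s e1) (ev s e2)
  | BLe e1 e2 => Nat.leb (ev s e1) (ev s e2)
  | BNot b => negb (bev s b)
  end.

Fixpoint bsafe (W : nat) (s : state) (b : bexp) : Prop :=
  match b with
  | BEq e1 e2 | BLe e1 e2 => safe W s e1 /\ safe W s e2
  | BNot b => bsafe W s b
  end.

Definition bounded (W : nat) (s : state) : Prop :=
  (forall x, var s x < W) /\ (forall a i, arr s a i < W).

Lemma fit_lt W v : v < W -> fit W v = Some v.
Proof. intros H; unfold fit; apply Nat.ltb_lt in H; now rewrite H. Qed.

Lemma fit_some W v u : fit W v = Some u -> u = v /\ v < W.
Proof.
  unfold fit; destruct (Nat.ltb_spec v W); intros E; inversion E; subst; auto.
Qed.

Lemma aeval_ev W s e :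
  bounded W s -> safe W s e -> aeval W s e = Some (ev s e) /\ ev s e < W.
Proof.
  intros [Hv Ha]; induction e as [m|x|a e IH|o e1 IH1 e2 IH2]; simpl; intros Hs.
  - split; auto using fit_lt.
  - split; auto using fit_lt.
  - destruct (IH Hs) as [-> _]; split; auto using fit_lt.
  - destruct Hs as (H1 & H2 & H3).
    destruct (IH1 H1) as [-> _]; destruct (IH2 H2) as [-> _].
    split; auto using fit_lt.
Qed.

Lemma beval_bev W s b :
  bounded W s -> bsafe W s b -> beval W s b = Some (bev s b).
Proof.
  intros HB; induction b as [e1 e2|e1 e2|b IH]; simpl; intros Hs;
    try (destruct Hs as [H1 H2];
         destruct (aeval_ev W s e1 HB H1) as [-> _];
         destruct (aeval_ev W s e2 HB H2) as [-> _]; reflexivity).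
  now rewrite (IH Hs).
Qed.

Lemma aeval_lt W s e v : aeval W s e = Some v -> v < W.
Proof.
  destruct e; simpl; intros H.
  - apply fit_some in H; lia.
  - apply fit_some in H; lia.
  - destruct (aeval W s e); try discriminate; apply fit_some in H; lia.
  - destruct (aeval W s e1), (aeval W s e2); try discriminate.
    apply fit_some in H; lia.
Qed.

(** Only values that have passed an evaluation are ever stored. *)
Lemma exec_bounded W c s t s' : exec W c s t s' -> bounded W s -> bounded W s'.
Proof.
  induction 1; auto.
  - intros [Hv Ha]; split; simpl; auto.
    intros y; destruct (String.eqb y x); eauto using aeval_lt.
  - intros [Hv Ha]; split; simpl; auto.
    intros b j; destruct (String.eqb b a && Nat.eqb j i)%bool; eauto using aeval_lt.
Qed.

Lemma fit_mono W W' v u : W <= W' -> fit W v = Some u -> fit W' v = Some u.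
Proof.
  intros HW H; apply fit_some in H as [-> H]; apply fit_lt; lia.
Qed.

Lemma aeval_mono W W' s e v :
  W <= W' -> aeval W s e = Some v -> aeval W' s e = Some v.
Proof.
  intros HW; revert v; induction e as [m|x|a e IH|o e1 IH1 e2 IH2]; simpl; intros v H;
    eauto using fit_mono.
  - destruct (aeval W s e) as [i|]; try discriminate.
    rewrite (IH _ eq_refl); eauto using fit_mono.
  - destruct (aeval W s e1) as [v1|]; try discriminate.
    destruct (aeval W s e2) as [v2|]; try discriminate.
    rewrite (IH1 _ eq_refl), (IH2 _ eq_refl); eauto using fit_mono.
Qed.

Lemma beval_mono W W' s b v :
  W <= W' -> beval W s b = Some v -> beval W' s b = Some v.
Proof.
  intros HW; revert v; induction b as [e1 e2|e1 e2|b IH]; simpl; intros v H.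
  1,2: destruct (aeval W s e1) as [v1|] eqn:E1; try discriminate;
       destruct (aeval W s e2) as [v2|] eqn:E2; try discriminate;
       now rewrite (aeval_mono _ _ _ _ _ HW E1), (aeval_mono _ _ _ _ _ HW E2).
  destruct (beval W s b); try discriminate; now rewrite (IH _ eq_refl).
Qed.

Lemma exec_mono W W' c s t s' :
  W <= W' -> exec W c s t s' -> exec W' c s t s'.
Proof.
  intros HW; induction 1;
    econstructor; eauto using aeval_mono, beval_mono.
Qed.

Definition runs (W : nat) (c : com) (s : state) (Q : nat -> state -> Prop) : Prop :=
  exists t s', exec W c s t s' /\ Q t s'.

Lemma runs_conseq W c s (Q Q' : nat -> state -> Prop) :
  runs W c s Q -> (forall t s', Q t s' -> Q' t s') -> runs W c s Q'.
Proof. intros (t & s' & HE & HQ) H; exists t, s'; auto. Qed.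

Lemma runs_seq W c1 c2 s Q :
  runs W c1 s (fun t1 s1 => runs W c2 s1 (fun t2 s2 => Q (t1 + t2) s2)) ->
  runs W (Seq c1 c2) s Q.
Proof.
  intros (t1 & s1 & H1 & t2 & s2 & H2 & HQ).
  exists (t1 + t2), s2; split; auto; econstructor; eauto.
Qed.

(** Postconditions see the number of steps as well. A loop is not unfolded: its clause asks for a
    run, to be supplied by an invariant and a potential. *)
Fixpoint wp (W : nat) (c : com) (s : state) (Q : nat -> state -> Prop) : Prop :=
  match c with
  | Skip => Q 1 s
  | Asg x e => safe W s e /\ Q 1 (set_var s x (ev s e))
  | Put a e1 e2 =>
      safe W s e1 /\ safe W s e2 /\ Q 1 (set_arr s a (ev s e1) (ev s e2))
  | Seq c1 c2 =>
      wp W c1 s (fun t1 s1 => wp W c2 s1 (fun t2 s2 => Q (t1 + t2) s2))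
  | If b c1 c2 =>
      bsafe W s b /\
      (bev s b = true -> wp W c1 s (fun t => Q (S t))) /\
      (bev s b = false -> wp W c2 s (fun t => Q (S t)))
  | While b c => bounded W s -> runs W (While b c) s Q
  end.

Lemma wp_runs W c s Q : bounded W s -> wp W c s Q -> runs W c s Q.
Proof.
  revert s Q; induction c as [|x e|a e1 e2|c1 IH1 c2 IH2|b c1 IH1 c2 IH2|b c IH];
    simpl; intros s Q HB H.
  - exists 1, s; split; auto; constructor.
  - destruct H as [Hs H]; exists 1, (set_var s x (ev s e)); split; auto.
    constructor; now apply aeval_ev.
  - destruct H as (H1 & H2 & H); exists 1, (set_arr s a (ev s e1) (ev s e2)).
    split; auto; constructor; now apply aeval_ev.
  - apply runs_seq.
    destruct (IH1 s _ HB H) as (t1 & s1 & HE & H1).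
    exists t1, s1; split; auto.
    apply IH2; auto; eapply exec_bounded; eauto.
  - destruct H as (Hb & Ht & Hf); apply (beval_bev W s b HB) in Hb.
    destruct (bev s b).
    + destruct (IH1 s _ HB (Ht eq_refl)) as (t & s' & HE & HQ).
      exists (S t), s'; split; auto; econstructor; eauto.
    + destruct (IH2 s _ HB (Hf eq_refl)) as (t & s' & HE & HQ).
      exists (S t), s'; split; auto; econstructor; eauto.
  - auto.
Qed.

(** Time is paid out of the potential [P]; each round has to pay for itself. *)
Lemma runs_while_runs W b c (I : state -> Prop) (P : state -> nat) :
  (forall s, bounded W s -> I s -> bsafe W s b) ->
  (forall s, bounded W s -> I s -> bev s b = true ->
     runs W c s (fun t s' => I s' /\ S t + P s' <= P s)) ->
  forall s, bounded W s -> I s ->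
  runs W (While b c) s (fun t s' => I s' /\ bev s' b = false /\ t + P s' <= S (P s)).
Proof.
  intros Hsafe Hbody s; remember (P s) as m eqn:Em; revert s Em.
  (* The potential is also the termination measure: each round lowers it by at least the [S t] steps
     it takes. *)
  induction m as [m IH] using lt_wf_ind; intros s -> HB HI.
  pose proof (beval_bev W s b HB (Hsafe s HB HI)) as Hb.
  destruct (bev s b) eqn:E.
  - destruct (Hbody s HB HI E) as (t1 & s1 & HE1 & HI1 & Ht1).
    assert (HB1 : bounded W s1) by (eapply exec_bounded; eauto).
    destruct (IH (P s1) ltac:(lia) s1 eq_refl HB1 HI1) as (t2 & s2 & HE2 & HI2 & Hb2 & Ht2).
    exists (S (t1 + t2)), s2; split; [econstructor; eauto|].
    repeat split; auto; lia.
  - exists 1, s; split; [now constructor|]; auto.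
Qed.

Lemma runs_while W b c (I : state -> Prop) (P : state -> nat) :
  (forall s, bounded W s -> I s -> bsafe W s b) ->
  (forall s, bounded W s -> I s -> bev s b = true ->
     wp W c s (fun t s' => I s' /\ S t + P s' <= P s)) ->
  forall s, bounded W s -> I s ->
  runs W (While b c) s (fun t s' => I s' /\ bev s' b = false /\ t + P s' <= S (P s)).
Proof. intros Hsafe Hbody; apply runs_while_runs; auto using wp_runs. Qed.

Definition mem (x : string) (l : list string) : bool := existsb (String.eqb x) l.

Fixpoint mvars (c : com) : list string :=
  match c with
  | Skip | Put _ _ _ => []
  | Asg x _ => [x]
  | Seq c1 c2 | If _ c1 c2 => mvars c1 ++ mvars c2
  | While _ c => mvars c
  end.

Fixpoint marrs (c : com) : list string :=
  match c with
  | Skip | Asg _ _ => []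
  | Put a _ _ => [a]
  | Seq c1 c2 | If _ c1 c2 => marrs c1 ++ marrs c2
  | While _ c => marrs c
  end.

Lemma mem_app x l1 l2 : mem x (l1 ++ l2) = (mem x l1 || mem x l2)%bool.
Proof. unfold mem; apply existsb_app. Qed.

Lemma exec_var_frame W c s t s' :
  exec W c s t s' -> forall x, mem x (mvars c) = false -> var s' x = var s x.
Proof.
  induction 1; simpl; intros y Hy; auto;
    rewrite ?mem_app, ?orb_false_iff in Hy.
  - destruct Hy as [Hy _]; simpl in Hy; now rewrite Hy.
  - destruct Hy; rewrite IHexec2, IHexec1; auto.
  - destruct Hy; destruct bv; auto.
  - rewrite IHexec2; auto.
Qed.

Lemma exec_arr_frame W c s t s' :
  exec W c s t s' -> forall a, mem a (marrs c) = false -> arr s' a = arr s a.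
Proof.
  induction 1; simpl; intros y Hy; auto;
    rewrite ?mem_app, ?orb_false_iff in Hy.
  - destruct Hy as [Hy _]; simpl in Hy; now rewrite Hy.
  - destruct Hy; rewrite IHexec2, IHexec1; auto.
  - destruct Hy; destruct bv; auto.
  - rewrite IHexec2; auto.
Qed.

(** What a program never assigns keeps its value; thus loop invariants need not mention it. *)
Definition frame (c : com) (s s' : state) : Prop :=
  (forall x, mem x (mvars c) = false -> var s' x = var s x) /\
  (forall a, mem a (marrs c) = false -> arr s' a = arr s a).

Lemma runs_frame W c s Q :
  bounded W s -> runs W c s Q ->
  runs W c s (fun t s' => Q t s' /\ bounded W s' /\ frame c s s').
Proof.
  intros HB (t & s' & HE & HQ); exists t, s'; repeat split; auto.
  1,2: eapply exec_bounded; eauto.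
  - intros; eapply exec_var_frame; eauto.
  - intros; eapply exec_arr_frame; eauto.
Qed.

Ltac wpsimpl :=
  cbv [wp safe ev bsafe bev op_eval var arr set_var set_arr String.eqb
       Ascii.eqb Bool.eqb andb Repeat_until].

Ltac wpsplit :=
  repeat match goal with
  | |- True => exact I
  | |- _ /\ _ => split
  | |- true = true -> _ => intros _
  | |- false = false -> _ => intros _
  | |- true = false -> _ => discriminate 1
  | |- false = true -> _ => discriminate 1
  | |- (_ =? _) = true -> _ => let H := fresh "E" in intro H; apply Nat.eqb_eq in H
  | |- (_ =? _) = false -> _ => let H := fresh "E" in intro H; apply Nat.eqb_neq in H
  | |- (_ <=? _) = true -> _ => let H := fresh "E" in intro H; apply Nat.leb_le in H
  | |- (_ <=? _) = false -> _ => let H := fresh "E" in intro H; apply Nat.leb_gt in H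
  | |- negb _ = true -> _ => let H := fresh "E" in intro H; apply negb_true_iff in H; revert H
  | |- negb _ = false -> _ => let H := fresh "E" in intro H; apply negb_false_iff in H; revert H
  end.

Ltac ands := repeat match goal with |- _ /\ _ => split end.

(** * Suffix trees *)

Definition eqf (w : nat -> nat) (a b l : nat) : Prop :=
  forall y, y < l -> w (a + y) = w (b + y).

Lemma eqf_sym w a b l : eqf w a b l -> eqf w b a l.
Proof. intros H y Hy; symmetry; auto. Qed.

Lemma eqf_trans w a b c l : eqf w a b l -> eqf w b c l -> eqf w a c l.
Proof. intros H1 H2 y Hy; rewrite H1, H2; auto. Qed.

Lemma eqf_le w a b l l' : eqf w a b l -> l' <= l -> eqf w a b l'.
Proof. intros H Hl y Hy; apply H; lia. Qed.

Lemma eqf_tail w a b l : eqf w a b l -> eqf w (a + 1) (b + 1) (l - 1).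
Proof.
  intros H y Hy; replace (a + 1 + y) with (a + S y) by lia.
  replace (b + 1 + y) with (b + S y) by lia; apply H; lia.
Qed.

Lemma eqf_S w a b l : eqf w a b l -> w (a + l) = w (b + l) -> eqf w a b (S l).
Proof.
  intros H E y Hy; destruct (Nat.eq_dec y l) as [->|]; auto; apply H; lia.
Qed.

Definition upd (f : nat -> nat) (k v : nat) : nat -> nat :=
  fun z => if Nat.eqb z k then v else f z.

Lemma upd_same f k v : upd f k v k = v.
Proof. unfold upd; now rewrite Nat.eqb_refl. Qed.

Lemma upd_other f k v z : z <> k -> upd f k v z = f z.
Proof. intros H; unfold upd; apply Nat.eqb_neq in H; now rewrite H. Qed.

(** The letter 0 behind the last position makes all suffixes prefix-free. *)
Definition text (n : nat) (w : nat -> nat) : Prop :=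
  (forall x, 1 <= x <= n -> w x <> 0) /\ w (n + 1) = 0.

(** Node [v] is labelled by the [td v] letters at [tb v]; [tc (a * stride + v)] is
    the child of [v] along the letter [a], and 0 if there is none. *)
Record tree := Tree { tb : nat -> nat; td : nat -> nat; tc : nat -> nat;
                      tl : nat -> nat; tm : nat }.

Definition stride (n : nat) : nat := n + n + 3.

Definition child (n : nat) (T : tree) (v a : nat) : nat := tc T (a * stride n + v).

(** The label of a leaf includes the end letter at [n + 1], so that [tb + td] is [n + 2] there; all
    other labels stay inside the word. *)
Definition internal (n : nat) (T : tree) (v : nat) : Prop :=
  1 <= v <= tm T /\ tb T v + td T v <= n + 1.

(** The suffix link: the target carries the label of [v] without its first letter. Truncated
    subtraction lets the root link to itself. *)
Definition good_link (n : nat) (w : nat -> nat) (T : tree) (v : nat) : Prop :=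
  internal n T (tl T v) /\ td T (tl T v) = td T v - 1 /\
  eqf w (tb T (tl T v)) (tb T v + 1) (td T v - 1).

(** [T] is the compacted trie of the suffixes starting before [i]. *)
Record trie (n : nat) (w : nat -> nat) (i : nat) (T : tree) : Prop := {
  trie_count : 1 <= tm T < stride n;
  trie_root : tb T 1 = 0 /\ td T 1 = 0;
  trie_node : forall x, 1 < x <= tm T ->
    1 <= tb T x < i /\ 1 <= td T x /\ tb T x + td T x <= n + 2;
  trie_edge : forall v a x, 1 <= v <= tm T -> child n T v a = x -> x <> 0 ->
    1 < x <= tm T /\ td T v < td T x /\ eqf w (tb T v) (tb T x) (td T v) /\
    w (tb T x + td T v) = a /\
    forall j, 1 <= j < i -> eqf w j (tb T x) (S (td T v)) -> eqf w j (tb T x) (td T x);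
  trie_none : forall v a, internal n T v -> child n T v a = 0 ->
    forall j, 1 <= j < i -> eqf w j (tb T v) (td T v) -> w (j + td T v) = a -> False;
  trie_fresh : forall v a, tm T < v < stride n -> child n T v a = 0;
  trie_inj : forall u v, internal n T u -> internal n T v -> td T u = td T v ->
    eqf w (tb T u) (tb T v) (td T u) -> u = v;
  trie_inside : forall v a x u, 1 <= v <= tm T -> child n T v a = x -> x <> 0 ->
    internal n T u -> eqf w (tb T u) (tb T x) (td T u) -> td T u < td T x ->
    td T u <= td T v
}.

Arguments trie_count {n w i T}.
Arguments trie_root {n w i T}.
Arguments trie_node {n w i T}.
Arguments trie_edge {n w i T}.
Arguments trie_none {n w i T}.
Arguments trie_fresh {n w i T}.
Arguments trie_inj {n w i T}.
Arguments trie_inside {n w i T}.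

Lemma stride_inj n a v a' v' :
  v < stride n -> v' < stride n ->
  a * stride n + v = a' * stride n + v' -> a = a' /\ v = v'.
Proof.
  intros H H' E.
  destruct (Nat.lt_trichotomy a a') as [L|[L|L]]; [exfalso|subst; lia|exfalso]; nia.
Qed.

Lemma child_upd n T T' v a y v' a' :
  tc T' = upd (tc T) (a * stride n + v) y ->
  v < stride n -> v' < stride n ->
  (v' = v /\ a' = a /\ child n T' v' a' = y) \/
  ((v' <> v \/ a' <> a) /\ child n T' v' a' = child n T v' a').
Proof.
  intros E Hv Hv'; unfold child; rewrite E.
  destruct (Nat.eq_dec (a' * stride n + v') (a * stride n + v)) as [Eq|Ne].
  - left; destruct (stride_inj _ _ _ _ _ Hv' Hv Eq); subst.
    rewrite upd_same; auto.
  - right; rewrite upd_other by auto; split; auto.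
    destruct (Nat.eq_dec v' v), (Nat.eq_dec a' a); subst; auto; congruence.
Qed.

Definition split_tree (n : nat) (w : nat -> nat) (T : tree) (v a x D : nat) : tree :=
  let y := tm T + 1 in
  Tree (upd (tb T) y (tb T x)) (upd (td T) y D)
       (upd (upd (tc T) (a * stride n + v) y) (w (tb T x + D) * stride n + y) x)
       (tl T) y.

Definition leaf_tree (n : nat) (w : nat -> nat) (T : tree) (i h D : nat) : tree :=
  let y := tm T + 1 in
  Tree (upd (tb T) y i) (upd (td T) y (n + 2 - i))
       (upd (tc T) (w (i + D) * stride n + h) y) (tl T) y.



(** The label of a leaf ends in the end letter 0. A longer label would contain it before its own
    last letter, hence at a position of the word, where no letter is 0. *)
Lemma edge_internal n w i T v a :
  text n w -> trie n w i T -> 1 <= v <= tm T -> child n T v a <> 0 -> internal n T v.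
Proof.
  intros [Hw0 Hw1] HT Hv Hx.
  destruct (trie_edge HT v a _ Hv eq_refl Hx) as (Xm & Xd & Xe & _).
  destruct (trie_node HT _ Xm) as (Xb & _ & Xl).
  split; auto.
  destruct (Nat.eq_dec v 1) as [->|]; [destruct (trie_root HT); lia|].
  destruct (trie_node HT v ltac:(lia)) as (Vb & Vd & Vl).
  destruct (le_lt_dec (tb T v + td T v) (n + 1)) as [|Hlt]; auto; exfalso.
  specialize (Xe (n + 1 - tb T v) ltac:(lia)).
  replace (tb T v + (n + 1 - tb T v)) with (n + 1) in Xe by lia.
  rewrite Hw1 in Xe; symmetry in Xe; revert Xe; apply Hw0; lia.
Qed.

Lemma split_child n w T v a x D v' a' :
  v <= tm T -> tm T + 1 < stride n -> v' < stride n ->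
  let T' := split_tree n w T v a x D in
  (v' = tm T + 1 /\ a' = w (tb T x + D) /\ child n T' v' a' = x) \/
  (v' = v /\ a' = a /\ child n T' v' a' = tm T + 1) \/
  ((v' <> v \/ a' <> a) /\ (v' <> tm T + 1 \/ a' <> w (tb T x + D)) /\
   child n T' v' a' = child n T v' a').
Proof.
  intros Hv Hm Hv' T'.
  set (T1 := Tree (tb T) (td T) (upd (tc T) (a * stride n + v) (tm T + 1)) (tl T) 0).
  destruct (child_upd n T1 T' (tm T + 1) (w (tb T x + D)) x v' a' eq_refl)
    as [H|[H ->]]; auto; try lia.
  destruct (child_upd n T T1 v a (tm T + 1) v' a' eq_refl) as [H1|[H1 ->]]; auto; lia.
Qed.

(** Both halves of the edge inherit from it that a suffix entering the edge follows it to the end,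
    and [trie_inside] for the old edge keeps the new label distinct from all old ones. *)
Lemma split_trie n w i T v a x D :
  text n w -> tm T + 1 < stride n ->
  trie n w i T -> internal n T v ->
  child n T v a = x -> x <> 0 ->
  td T v < D < td T x ->
  trie n w i (split_tree n w T v a x D).
Proof.
  intros Htext Hm HT Hv Hx Hx0 HD.
  remember (tm T + 1) as y eqn:Ey.
  set (T' := split_tree n w T v a x D).
  destruct (trie_edge HT v a x (proj1 Hv) Hx Hx0) as (Xm & Xd & Xe & Xa & Xc).
  destruct (trie_node HT x Xm) as (Xb & Xd1 & Xl).
  assert (Hb : forall z, z <= tm T -> tb T' z = tb T z)
    by (intros; simpl; apply upd_other; lia).
  assert (Hd : forall z, z <= tm T -> td T' z = td T z)
    by (intros; simpl; apply upd_other; lia).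
  assert (Hby : tb T' y = tb T x) by (subst y; simpl; apply upd_same).
  assert (Hdy : td T' y = D) by (subst y; simpl; apply upd_same).
  assert (Hm' : tm T' = y) by (subst y; reflexivity).
  assert (Hc : forall v' a', v' < stride n ->
    (v' = y /\ a' = w (tb T x + D) /\ child n T' v' a' = x) \/
    (v' = v /\ a' = a /\ child n T' v' a' = y) \/
    ((v' <> v \/ a' <> a) /\ (v' <> y \/ a' <> w (tb T x + D)) /\
     child n T' v' a' = child n T v' a')).
  { intros; subst y; apply split_child; destruct Hv; auto; lia. }
  assert (Hint : forall u, internal n T' u -> u = y \/ internal n T u).
  { intros u [Hu Hu']; destruct (Nat.eq_dec u y); auto; right.
    rewrite Hm' in Hu; rewrite Hb, Hd in Hu' by lia; split; auto; lia. }
  assert (Hfy : forall a', child n T y a' = 0)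
    by (intros; apply (trie_fresh HT); lia).
  assert (Hvm : v <= tm T) by (destruct Hv; lia).
  (* no node lies strictly inside an edge, so the old nodes differ from [y] *)
  assert (Hin : forall u, internal n T u -> eqf w (tb T u) (tb T x) (td T u) ->
            td T u < td T x -> td T u <= td T v).
  { intros; eapply (trie_inside HT v a x); eauto; apply Hv. }
  constructor.
  - pose proof (trie_count HT); rewrite Hm'; subst y; lia.
  - pose proof (trie_count HT).
    rewrite Hb, Hd by lia; apply (trie_root HT).
  - intros z Hz; rewrite Hm' in Hz; destruct (Nat.eq_dec z y) as [->|].
    + rewrite Hby, Hdy; lia.
    + rewrite Hb, Hd by lia; apply (trie_node HT); lia.
  - intros v' a' z Hv' Hz Hz0; rewrite Hm' in *.
    destruct (Hc v' a' ltac:(lia)) as [(-> & -> & E)|[(-> & -> & E)|(N & N' & E)]];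
      rewrite E in Hz; subst z.
    + rewrite Hby, Hdy, Hb, Hd by lia.
      repeat split; try lia.
      intros j Hj He; apply Xc; auto; eapply eqf_le; eauto; lia.
    + rewrite Hby, Hdy, Hb, Hd by lia.
      repeat split; auto; try lia.
      intros j Hj He; eapply eqf_le; [apply Xc|]; auto; lia.
    + assert (v' <> y) by (intros ->; rewrite Hfy in Hz0; congruence).
      destruct (trie_edge HT v' a' _ ltac:(lia) eq_refl Hz0) as (H1 & H2 & H3).
      rewrite !Hb, !Hd by lia; split; auto; lia.
  - intros v' a' Hv' Ez j Hj He Hl.
    destruct (Hc v' a') as [(-> & -> & E)|[(-> & -> & E)|(N & N' & E)]]; [destruct Hv'; lia|..];
      rewrite E in Ez.
    + lia.
    + subst y; lia.
    + destruct (Hint _ Hv') as [->|Hi].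
      * rewrite Hby, Hdy in *.
        assert (a' = w (tb T x + D)).
        { rewrite <- Hl; apply Xc; auto; [eapply eqf_le; eauto; lia|lia]. }
        subst a'.
        destruct N'; congruence.
      * rewrite Hb, Hd in * by (destruct Hi; lia).
        eapply (trie_none HT v' a'); eauto.
  - intros v' a' Hv'; rewrite Hm' in Hv'.
    destruct (Hc v' a') as [(-> & -> & E)|[(-> & -> & E)|(N & N' & E)]]; try lia.
    rewrite E; apply (trie_fresh HT); lia.
  - intros u u' Hu Hu' Ed Ee.
    destruct (Hint u Hu) as [->|Hi], (Hint u' Hu') as [->|Hi']; auto.
    + exfalso; rewrite Hby, Hdy in *; rewrite Hb, Hd in * by (destruct Hi'; lia).
      assert (td T u' <= td T v); [apply Hin; auto|]; try lia.
      rewrite <- Ed; apply eqf_sym; auto.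
    + exfalso; rewrite Hby, Hdy in *; rewrite Hb, Hd in * by (destruct Hi; lia).
      assert (td T u <= td T v); [apply Hin; auto|]; lia.
    + rewrite !Hb, !Hd in * by (destruct Hi, Hi'; lia).
      apply (trie_inj HT); auto.
  - intros v' a' z u Hv' Hz Hz0 Hu He Hlt; rewrite Hm' in Hv'.
    destruct (Hc v' a') as [(-> & -> & E)|[(-> & -> & E)|(N & N' & E)]]; try lia;
      rewrite E in Hz; subst z.
    + rewrite Hdy; destruct (Hint u Hu) as [->|Hi]; [lia|].
      rewrite !Hb, !Hd in * by (destruct Hi; lia).
      specialize (Hin u Hi He Hlt); lia.
    + rewrite Hby, Hdy in *; destruct (Hint u Hu) as [->|Hi]; [lia|].
      rewrite !Hb, !Hd in * by (destruct Hi; lia).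
      apply Hin; auto; lia.
    + assert (v' <> y) by (intros ->; rewrite Hfy in Hz0; congruence).
      destruct (trie_edge HT v' a' _ ltac:(lia) eq_refl Hz0)
        as (Z1 & Z2 & Z3 & Z4 & Z5).
      remember (child n T v' a') as z eqn:Ez; symmetry in Ez.
          destruct (Hint u Hu) as [->|Hi].
      * rewrite Hby, Hdy in *; rewrite Hb, !Hd in * by lia.
        (* If the new node lay inside another edge, the upper ends of both edges would carry
           prefixes of one another's lower labels, so they coincide, and so do the first letters: it
           would be the edge just split. *)
        destruct (le_lt_dec D (td T v')) as [|Hlt']; [auto|exfalso].
        assert (Hi' : internal n T v').
        { eapply edge_internal; eauto; [lia|rewrite Ez; auto]. }
        assert (td T v' <= td T v).
        { apply Hin; auto; [|lia]; eapply eqf_trans; eauto.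
          apply eqf_sym; eapply eqf_le; eauto; lia. }
        assert (td T v <= td T v').
        { eapply (trie_inside HT v' a' z); eauto; try (lia).
          eapply eqf_trans; eauto; eapply eqf_le; eauto; lia. }
        assert (v' = v).
        { apply (trie_inj HT); auto; try lia.
          eapply eqf_trans; eauto; apply eqf_sym.
          replace (td T v') with (td T v) by lia.
          eapply eqf_trans; eauto; eapply eqf_le; eauto; lia. }
        subst v'; destruct N as [|N]; [congruence|]; apply N.
        rewrite <- Xa, <- Z4; symmetry; apply He; lia.
      * rewrite !Hb, !Hd in * by (destruct Hi; lia).
        eapply (trie_inside HT v' a' z); eauto; lia.
Qed.

(** As [D] is the exact length of the longest match, the suffix leaves the tree at [h]: no edge
    continues it there, and below [h] it shares nothing with earlier suffixes. *)
Lemma leaf_trie n w i T h D :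
  text n w -> 1 <= i <= n -> tm T + 1 < stride n ->
  trie n w i T -> internal n T h -> td T h = D -> eqf w (tb T h) i D ->
  child n T h (w (i + D)) = 0 -> D <= n + 1 - i ->
  D = 0 \/ (exists j, 1 <= j < i /\ eqf w j i D) ->
  (forall j, 1 <= j < i -> eqf w j i (S D) -> False) ->
  trie n w (i + 1) (leaf_tree n w T i h D).
Proof.
  intros Htext Hi Hm HT Hh HD He Hnone HDn Hmat Hmax.
  remember (tm T + 1) as y eqn:Ey.
  set (T' := leaf_tree n w T i h D).
  assert (Hb : forall z, z <= tm T -> tb T' z = tb T z)
    by (intros; simpl; apply upd_other; lia).
  assert (Hd : forall z, z <= tm T -> td T' z = td T z)
    by (intros; simpl; apply upd_other; lia).
  assert (Hby : tb T' y = i) by (subst y; simpl; apply upd_same).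
  assert (Hdy : td T' y = n + 2 - i) by (subst y; simpl; apply upd_same).
  assert (Hm' : tm T' = y) by (subst y; reflexivity).
  assert (Hc : forall v' a', v' < stride n ->
    (v' = h /\ a' = w (i + D) /\ child n T' v' a' = y) \/
    ((v' <> h \/ a' <> w (i + D)) /\ child n T' v' a' = child n T v' a')).
  { intros; subst y; apply child_upd; auto; destruct Hh; lia. }
  assert (Hint : forall u, internal n T' u -> internal n T u).
  { intros u [Hu Hu']; destruct (Nat.eq_dec u y) as [->|].
    - rewrite Hby, Hdy in Hu'; lia.
    - rewrite Hb, Hd in Hu' by lia; split; auto; lia. }
  assert (Hfy : forall a', child n T y a' = 0)
    by (intros; apply (trie_fresh HT); lia).
  pose proof (trie_count HT) as Hcount.
  pose proof (trie_root HT) as [Hr1 Hr2].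
  (* The new suffix leaves no edge in the middle. Up to depth [D] it agrees with an earlier suffix,
     which follows every edge it enters; and an edge reaching beyond depth [D] would have the
     explicit node [h] in its interior. *)
  assert (Hclosed : forall v' a' x, 1 <= v' <= tm T -> child n T v' a' = x -> x <> 0 ->
    eqf w i (tb T x) (S (td T v')) -> eqf w i (tb T x) (td T x)).
  { intros v' a' x Hv' Hx Hx0 Hix.
    destruct (trie_edge HT v' a' x Hv' Hx Hx0) as (Xm & Xd & Xe & Xa & Xc).
    destruct (trie_node HT x Xm) as (Xb & Xd1 & Xl).
    destruct (le_lt_dec D (td T v')) as [Hle|Hlt].
    { exfalso; apply (Hmax (tb T x) Xb), eqf_sym; eapply eqf_le; eauto; lia. }
    destruct Hmat as [|(j & Hj & Hji)]; [lia|].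
    assert (Hjx : eqf w j (tb T x) (td T x)).
    { apply Xc; auto; eapply eqf_trans; eauto; eapply eqf_le; eauto; lia. }
    destruct (le_lt_dec (td T x) D) as [Hle|Hlt'].
    { eapply eqf_trans; eauto; apply eqf_sym; eapply eqf_le; eauto. }
    exfalso; enough (td T h <= td T v') by lia.
    apply (trie_inside HT v' a' x h); auto; [|lia].
    rewrite HD; eapply eqf_trans; eauto.
    eapply eqf_trans; [apply eqf_sym; eauto|]; eapply eqf_le; eauto; lia. }
  constructor.
  - lia.
  - rewrite Hb, Hd by lia; auto.
  - intros z Hz; rewrite Hm' in Hz; destruct (Nat.eq_dec z y) as [->|].
    + rewrite Hby, Hdy; lia.
    + rewrite Hb, Hd by lia.
      destruct (trie_node HT z ltac:(lia)) as (H1 & H2 & H3); lia.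
  - intros v' a' z Hv' Hz Hz0; rewrite Hm' in *.
    destruct (Hc v' a' ltac:(lia)) as [(-> & -> & E)|(N & E)]; rewrite E in Hz; subst z.
    + destruct Hh; rewrite Hby, Hdy, Hb, Hd, HD by lia.
      repeat split; auto; try lia.
      intros j Hj Hej; destruct (Nat.eq_dec j i) as [->|]; [intros k Hk; auto|].
      exfalso; apply (Hmax j); auto; lia.
    + assert (v' <> y) by (intros ->; rewrite Hfy in Hz0; congruence).
      assert (Hvt : 1 <= v' <= tm T) by lia.
      destruct (trie_edge HT v' a' _ Hvt eq_refl Hz0) as (H1 & H2 & H3 & H4 & H5).
      rewrite !Hb, !Hd by lia; repeat split; auto; try lia.
      intros j Hj Hej; destruct (Nat.eq_dec j i) as [->|]; [|apply H5; auto; lia].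
      eapply Hclosed; eauto.
  - intros v' a' Hv' Ez j Hj Hej Hl.
    pose proof (Hint _ Hv') as Hv; pose proof (proj1 Hv) as Hvt.
    rewrite Hb, Hd in * by lia.
    destruct (Hc v' a') as [(-> & -> & E)|(N & E)]; [lia| |]; rewrite E in Ez; [lia|].
    destruct (Nat.eq_dec j i) as [->|];
      [|eapply (trie_none HT v' a'); eauto; lia].
    destruct (Nat.lt_trichotomy (td T v') D) as [Hlt|[Heq|Hgt]].
    + destruct Hmat as [|(j & Hj' & Hji)]; [lia|].
      apply (trie_none HT v' a' Hv Ez j); auto.
      * eapply eqf_trans; eauto; eapply eqf_le; eauto; lia.
      * rewrite Hji; auto.
    + assert (v' = h).
      { apply (trie_inj HT); auto; try lia.
        rewrite Heq; apply eqf_sym; eapply eqf_trans; eauto; rewrite <- Heq; auto. }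
      destruct N; [congruence|]; subst v'; rewrite HD in Hl; congruence.
    + destruct (Nat.eq_dec v' 1) as [->|]; [lia|].
      destruct (trie_node HT v' ltac:(lia)) as (H1 & _).
      apply (Hmax (tb T v') H1), eqf_sym; eapply eqf_le; eauto.
  - intros v' a' Hv'; rewrite Hm' in Hv'.
    destruct (Hc v' a') as [(-> & -> & E)|(N & E)]; try (destruct Hh; lia).
    rewrite E; apply (trie_fresh HT); lia.
  - intros u u' Hu Hu' Ed Ee; apply Hint in Hu, Hu'.
    rewrite !Hb, !Hd in * by (destruct Hu, Hu'; lia).
    apply (trie_inj HT); auto.
  - intros v' a' z u Hv' Hz Hz0 Hu He' Hlt; rewrite Hm' in Hv'; apply Hint in Hu.
    pose proof (proj1 Hu) as Hut.
    destruct (Hc v' a') as [(-> & -> & E)|(N & E)]; try lia; rewrite E in Hz; subst z.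
    + pose proof (proj1 Hh) as Hht.
      rewrite Hby, Hdy, Hb, !Hd in * by lia.
      destruct (le_lt_dec (td T u) (td T h)) as [|Hgt]; [auto|exfalso].
      destruct (Nat.eq_dec u 1) as [->|]; [lia|].
      destruct (trie_node HT u ltac:(lia)) as (H1 & _).
      apply (Hmax (tb T u) H1); eapply eqf_le; eauto; lia.
    + assert (v' <> y) by (intros ->; rewrite Hfy in Hz0; congruence).
      assert (Hvt : 1 <= v' <= tm T) by lia.
      destruct (trie_edge HT v' a' _ Hvt eq_refl Hz0) as (H1 & _).
      rewrite !Hb, !Hd in * by lia.
      eapply (trie_inside HT v' a'); eauto.
Qed.

Definition matched (w : nat -> nat) (i l : nat) : Prop :=
  exists j, 1 <= j < i /\ eqf w j i l.

(** A longer match would place the end letter at an earlier position, inside the word. *)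
Lemma matched_length n w i l : text n w -> i <= n -> matched w i l -> l <= n + 1 - i.
Proof.
  intros [Hw0 Hw1] Hi (j & Hj & He).
  destruct (le_lt_dec l (n + 1 - i)) as [|Hlt]; auto; exfalso.
  specialize (He _ Hlt); replace (i + (n + 1 - i)) with (n + 1) in He by lia.
  rewrite Hw1 in He; revert He; apply Hw0; lia.
Qed.

Definition set_links (T : tree) (l : nat -> nat) : tree :=
  Tree (tb T) (td T) (tc T) l (tm T).

Lemma trie_set_links n w i T l : trie n w i T -> trie n w i (set_links T l).
Proof. intros []; constructor; assumption. Qed.

(** While the suffix at [i] is searched, [v] is an explicit node on its path and [D]
    letters are known to match.  Only the head [p] of the suffix at [i - 1] may still
    lack its link; then depth [D0] of the path is branching but not yet passed. *)
Record descent (n : nat) (w : nat -> nat) (i : nat) (T : tree) (p D0 v D : nat)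
    (passed : bool) : Prop := {
  descent_node : internal n T v;
  descent_depth : td T v <= D;
  descent_eqf : eqf w (tb T v) i (td T v);
  descent_D0 : D0 <= D;
  descent_matched : D = 0 \/ matched w i D;
  descent_head : internal n T p /\ D0 = td T p - 1 /\ eqf w (tb T p + 1) i D0;
  descent_links : forall u, internal n T u -> u <> p -> good_link n w T u;
  descent_pending : good_link n w T p \/
    ((if passed then td T v < D0 else td T v <= D0) /\
     exists j, 1 <= j < i /\ eqf w j i D0 /\ w (j + D0) <> w (i + D0))
}.

Arguments descent_node {n w i T p D0 v D passed}.
Arguments descent_depth {n w i T p D0 v D passed}.
Arguments descent_eqf {n w i T p D0 v D passed}.
Arguments descent_D0 {n w i T p D0 v D passed}.
Arguments descent_matched {n w i T p D0 v D passed}.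
Arguments descent_head {n w i T p D0 v D passed}.
Arguments descent_links {n w i T p D0 v D passed}.
Arguments descent_pending {n w i T p D0 v D passed}.

(** An explicit node met at depth [D0] carries the label of [p] without its first letter, so it is
    the target of the pending link. If the link was good already, it is replaced by one that is good
    too. *)
Lemma descent_link n w i T p D0 v D :
  descent n w i T p D0 v D false ->
  descent n w i
    (set_links T (if td T v =? D0 then upd (tl T) p v else tl T)) p D0 v D true.
Proof.
  intros [H1 H2 H3 H4 H5 (H6 & H7 & H8) H9 H10].
  destruct (Nat.eqb_spec (td T v) D0) as [E|E].
  - constructor; auto.
    + intros u Hu Hup; destruct (H9 u Hu Hup) as (A & B & C).
      unfold good_link, set_links; simpl; rewrite upd_other by auto; auto.
    + left; unfold good_link, set_links; simpl; rewrite upd_same.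
      repeat split; try apply H1; try lia.
      rewrite <- H7, <- E; eapply eqf_trans; eauto; apply eqf_sym; rewrite E; auto.
  - destruct T; constructor; auto.
    destruct H10 as [|[A B]]; [left; auto|right; split; auto].
    cbv beta iota in A |- *; simpl in *; lia.
Qed.

(** The skip/count trick: the known match of [D] letters comes from an earlier suffix, which follows
    every edge it enters. So the letters of the edge up to depth [D] need no comparison. *)
Lemma descent_edge n w i T p D0 v D q l :
  let x := child n T v (w (i + td T v)) in
  trie n w i T -> descent n w i T p D0 v D q -> x <> 0 -> l <= D -> l <= td T x ->
  eqf w (tb T x) i l.
Proof.
  intros x HT HD Hx Hl Hl'.
  destruct (descent_node HD) as [Hv _].
  destruct (trie_edge HT v _ x Hv eq_refl Hx) as (Xm & Xd & Xe & Xa & Xc).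
  pose proof (descent_eqf HD) as He.
  destruct (le_lt_dec l (td T v)) as [|Hlt].
  { eapply eqf_le; eauto; apply eqf_sym in Xe; eapply eqf_trans; eauto. }
  destruct (descent_matched HD) as [|(j & Hj & Hji)]; [lia|].
  apply eqf_le with (l := td T x) (l' := l) (a := j) (b := tb T x) in Xc; auto.
  - eapply eqf_trans; [apply eqf_sym; eauto|]; eapply eqf_le; eauto.
  - apply eqf_S.
    + eapply eqf_trans; [eapply eqf_le; eauto; lia|].
      apply eqf_sym in He; eapply eqf_trans; eauto.
    + rewrite Xa; apply Hji; lia.
Qed.

Lemma descent_max_leaf n w i T p D0 v D q :
  trie n w i T -> descent n w i T p D0 v D q -> child n T v (w (i + td T v)) = 0 ->
  D = td T v /\ ~ matched w i (S D).
Proof.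
  intros HT HD Hx.
  pose proof (descent_depth HD) as Hd.
  pose proof (descent_eqf HD) as He.
  pose proof (descent_node HD) as Hv.
  assert (Hno : forall l, td T v < l -> ~ matched w i l).
  { intros l Hl (j & Hj & Hji); apply (trie_none HT v _ Hv Hx j Hj).
    - eapply eqf_trans; [eapply eqf_le; eauto; lia|]; apply eqf_sym; auto.
    - apply Hji; auto. }
  split; [|apply Hno; lia].
  destruct (descent_matched HD) as [|Hm]; [lia|].
  destruct (Nat.eq_dec D (td T v)); auto; exfalso; apply (Hno D); auto; lia.
Qed.

Arguments descent_max_leaf {n w i T p D0 v D q}.

Lemma descent_max_split n w i T p D0 v D q :
  let x := child n T v (w (i + td T v)) in
  trie n w i T -> descent n w i T p D0 v D q -> x <> 0 -> D < td T x ->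
  w (i + D) <> w (tb T x + D) ->
  td T v < D /\ ~ matched w i (S D).
Proof.
  intros x HT HD Hx Hlt Hne.
  destruct (descent_node HD) as [Hv _].
  destruct (trie_edge HT v _ x Hv eq_refl Hx) as (Xm & Xd & Xe & Xa & Xc).
  pose proof (descent_depth HD) as Hd.
  pose proof (descent_eqf HD) as He.
  assert (td T v < D).
  { destruct (Nat.eq_dec D (td T v)) as [->|]; [congruence|lia]. }
  split; auto; intros (j & Hj & Hji); apply Hne.
  rewrite <- Hji by lia; apply Xc; auto.
  apply eqf_S.
  - eapply eqf_trans; [eapply eqf_le; eauto; lia|].
    apply eqf_sym in He; eapply eqf_trans; eauto.
  - rewrite Xa; apply Hji; lia.
Qed.

(** At depth [D0] an earlier suffix branches off the path, which cannot happen inside an edge, since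
    a suffix entering an edge follows it to the end. So a search that gets past [D0] on an edge, or
    stops for lack of an edge, cannot have the link still pending. *)
Lemma descent_pending_ok n w i T p D0 v D :
  let x := child n T v (w (i + td T v)) in
  trie n w i T -> descent n w i T p D0 v D true ->
  x = 0 \/ (x <> 0 /\ D0 < D) -> D0 < td T x \/ x = 0 -> good_link n w T p.
Proof.
  intros x HT HD Hx Hlt.
  destruct (descent_pending HD) as [|[Hv (j & Hj & Hji & Hne)]]; auto.
  exfalso; destruct Hx as [Hx|[Hx HDD]].
  - destruct (descent_max_leaf HT HD Hx).
    pose proof (descent_D0 HD); lia.
  - destruct Hlt as [Hlt|]; [|contradiction].
    destruct (descent_node HD) as [Hvt _].
    destruct (trie_edge HT v _ x Hvt eq_refl Hx) as (Xm & Xd & Xe & Xa & Xc).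
    assert (Hxi : eqf w (tb T x) i (S D0)) by (eapply descent_edge; eauto).
    apply Hne; rewrite <- Hxi by lia; apply Xc; auto.
    eapply eqf_le; [eapply eqf_trans; [eauto|]|apply Hv].
    apply eqf_sym; eapply eqf_le; eauto.
Qed.

Lemma descent_hop n w i T p D0 v D :
  let x := child n T v (w (i + td T v)) in
  text n w -> 1 <= i <= n ->
  trie n w i T -> descent n w i T p D0 v D true -> x <> 0 -> td T x <= D ->
  td T v < td T x /\ descent n w i T p D0 x D false.
Proof.
  intros x Htext Hi HT HD Hx Hle.
  assert (Hxi : eqf w (tb T x) i (td T x)) by (eapply descent_edge; eauto).
  assert (Hgood : D0 < td T x -> good_link n w T p).
  { intros; eapply descent_pending_ok; eauto; right; split; auto; lia. }
  destruct HD as [H1 H2 H3 H4 H5 H6 H9 H10].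
  destruct (trie_edge HT v _ x (proj1 H1) eq_refl Hx) as (Xm & Xd & Xe & Xa & Xc).
  destruct (trie_node HT x Xm) as (Xb & _ & _).
  split; auto; constructor; auto.
  - split; [lia|]; destruct H5 as [|H5]; [lia|].
    pose proof (matched_length n w i D Htext ltac:(lia) H5); lia.
  - destruct (le_lt_dec (td T x) D0); auto; destruct H10 as [|[_ H10]]; auto.
Qed.

Lemma descent_scan n w i T p D0 v D :
  let x := child n T v (w (i + td T v)) in
  trie n w i T -> descent n w i T p D0 v D true -> x <> 0 -> D < td T x ->
  w (i + D) = w (tb T x + D) ->
  descent n w i T p D0 v (D + 1) false.
Proof.
  intros x HT HD Hx Hlt He.
  assert (Hxi : eqf w (tb T x) i D) by (eapply descent_edge; eauto; apply Nat.lt_le_incl; exact Hlt).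
  destruct HD as [H1 H2 H3 H4 H5 H6 H9 H10].
  destruct (trie_edge HT v _ x (proj1 H1) eq_refl Hx) as (Xm & Xd & Xe & Xa & Xc).
  destruct (trie_node HT x Xm) as (Xb & _ & _).
  constructor; auto; try lia.
  - right; exists (tb T x); split; auto; rewrite Nat.add_1_r; apply eqf_S; auto.
  - destruct H10 as [|[A B]]; auto; right; split; auto; lia.
Qed.

Lemma good_link_ext n w T T' u :
  (forall z, z <= tm T -> tb T' z = tb T z /\ td T' z = td T z) ->
  tl T' u = tl T u -> tm T <= tm T' -> 1 <= u <= tm T ->
  good_link n w T u -> good_link n w T' u.
Proof.
  intros H Hl Hm Hu (A & B & C); unfold good_link; rewrite Hl.
  destruct (H u) as [-> ->]; [lia|]; destruct A as [A1 A2].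
  destruct (H (tl T u)) as [E1 E2]; [lia|]; rewrite E1, E2.
  split; auto; unfold internal; rewrite E1, E2; split; lia.
Qed.

(** Removing the first letter from an occurrence of the head gives an earlier occurrence for the
    next suffix. Thus [D - 1] letters are known to match, and the branching of the head at depth [D]
    becomes the branching at the new [D0]. The search restarts from the link of [v], because [h] may
    have none yet. *)
Lemma descent_start n w i T T' p D0 v h D :
  text n w ->
  descent n w i T p D0 v D true ->
  (forall z, z <= tm T -> tb T' z = tb T z /\ td T' z = td T z) ->
  tm T <= tm T' ->
  good_link n w T' v ->
  internal n T' h -> td T' h = D -> eqf w (tb T' h) i D ->
  (forall u, internal n T' u -> u <> h -> good_link n w T' u) ->
  (good_link n w T' h \/
   (0 < D /\ exists j, 1 <= j < i /\ eqf w j i D /\ w (j + D) <> w (i + D))) ->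
  descent n w (i + 1) T' h (D - 1) (tl T' v) (D - 1) false.
Proof.
  intros Htext [H1 H2 H3 H4 H5 H6 H9 H10] Hext Hm Hv Hh HhD Hhe Hlinks Hbr.
  destruct (Hext v) as [E1 E2]; [destruct H1; lia|].
  pose proof Hv as (A & B & C).
  rewrite E1 in *; rewrite E2 in *.
  constructor; auto; try lia.
  - rewrite B; eapply eqf_trans; eauto; apply eqf_tail; auto.
  - destruct H5 as [H5|(j & Hj & Hji)]; [left; lia|].
    right; exists (j + 1); split; [lia|]; apply eqf_tail; auto.
  - split; auto; rewrite HhD; split; auto; apply eqf_tail; auto.
  - destruct Hbr as [|(HD & j & Hj & Hji & Hne)]; [left; auto|right; split; [lia|]].
    exists (j + 1); split; [lia|]; split; [apply eqf_tail; auto|].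
    replace (j + 1 + (D - 1)) with (j + D) by lia.
    now replace (i + 1 + (D - 1)) with (i + D) by lia.
Qed.

(** Here the head is the old node [v], which has its link already, so nothing is pending for the
    next suffix. *)
Lemma descent_stop_leaf n w i T p D0 v D :
  text n w -> 1 <= i <= n -> tm T + 1 < stride n ->
  trie n w i T -> descent n w i T p D0 v D true ->
  child n T v (w (i + td T v)) = 0 ->
  let T' := leaf_tree n w T i v (td T v) in
  D = td T v /\ ~ matched w i (S D) /\
  trie n w (i + 1) T' /\ td T' (tl T' v) = td T v - 1 /\
  descent n w (i + 1) T' v (D - 1) (tl T' v) (D - 1) false.
Proof.
  intros Htext Hi Hm HT HD Hx T'.
  destruct (descent_max_leaf HT HD Hx) as [ED Hmax].
  assert (Hp : good_link n w T p).
  { eapply descent_pending_ok; eauto. }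
  assert (Hext : forall z, z <= tm T -> tb T' z = tb T z /\ td T' z = td T z)
    by (intros; unfold T'; simpl; rewrite !upd_other by lia; auto).
  assert (Hall : forall u, internal n T' u -> good_link n w T' u).
  { intros u Hu; assert (u <= tm T).
    { destruct Hu as [Hu Hu']; destruct (Nat.eq_dec u (tm T + 1)) as [->|];
        [|unfold T' in Hu; simpl in Hu; lia].
      unfold T' in Hu'; simpl in Hu'; rewrite !upd_same in Hu'; lia. }
    destruct Hu as [Hu Hu']; destruct (Hext u) as [E1 E2]; auto; rewrite E1, E2 in Hu'.
    apply good_link_ext with T; auto; [simpl; lia|lia|].
    destruct (Nat.eq_dec u p) as [->|]; auto.
    eapply descent_links; eauto; split; auto; lia. }
  pose proof (descent_node HD) as Hv.
  pose proof (descent_eqf HD) as He.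
  assert (Hv' : internal n T' v).
  { destruct Hv as [A B]; destruct (Hext v) as [E1 E2]; [lia|].
    split; [simpl; lia|rewrite E1, E2; auto]. }
  pose proof (descent_matched HD) as Hmt.
  split; auto; split; auto; split.
  - apply leaf_trie; auto; rewrite <- ED; auto.
    + destruct Hmt as [|Hmt]; [lia|]; eapply matched_length; eauto; lia.
    + intros j Hj Hji; apply Hmax; exists j; auto.
  - destruct (Hext v) as [E1 E2]; [destruct Hv; lia|].
    split; [destruct (Hall v Hv') as (_ & -> & _); rewrite E2; auto|].
    eapply descent_start; eauto; rewrite ?E1, ?E2; try (simpl; lia); auto.
    rewrite ED; auto.
Qed.

(** The node [y] made by the split is the new head and the only node without a link. When [D = D0],
    it is itself the missing target of the link of [p]; when [D] is larger, that link has been set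
    on the way. *)
Lemma descent_stop_split n w i T p D0 v D :
  let x := child n T v (w (i + td T v)) in
  text n w -> 1 <= i <= n -> tm T + 2 < stride n ->
  trie n w i T -> descent n w i T p D0 v D true ->
  x <> 0 -> D < td T x -> w (i + D) <> w (tb T x + D) ->
  let y := tm T + 1 in
  let T1 := split_tree n w T v (w (i + td T v)) x D in
  let T2 := set_links T1 (if D =? D0 then upd (tl T) p y else tl T) in
  let T' := leaf_tree n w T2 i y D in
  td T v < D /\ ~ matched w i (S D) /\ 1 <= tb T x < i /\ eqf w (tb T x) i D /\
  trie n w (i + 1) T' /\ td T' (tl T' v) = td T v - 1 /\
  descent n w (i + 1) T' y (D - 1) (tl T' v) (D - 1) false.
Proof.
  intros x Htext Hi Hm HT HD Hx Hlt Hne y T1 T2 T'.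
  destruct (descent_max_split _ _ _ _ _ _ _ _ _ HT HD Hx Hlt Hne) as [HvD Hmax].
  assert (Hxi : eqf w (tb T x) i D) by (eapply descent_edge; eauto; apply Nat.lt_le_incl; exact Hlt).
  pose proof (descent_node HD) as Hv.
  destruct (trie_edge HT v _ x (proj1 Hv) eq_refl Hx) as (Xm & Xd & Xe & Xa & Xc).
  destruct (trie_node HT x Xm) as (Xb & _ & Xl).
  split; auto; split; auto; split; auto; split; auto.
  assert (HT2 : trie n w i T2).
  { apply trie_set_links, split_trie; auto; lia. }
  assert (Hext2 : forall z, z <= tm T -> tb T2 z = tb T z /\ td T2 z = td T z)
    by (intros; unfold T2; simpl; rewrite !upd_other by lia; auto).
  assert (Hext : forall z, z <= tm T -> tb T' z = tb T z /\ td T' z = td T z).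
  { intros z Hz; destruct (Hext2 z Hz) as [<- <-]; unfold T', T2; simpl.
    rewrite !(upd_other _ (tm T + 1 + 1)) by lia; auto. }
  pose proof (descent_matched HD) as Hmt.
  destruct Hmt as [|Hmt]; [lia|].
  assert (HDn : D <= n + 1 - i) by (eapply matched_length; eauto; lia).
  assert (Hy2 : tb T2 y = tb T x /\ td T2 y = D)
    by (unfold T2; simpl; fold y; rewrite !upd_same; auto).
  destruct Hy2 as [Hyb Hyd].
  assert (Hyi : internal n T2 y).
  { split; [unfold T2, y; simpl; lia|]; rewrite Hyb, Hyd; lia. }
  assert (HT' : trie n w (i + 1) T').
  { apply leaf_trie; auto; [unfold T2; simpl; lia|rewrite Hyb; auto| |].
    - unfold T2; destruct (split_child n w T v (w (i + td T v)) x D y (w (i + D)))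
        as [(_ & E & _)|[(E & _)|(_ & _ & E)]]; try (destruct Hv; unfold y in *; lia).
      unfold child, set_links; simpl in *; unfold child in E; simpl in E; rewrite E.
      apply (trie_fresh HT y); unfold y; lia.
    - intros j Hj Hji; apply Hmax; exists j; auto. }
  split; auto.
  assert (Hy' : tb T' y = tb T x /\ td T' y = D).
  { rewrite <- Hyb, <- Hyd; unfold T'; simpl.
    rewrite !(upd_other _ (tm T + 1 + 1)) by (unfold y; lia); auto. }
  destruct Hy' as [Hyb' Hyd'].
  assert (Hlinks : forall u, internal n T' u -> u <> y -> good_link n w T' u).
  { intros u Hu Huy.
    assert (u <= tm T).
    { destruct Hu as [Hu Hu']; destruct (Nat.eq_dec u (tm T + 1 + 1)) as [->|];
        [|unfold T', y in *; simpl in Hu; lia].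
      unfold T' in Hu'; simpl in Hu'; rewrite !upd_same in Hu'; lia. }
    assert (HuT : internal n T u).
    { destruct Hu as [Hu Hu']; destruct (Hext u) as [E1 E2]; auto; rewrite E1, E2 in Hu'.
      split; lia. }
    destruct (descent_head HD) as (P1 & P2 & P3).
    pose proof (descent_D0 HD) as HD0.
    destruct (Nat.eqb_spec D D0) as [ED|ED].
    - destruct (Nat.eq_dec u p) as [->|Hup].
      + unfold good_link.
        assert (El : tl T' p = y) by (unfold T', T2; simpl; apply upd_same).
        rewrite El, Hyb', Hyd'; destruct (Hext p) as [E1 E2]; auto; rewrite E1, E2.
        split; [|split; [lia|]].
        * split; [unfold T', T2, y; simpl; lia|rewrite Hyb', Hyd'; lia].
        * rewrite <- P2; eapply eqf_trans; [eapply eqf_le; eauto; lia|].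
          apply eqf_sym; auto.
      + apply good_link_ext with T; auto; try (destruct HuT; unfold T', T2; simpl; lia).
        * unfold T', T2; simpl; apply upd_other; auto.
        * eapply descent_links; eauto.
    - apply good_link_ext with T; auto; try (destruct HuT; unfold T', T2; simpl; lia).
      destruct (Nat.eq_dec u p) as [->|Hup]; [|eapply descent_links; eauto].
      eapply descent_pending_ok; eauto; [right; split; auto; lia|left; fold x; lia]. }
  destruct Hv as [Hv1 Hv2]; destruct (Hext v) as [E1 E2]; [lia|].
  assert (Hlv : good_link n w T' v)
    by (apply Hlinks; [split; [unfold T', T2; simpl; lia|lia]|unfold y; lia]).
  split; [destruct Hlv as (_ & -> & _); rewrite E2; auto|].
  eapply descent_start; eauto; rewrite ?Hyb', ?Hyd'; auto.
  - unfold T', T2; simpl; lia.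
  - split; [unfold T', T2, y; simpl; lia|lia].
  - right; split; [lia|]; exists (tb T x); auto.
Qed.

(** What zero-initialised arrays represent once [m] and the link of the root are set. The root is
    node 1, as 0 stands for a missing child. *)
Definition one_node (T : tree) : Prop :=
  (forall x, tb T x = 0) /\ (forall x, td T x = 0) /\ (forall x, tc T x = 0) /\
  tl T 1 = 1 /\ tm T = 1.

Lemma one_node_trie n w T : one_node T -> trie n w 1 T.
Proof.
  intros (Hb & Hd & Hc & Hl & Hm).
  constructor; unfold internal, child; rewrite ?Hm; intros; rewrite ?Hb, ?Hd, ?Hc in *;
    try lia.
  unfold stride; lia.
Qed.

Lemma one_node_descent n w T : one_node T -> descent n w 1 T 1 0 1 0 false.
Proof.
  intros (Hb & Hd & Hc & Hl & Hm).
  assert (H1 : internal n T 1) by (unfold internal; rewrite Hb, Hd, Hm; lia).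
  constructor; rewrite ?Hd; auto; try lia; try (intros y Hy; lia).
  - split; auto; split; auto; intros y Hy; lia.
  - intros u [Hu _] Hu1; lia.
  - left; unfold good_link; rewrite Hl, Hd; split; auto; split; auto; intros y Hy; lia.
Qed.

(** * The factorisation program *)

Local Open Scope string_scope.
Local Open Scope prog_scope.
Local Infix "*" := (Op OpMul) : prog_scope.

Definition descend : com :=
  While ("go" =? 1) (
    If ("d".["v"] =? "D0") ("link".["pend" <- "v"]) Skip ;;
    "x" <- "child".["w".["i" + "d".["v"]] * "S" + "v"] ;;
    If ("x" =? 0) ("go" <- 0)
    (If ("d".["x"] <=? "D") ("v" <- "x")
    (If ("w".["i" + "D"] =? "w".["b".["x"] + "D"]) ("D" <- "D" + 1) ("go" <- 0)))).

Definition insert_suffix : com :=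
  If ("x" =? 0)
    ("h" <- "v" ;; "q" <- "b".["v"])
    ("m" <- "m" + 1 ;;
     "h" <- "m" ;;
     "q" <- "b".["x"] ;;
     "child".["w".["i" + "d".["v"]] * "S" + "v" <- "h"] ;;
     "child".["w".["q" + "D"] * "S" + "h" <- "x"] ;;
     "b".["h" <- "q"] ;;
     "d".["h" <- "D"] ;;
     If ("D" =? "D0") ("link".["pend" <- "h"]) Skip) ;;
  "m" <- "m" + 1 ;;
  "b".["m" <- "i"] ;;
  "d".["m" <- "n" + 2 - "i"] ;;
  "child".["w".["i" + "D"] * "S" + "h" <- "m"].

Definition emit_phrase : com :=
  If ("s" =? "i")
    (If ("D" =? 0)
       ("s" <- "s" + 1)
       ("pocz".["i" <- "q"] ;;
        "kon".["i" + "D" - 1 <- 1] ;;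
        "s" <- "s" + "D"))
    Skip.

Definition lz77 : com :=
  "m" <- 1 ;; "S" <- "n" + "n" + 3 ;; "link".[1 <- 1] ;;
  "v" <- 1 ;; "D" <- 0 ;; "pend" <- 1 ;; "s" <- 1 ;; "i" <- 1 ;;
  While ("i" <=? "n") (
    "D0" <- "D" ;;
    "go" <- 1 ;;
    descend ;;
    insert_suffix ;;
    emit_phrase ;;
    "pend" <- "h" ;; "v" <- "link".["v"] ;; "D" <- "D" - 1 ;; "i" <- "i" + 1).

Local Close Scope prog_scope.
Local Open Scope list_scope.
Local Open Scope nat_scope.

Definition tree_of (s : state) : tree :=
  Tree (arr s "b") (arr s "d") (arr s "child") (arr s "link") (var s "m").

Definition searching (n : nat) (w : nat -> nat) (s : state) (go : bool) : Prop :=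
  var s "n" = n /\ var s "S" = stride n /\ arr s "w" = w /\
  1 <= var s "i" <= n /\ var s "i" + var s "D" <= n + 1 /\
  trie n w (var s "i") (tree_of s) /\
  descent n w (var s "i") (tree_of s) (var s "pend") (var s "D0") (var s "v")
    (var s "D") (negb go).

Definition stopped (n : nat) (w : nat -> nat) (s : state) : Prop :=
  let T := tree_of s in
  var s "x" = child n T (var s "v") (w (var s "i" + td T (var s "v"))) /\
  (var s "x" = 0 \/
   var s "x" <> 0 /\ var s "D" < td T (var s "x") /\
   w (var s "i" + var s "D") <> w (tb T (var s "x") + var s "D")).

(** The sums [i + d v] and [i + D] never exceed [n + 1]. A hop raises the first, a comparison that
    succeeds raises the second, and passing to the next suffix lowers neither, since a suffix link
    loses a single letter. *)
Definition search_potential (n : nat) (s : state) : nat :=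
  20 * ((2 * n + 2) - (var s "i" + arr s "d" (var s "v")) - (var s "i" + var s "D")).

Lemma descend_correct W n w A s :
  text n w -> (forall x, 1 <= x <= n -> w x <= A) -> A * stride n + stride n + 10 < W ->
  bounded W s -> searching n w s true -> var s "go" = 1 ->
  runs W descend s (fun t s' =>
    searching n w s' false /\ stopped n w s' /\
    t + search_potential n s' <= search_potential n s + 30).
Proof.
  intros Htext HA HW HB Hs Hgo.
  eapply runs_conseq.
  (* The summand [20 * go] pays for the last iteration, which raises neither sum in the
     potential. *)
  - apply runs_while with
      (I := fun s => (var s "go" = 1 /\ searching n w s true) \/
                     (var s "go" = 0 /\ searching n w s false /\ stopped n w s))
      (P := fun s => search_potential n s + 20 * var s "go"); auto.
    + intros s' HB' _; simpl; lia.
    + clear s HB Hs Hgo; intros [vr ar] HB HI Hb.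
      simpl in Hb; apply Nat.eqb_eq in Hb.
      destruct HI as [[Hgo Hs]|[Hgo _]]; [|simpl in Hgo; lia].
      unfold searching, tree_of in Hs.
      cbn [var arr] in Hs, Hgo, Hb.
      destruct Hs as (Hn & HS & Hw & Hi & HiD & HT & HD).
      set (T := Tree (ar "b") (ar "d") (ar "child") (ar "link") (vr "m")) in *.
      pose proof (descent_link _ _ _ _ _ _ _ _ HD) as HD1.
      pose proof (descent_depth HD) as Hd; simpl in Hd.
      destruct (descent_node HD) as [Hv1 Hv2]; simpl in Hv1, Hv2.
      destruct (trie_count HT) as [_ Hcount]; simpl in Hcount.
      set (T1 := set_links T _) in HD1.
      assert (HT1 : trie n w (vr "i") T1) by (apply trie_set_links; auto).
      assert (Hwl : forall k, 1 <= k <= n + 1 -> w k <= A).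
      { intros k Hk; destruct (Nat.eq_dec k (n + 1)) as [->|]; [|apply HA; lia].
        destruct Htext as [_ ->]; lia. }
      assert (Hidx : ar "w" (vr "i" + ar "d" (vr "v")) * vr "S" + vr "v" < W /\
                     ar "w" (vr "i" + ar "d" (vr "v")) * vr "S" < W).
      { rewrite Hw, HS; pose proof (Hwl (vr "i" + ar "d" (vr "v")) ltac:(lia)).
        split; nia. }
      assert (Hsn : n + n + 3 = stride n) by reflexivity.
      set (x := ar "child" (ar "w" (vr "i" + ar "d" (vr "v")) * vr "S" + vr "v")).
      assert (Hx : child n T1 (vr "v") (w (vr "i" + td T1 (vr "v"))) = x).
      { unfold child, T1, set_links, x; simpl; now rewrite Hw, HS. }
      assert (Hxb : x <> 0 -> 1 <= ar "b" x < vr "i").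
      { intros Hx0; rewrite <- Hx in Hx0.
        destruct (trie_edge HT1 _ _ _ Hv1 eq_refl Hx0) as (X1 & _).
        destruct (trie_node HT1 _ X1) as (X2 & _); rewrite Hx in X2; exact X2. }
      assert (Hgoal : forall lk, T1 = Tree (ar "b") (ar "d") (ar "child") lk (vr "m") ->
        (x <> 0 -> td T1 x <= vr "D" -> ar "d" (vr "v") < ar "d" x /\
           descent n w (vr "i") (Tree (ar "b") (ar "d") (ar "child") lk (vr "m"))
             (vr "pend") (vr "D0") x (vr "D") false /\ vr "i" + ar "d" x <= n + 1) /\
        (x <> 0 -> vr "D" < td T1 x -> w (vr "i" + vr "D") = w (ar "b" x + vr "D") ->
           descent n w (vr "i") (Tree (ar "b") (ar "d") (ar "child") lk (vr "m"))
             (vr "pend") (vr "D0") (vr "v") (vr "D" + 1) false /\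
           vr "i" + (vr "D" + 1) <= n + 1)).
      { intros lk E; rewrite <- E; split; intros Hx0 Hle.
        - destruct (descent_hop n w (vr "i") T1 (vr "pend") (vr "D0") (vr "v") (vr "D"))
            as [H1 H2]; auto; rewrite Hx in *; auto.
          split; [exact H1|]; split; auto.
          pose proof (descent_depth H2); unfold T1 in H; simpl in H; lia.
        - intros Hxe.
          assert (H2 : descent n w (vr "i") T1 (vr "pend") (vr "D0") (vr "v") (vr "D" + 1) false).
          { apply descent_scan; rewrite ?Hx; auto. }
          split; auto.
          destruct (descent_matched H2) as [|Hm]; [lia|].
          pose proof (matched_length n w (vr "i") _ Htext ltac:(lia) Hm); lia. }
      assert (Hlink : forall lk, T1 = Tree (ar "b") (ar "d") (ar "child") lk (vr "m") ->
        trie n w (vr "i") (Tree (ar "b") (ar "d") (ar "child") lk (vr "m")) /\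
        descent n w (vr "i") (Tree (ar "b") (ar "d") (ar "child") lk (vr "m"))
             (vr "pend") (vr "D0") (vr "v") (vr "D") true) by (intros lk <-; auto).
      unfold T1, set_links in Hgoal, Hlink, Hx; simpl in Hgoal, Hlink, Hx.
      wpsimpl; fold x; fold x in Hidx.
      destruct (Nat.eqb_spec (ar "d" (vr "v")) (vr "D0")) as [Ed|Ed];
      wpsplit; try lia; destruct (Hgoal _ eq_refl) as [G1 G2];
        destruct (Hlink _ eq_refl) as [L1 L2]; rewrite ?Hw in *.
      all: match goal with
           | |- _ \/ _ => idtac
           | |- _ => cbv [search_potential var arr String.eqb Ascii.eqb Bool.eqb]
           end.
      all: try lia.
      all: match goal with |- (0 = 1 /\ _) \/ _ => right | |- _ => left end.
      all: cbv [searching stopped tree_of var arr String.eqb Ascii.eqb Bool.eqb negb].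
      all: ands; try lia; try exact Hn; try exact HS; try exact Hw; try exact L1.
      all: try exact L2; try exact (proj1 (proj2 (G1 E E0))).
      all: try exact (proj1 (G2 E E0 E1)).
      all: try (unfold child, td; rewrite <- Hx; reflexivity).
      all: try (left; exact E); try (right; repeat split; [exact E|exact E0|exact E1]).
      all: try (specialize (G1 E E0); lia); try (specialize (G2 E E0 E1); lia).
  - cbn beta; intros t s' ([[Hgo' _]|(_ & Hs' & Hst)] & Hb & Ht).
    + simpl in Hb; rewrite Hgo' in Hb; discriminate.
    + split; auto; split; auto; lia.
Qed.


Definition inserted (n : nat) (w : nat -> nat) (i D s : nat) (pocz kon : nat -> nat) (k : nat)
    (s' : state) : Prop :=
  var s' "n" = n /\ var s' "S" = stride n /\ arr s' "w" = w /\
  var s' "i" = i /\ var s' "D" = D /\ var s' "s" = s /\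
  arr s' "pocz" = pocz /\ arr s' "kon" = kon /\
  let T := tree_of s' in
  let v := tl T (var s' "v") in
  trie n w (i + 1) T /\ td T v = k - 1 /\ tm T <= 2 * i + 1 /\
  descent n w (i + 1) T (var s' "h") (D - 1) v (D - 1) false /\
  ~ matched w i (S D) /\
  (0 < D -> 1 <= var s' "q" < i /\ eqf w (var s' "q") i D).

Lemma insert_correct W n w A s :
  text n w -> (forall x, 1 <= x <= n -> w x <= A) -> A * stride n + stride n + 10 < W ->
  searching n w s false -> stopped n w s -> var s "m" <= 2 * var s "i" - 1 ->
  wp W insert_suffix s (fun t s' =>
    inserted n w (var s "i") (var s "D") (var s "s") (arr s "pocz") (arr s "kon")
      (arr s "d" (var s "v")) s' /\ t <= 20).
Proof.
  intros Htext HA HW; destruct s as [vr ar].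
  intros (Hn & HS & Hw & Hi & HiD & HT & HD) [Hx Hst] Hm.
  assert (Hwl : forall k, 1 <= k <= n + 1 -> w k <= A).
  { intros k Hk; destruct (Nat.eq_dec k (n + 1)) as [->|]; [|apply HA; lia].
    destruct Htext as [_ ->]; lia. }
  assert (Hsn : n + n + 3 = stride n) by reflexivity.
  pose proof (descent_depth HD) as Hd; simpl in Hd.
  destruct (descent_node HD) as [Hv1 Hv2]; simpl in Hv1, Hv2.
  pose proof (descent_eqf HD) as Hve; simpl in Hve.
  pose proof (trie_root HT) as [_ Hr]; simpl in Hr.
  pose proof (trie_node HT (vr "v")) as Hvb; simpl in Hvb.
  cbn [var arr] in *.
  assert (Hidx : forall k v, 1 <= k <= n + 1 -> v <= 2 * n + 2 ->
                  w k * stride n + v < W /\ w k * stride n < W).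
  { intros k v Hk Hv; specialize (Hwl k Hk); split; nia. }
  destruct Hst as [Hx0|(Hx0 & HxD & Hne)].
  - destruct (descent_stop_leaf n w (vr "i") (tree_of (State vr ar)) (vr "pend") (vr "D0")
                (vr "v") (vr "D")) as (ED & Hmax & HT' & Hk & HD'); auto.
    { simpl; lia. }
    { rewrite <- Hx; auto. }
    simpl in ED.
    pose proof (Hidx (vr "i" + vr "D") (vr "v") ltac:(lia) ltac:(lia)).
    unfold insert_suffix; wpsimpl; rewrite Hx0, Hn, HS, Hw; wpsplit; try lia.
    unfold inserted; cbv [var arr String.eqb Ascii.eqb Bool.eqb tree_of].
    rewrite ED in *; ands; auto; try lia.
    all: try first [exact HT' | exact Hk | simpl; lia | exact HD'].
    all: try (intros; exact Hve).
    + intros Hd0; split; auto.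
      destruct (Nat.eq_dec (vr "v") 1) as [E1|]; [rewrite E1 in *; lia|].
      apply Hvb; lia.
  - simpl in HxD, Hne; rewrite Hx in Hx0, HxD, Hne.
    destruct (descent_stop_split n w (vr "i") (tree_of (State vr ar)) (vr "pend") (vr "D0")
                (vr "v") (vr "D")) as (ED & Hmax & Hq & Hqe & HT' & Hk & HD'); auto.
    { simpl; lia. }
    rewrite <- Hx in Hx0, HxD, Hne, Hq, Hqe, HT', Hk, HD'.
    simpl in Hq, Hqe.
    pose proof (Hidx (vr "i" + ar "d" (vr "v")) (vr "v") ltac:(lia) ltac:(lia)).
    pose proof (Hidx (ar "b" (vr "x") + vr "D") (vr "m" + 1) ltac:(lia) ltac:(lia)).
    pose proof (Hidx (vr "i" + vr "D") (vr "m" + 1) ltac:(lia) ltac:(lia)).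
    unfold insert_suffix; wpsimpl; rewrite Hn, HS, Hw.
    destruct (Nat.eqb_spec (vr "D") (vr "D0")) as [E0|E0]; wpsplit; try lia;
    unfold inserted; cbv [var arr String.eqb Ascii.eqb Bool.eqb tree_of];
    ands; auto; try lia; try (intros; split; auto; fail).
    all: first [exact HT' | exact Hk | simpl; lia | exact HD'].
Qed.

(** * Factorisations stored in arrays *)

(** The default 0 behind the word serves as the end letter of [text]. By truncated subtraction
    position 0 reads the first letter, so agreement with the array [w] is only claimed from position
    1 on. *)
Definition letter (u : word) : nat -> nat := fun i => nth (i - 1) u 0.

(** The arrays [pocz] and [kon] describe the factorisation [F] of the positions
    before [b]. *)
Inductive parsed (w pocz kon : nat -> nat) : nat -> list phrase -> Prop :=
| parsed_nil : parsed w pocz kon 1 []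
| parsed_free b F :
    parsed w pocz kon b F -> pocz b = 0 -> kon b = 0 ->
    parsed w pocz kon (b + 1) (F ++ [Free (w b)])
| parsed_factor b F j l :
    parsed w pocz kon b F -> 1 <= j < b -> 1 <= l -> pocz b = j ->
    (forall i, b < i < b + l -> pocz i = 0) -> kon (b + l - 1) = 1 ->
    (forall i, b <= i < b + l - 1 -> kon i = 0) -> eqf w j b l ->
    parsed w pocz kon (b + l) (F ++ [Factor j l]).

Lemma parsed_pos w pocz kon b F : parsed w pocz kon b F -> 1 <= b.
Proof. induction 1; lia. Qed.

Arguments parsed_pos {w pocz kon b F}.

Lemma parsed_ext w pocz kon pocz' kon' b F :
  parsed w pocz kon b F ->
  (forall i, 1 <= i < b -> pocz' i = pocz i /\ kon' i = kon i) ->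
  parsed w pocz' kon' b F.
Proof.
  induction 1 as [|b F HF IH H1 H2|b F j l HF IH H1 H2 H3 H4 H5 H6 H7]; intros H;
    try pose proof (parsed_pos HF).
  - constructor.
  - destruct (H b) as [E1 E2]; [lia|].
    apply parsed_free; [apply IH; intros; apply H; lia|congruence|congruence].
  - apply parsed_factor; auto.
    + apply IH; intros; apply H; lia.
    + destruct (H b) as [-> _]; [lia|]; auto.
    + intros i Hi; destruct (H i) as [-> _]; [lia|]; auto.
    + destruct (H (b + l - 1)) as [_ ->]; [lia|]; auto.
    + intros i Hi; destruct (H i) as [_ ->]; [lia|]; auto.
Qed.

Lemma unfactor_app u F1 F2 : unfactor u (F1 ++ F2) = unfactor u F1 ++ unfactor u F2.
Proof. unfold unfactor; now rewrite map_app, concat_app. Qed.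

Lemma unfactor_one u f : unfactor u [f] = phrase_word u f.
Proof. unfold unfactor; simpl; apply app_nil_r. Qed.

Lemma nth_subword u j l k : k < l -> nth k (subword u j l) 0 = nth (j - 1 + k) u 0.
Proof.
  intros Hk; unfold subword; rewrite nth_firstn.
  apply Nat.ltb_lt in Hk; rewrite Hk; apply nth_skipn.
Qed.

Lemma length_subword u j l :
  1 <= j -> j + l - 1 <= length u -> length (subword u j l) = l.
Proof. intros; unfold subword; rewrite length_firstn, length_skipn; lia. Qed.

Lemma snoc_inv {A} (F : list A) x F1 f F2 :
  F ++ [x] = F1 ++ f :: F2 ->
  (F2 = [] /\ F = F1 /\ x = f) \/ (exists F2', F2 = F2' ++ [x] /\ F = F1 ++ f :: F2').
Proof.
  intros E; destruct F2 as [|y F2] using rev_ind.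
  - left; apply app_inj_tail in E as [-> ->]; auto.
  - right; clear IHF2; exists F2.
    replace (F1 ++ f :: F2 ++ [y]) with ((F1 ++ f :: F2) ++ [y]) in E
      by (now rewrite <- app_assoc).
    apply app_inj_tail in E as [-> ->]; auto.
Qed.

Lemma firstn_add {A} (u : list A) p q : firstn (p + q) u = firstn p u ++ firstn q (skipn p u).
Proof.
  revert u; induction p as [|p IH]; intros [|x u]; simpl; auto.
  - now rewrite firstn_nil.
  - now rewrite IH.
Qed.

Lemma firstn_letter u k :
  1 <= k <= length u -> firstn k u = firstn (k - 1) u ++ [letter u k].
Proof.
  intros Hk; replace k with (k - 1 + 1) at 1 by lia; rewrite firstn_add; f_equal.
  unfold letter; rewrite <- (Nat.add_0_r (k - 1)) at 2; rewrite <- nth_skipn.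
  pose proof (length_skipn (k - 1) u).
  destruct (skipn (k - 1) u); simpl in *; [lia|reflexivity].
Qed.

Lemma subword_eq u i j l :
  1 <= i -> 1 <= j -> i + l - 1 <= length u -> j + l - 1 <= length u ->
  eqf (letter u) i j l -> subword u i l = subword u j l.
Proof.
  intros Hi Hj Hil Hjl He.
  apply (nth_ext _ _ 0 0); rewrite !length_subword by lia; auto.
  intros k Hk; rewrite !nth_subword by lia.
  specialize (He k Hk); unfold letter in He.
  replace (i + k - 1) with (i - 1 + k) in He by lia.
  now replace (j + k - 1) with (j - 1 + k) in He by lia.
Qed.

Lemma parsed_unfactor u pocz kon b F :
  parsed (letter u) pocz kon b F -> b <= length u + 1 ->
  unfactor u F = firstn (b - 1) u.
Proof.
  induction 1 as [|b F HF IH H1 H2|b F j l HF IH H1 H2 H3 H4 H5 H6 H7]; intros Hb.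
  - reflexivity.
  - apply parsed_pos in HF.
    rewrite unfactor_app, unfactor_one, IH by lia; simpl.
    rewrite Nat.add_sub; symmetry; apply firstn_letter; lia.
  - apply parsed_pos in HF.
    rewrite unfactor_app, unfactor_one, IH by lia; simpl.
    replace (b + l - 1) with (b - 1 + l) by lia.
    rewrite firstn_add; f_equal.
    apply (subword_eq u j b l); auto; lia.
Qed.

Lemma parsed_length u pocz kon b F :
  parsed (letter u) pocz kon b F -> b <= length u + 1 ->
  length (unfactor u F) + 1 = b.
Proof.
  intros HF Hb; rewrite (parsed_unfactor _ _ _ _ _ HF Hb), length_firstn.
  apply parsed_pos in HF; lia.
Qed.

Lemma parsed_phrases u pocz kon b F F1 f F2 :
  parsed (letter u) pocz kon b F -> b <= length u + 1 -> F = F1 ++ f :: F2 ->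
  let b := length (unfactor u F1) + 1 in
  match f with
  | Free _ => pocz b = 0 /\ kon b = 0
  | Factor j l =>
      (1 <= j < b /\ 1 <= l /\ b + l - 1 <= length u) /\
      pocz b = j /\ (forall i, b < i <= b + l - 1 -> pocz i = 0) /\
      kon (b + l - 1) = 1 /\ (forall i, b <= i < b + l - 1 -> kon i = 0)
  end.
Proof.
  intros HF; revert F1 f F2.
  induction HF as [|b F HF IH H1 H2|b F j l HF IH H1 H2 H3 H4 H5 H6 H7];
    intros F1 f F2 Hb E.
  - destruct F1; discriminate.
  - apply snoc_inv in E as [(-> & <- & <-)|(F2' & -> & E)].
    + cbv zeta; rewrite (parsed_length _ _ _ _ _ HF) by lia; auto.
    + apply (IH F1 f F2'); auto; lia.
  - apply snoc_inv in E as [(-> & <- & <-)|(F2' & -> & E)].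
    + cbv zeta; rewrite (parsed_length _ _ _ _ _ HF) by lia.
      repeat split; auto; try lia; intros i Hi; apply H4; lia.
    + apply (IH F1 f F2'); auto; lia.
Qed.

Lemma parsed_is_lz77 u pocz kon F :
  parsed (letter u) pocz kon (length u + 1) F -> is_lz77 u F.
Proof.
  intros HF; split.
  - rewrite (parsed_unfactor _ _ _ _ _ HF), Nat.add_sub, firstn_all; auto.
  - intros F1 j l F2 E.
    destruct (parsed_phrases _ _ _ _ _ _ _ _ HF ltac:(auto) E) as [H _]; lia.
Qed.

Lemma parsed_stores s u F :
  parsed (letter u) (arr s "pocz") (arr s "kon") (length u + 1) F -> stores_lz77 s u F.
Proof.
  intros HF F1 f F2 E b.
  pose proof (parsed_phrases _ _ _ _ _ _ _ _ HF ltac:(auto) E) as H; cbv zeta in H.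
  destruct f; fold b in H; tauto.
Qed.

(** [unfactor] reads definitions in the complete word, so a factor is just an equality of two
    windows of [u], whether they overlap or not. *)
Lemma lz77_phrase u F F1 f F2 :
  is_lz77 u F -> F = F1 ++ f :: F2 ->
  let b := length (unfactor u F1) + 1 in
  match f with
  | Free a => letter u b = a /\ b <= length u /\ length (unfactor u (F1 ++ [f])) = b
  | Factor j l =>
      1 <= j < b /\ 1 <= l /\ b + l - 1 <= length u /\ eqf (letter u) j b l /\
      length (unfactor u (F1 ++ [f])) = b + l - 1
  end.
Proof.
  intros [Eu HF] E b.
  assert (Eu' : u = unfactor u F1 ++ phrase_word u f ++ unfactor u F2).
  { rewrite Eu at 1; rewrite E, unfactor_app; reflexivity. }
  rewrite unfactor_app, unfactor_one, length_app.
  assert (Hlen : length u = length (unfactor u F1) + (length (phrase_word u f) + length (unfactor u F2)))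
    by (rewrite Eu' at 1; now rewrite !length_app).
  assert (Hn : forall k, k < length (phrase_word u f) ->
            letter u (b + k) = nth k (phrase_word u f) 0).
  { intros k Hk; unfold letter; rewrite Eu' at 1.
    replace (b + k - 1) with (length (unfactor u F1) + k) by (unfold b; lia).
    rewrite app_nth2_plus, app_nth1; auto. }
  destruct f as [a|j l].
  - simpl in *; specialize (Hn 0 ltac:(lia)); rewrite Nat.add_0_r in Hn; simpl in Hn.
    unfold b in *; repeat split; auto; lia.
  - destruct (HF F1 j l F2 E) as (H1 & H2 & H3).
    cbn [phrase_word] in *; rewrite length_subword in * by lia.
    unfold b in *; repeat split; auto; try lia.
    intros k Hk; rewrite Hn by auto; rewrite nth_subword by auto.
    unfold letter; f_equal; lia.
Qed.

Lemma lz77_parsed s u F F1 F2 :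
  is_lz77 u F -> stores_lz77 s u F -> F = F1 ++ F2 ->
  parsed (letter u) (arr s "pocz") (arr s "kon") (length (unfactor u F1) + 1) F1.
Proof.
  intros HF HS; revert F2.
  induction F1 as [|f F1 IH] using rev_ind; intros F2 E.
  - constructor.
  - rewrite <- app_assoc in E; simpl in E; specialize (IH _ E).
    pose proof (lz77_phrase u F F1 f F2 HF E) as H.
    pose proof (HS F1 f F2 E) as H'; cbv zeta in *.
    destruct f as [a|j l].
    + destruct H as (<- & H1 & ->), H' as [H2 H3].
      apply parsed_free; auto.
    + destruct H as (H1 & H2 & H3 & H4 & ->), H' as (H5 & H6 & H7 & H8).
      replace (length (unfactor u F1) + 1 + l - 1 + 1) with (length (unfactor u F1) + 1 + l) by lia.
      apply parsed_factor; auto; intros i Hi; apply H6; lia.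
Qed.

(** * Optimality of greedy parsing *)

(** [reach w b k]: some [k] valid phrases cover exactly the positions before [b]. *)
Inductive reach (w : nat -> nat) : nat -> nat -> Prop :=
| reach_nil : reach w 1 0
| reach_free b k : reach w b k -> reach w (b + 1) (k + 1)
| reach_factor b k l : reach w b k -> matched w b l -> reach w (b + l) (k + 1).

Lemma lz77_reach u F F1 F2 :
  is_lz77 u F -> F = F1 ++ F2 ->
  reach (letter u) (length (unfactor u F1) + 1) (length F1).
Proof.
  intros HF; revert F2.
  induction F1 as [|f F1 IH] using rev_ind; intros F2 E.
  - constructor.
  - rewrite <- app_assoc in E; simpl in E; specialize (IH _ E).
    pose proof (lz77_phrase u F F1 f F2 HF E) as H; cbv zeta in *.
    rewrite length_app; cbn [length]; destruct f as [a|j l].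
    + destruct H as (_ & _ & ->); now apply reach_free.
    + destruct H as (H1 & H2 & H3 & H4 & ->).
      replace (length (unfactor u F1) + 1 + l - 1 + 1) with (length (unfactor u F1) + 1 + l) by lia.
      apply reach_factor; auto; exists j; auto.
Qed.

(** The strict part turns the comparison of positions into one of counts: fewer phrases cannot reach
    the end of the word. *)
Definition farthest (w : nat -> nat) (b k : nat) : Prop :=
  forall e k', reach w e k' -> k' <= k -> e <= b /\ (k' < k -> e < b).

Lemma matched_suffix w b b' l : matched w b l -> b <= b' -> matched w b' (l - (b' - b)).
Proof.
  intros (j & Hj & He) Hb; exists (j + (b' - b)); split; [lia|].
  intros y Hy; specialize (He (b' - b + y) ltac:(lia)).
  rewrite <- Nat.add_assoc, He; f_equal; lia.
Qed.

Lemma matched_le w b l l' : matched w b l -> l' <= l -> matched w b l'.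
Proof. intros (j & Hj & He) Hl; exists j; split; auto; eapply eqf_le; eauto. Qed.

(** Greedy parsing is optimal because suffixes of repeated words are repeated. *)
Lemma farthest_step w b k L :
  farthest w b k -> ~ matched w b (S L) -> farthest w (b + Nat.max 1 L) (k + 1).
Proof.
  intros HF HL.
  assert (Hlt : forall e k', reach w e k' -> k' < k + 1 -> e < b + Nat.max 1 L).
  { intros e k' He Hk; destruct (HF e k' He ltac:(lia)); lia. }
  intros e k' He Hk; split; [|intros; eauto].
  destruct (Nat.eq_dec k' (k + 1)) as [->|]; [|specialize (Hlt e k' He); lia].
  inversion He as [E|b0 k0 Hb0 E E'|b0 k0 l Hb0 Hm E E'].
  - lia.
  - assert (k0 = k) by lia; subst k0; destruct (HF b0 k Hb0 ltac:(lia)); lia.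
  - assert (k0 = k) by lia; subst k0; destruct (HF b0 k Hb0 ltac:(lia)) as [Hle _].
    destruct (le_lt_dec (b0 + l) (b + Nat.max 1 L)) as [|Hgt]; [lia|exfalso].
    apply HL; apply matched_le with (l - (b - b0)); [|lia].
    apply matched_suffix; auto.
Qed.

Lemma farthest_smallest u F :
  is_lz77 u F -> farthest (letter u) (length u + 1) (length F) -> smallest_lz77 u F.
Proof.
  intros HF Hfar; split; auto; intros F' HF'.
  pose proof (lz77_reach u F' F' [] HF' (eq_sym (app_nil_r _))) as Hr.
  rewrite <- (proj1 HF') in Hr.
  destruct (le_lt_dec (length F) (length F')) as [|Hlt]; auto.
  destruct (Hfar _ _ Hr ltac:(lia)) as [_ H]; specialize (H Hlt); lia.
Qed.

Lemma wp_mono W c s (Q Q' : nat -> state -> Prop) :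
  wp W c s Q -> (forall t s', Q t s' -> Q' t s') -> wp W c s Q'.
Proof.
  revert s Q Q'; induction c as [|x e|a e1 e2|c1 IH1 c2 IH2|b c1 IH1 c2 IH2|b c IH];
    simpl; intros s Q Q' H HQ; try (intuition; fail).
  - eapply IH1; [exact H|]; intros t1 s1 H1; eapply IH2; [exact H1|]; cbn beta; auto.
  - destruct H as (H & Ht & Hf); split; auto; split; intros E.
    + eapply IH1; [exact (Ht E)|]; cbn beta; auto.
    + eapply IH2; [exact (Hf E)|]; cbn beta; auto.
  - intros HB; eapply runs_conseq; eauto.
Qed.

Lemma wp_seq W c1 c2 s Q :
  wp W c1 s (fun t1 s1 => wp W c2 s1 (fun t2 s2 => Q (t1 + t2) s2)) ->
  wp W (Seq c1 c2) s Q.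
Proof. exact (fun H => H). Qed.

Definition greedy (n : nat) (w : nat -> nat) (s : state) : Prop :=
  var s "i" <= var s "s" <= n + 1 /\
  (forall x, var s "s" <= x -> arr s "pocz" x = 0 /\ arr s "kon" x = 0) /\
  exists F, parsed w (arr s "pocz") (arr s "kon") (var s "s") F /\
            farthest w (var s "s") (List.length F).

Definition scanning (n : nat) (w : nat -> nat) (s : state) : Prop :=
  var s "n" = n /\ var s "S" = stride n /\ arr s "w" = w /\
  1 <= var s "i" <= n + 1 /\ var s "i" + var s "D" <= n + 1 /\
  trie n w (var s "i") (tree_of s) /\ var s "m" <= 2 * var s "i" - 1 /\
  descent n w (var s "i") (tree_of s) (var s "pend") (var s "D") (var s "v")
    (var s "D") false /\
  greedy n w s.

Definition emit_advance : com :=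
  Seq emit_phrase
    (Seq (Asg "pend" "h") (Seq (Asg "v" (Get "link" "v"))
      (Seq (Asg "D" (Op OpSub "D" 1)) (Asg "i" (Op OpAdd "i" 1))))).

Lemma emit_correct W n w i D p pocz kon k F s :
  n + 10 < W -> 1 <= i <= n -> i + D <= n + 1 -> (D = 0 \/ matched w i D) ->
  i <= p <= n + 1 -> (forall x, p <= x -> pocz x = 0 /\ kon x = 0) ->
  parsed w pocz kon p F -> farthest w p (List.length F) ->
  inserted n w i D p pocz kon k s ->
  wp W emit_advance s (fun t s' =>
    scanning n w s' /\ var s' "i" = i + 1 /\ var s' "D" = D - 1 /\
    arr s' "d" (var s' "v") = k - 1 /\ t <= 20).
Proof.
  intros HW Hi HiD Hmat Hs Hz HF Hfar Hin; destruct s as [vr ar].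
  destruct Hin as (Hn & HS & Hw & Ei & ED & Es & Epocz & Ekon & HT & Hk & Hm & HD & Hmax & Hq).
  cbv [var arr String.eqb Ascii.eqb Bool.eqb] in *.
  subst p; unfold emit_advance, emit_phrase; wpsimpl; rewrite Ei, ED in *.
  assert (Hgoal : forall ar', 
    ar' "b" = ar "b" -> ar' "d" = ar "d" -> ar' "child" = ar "child" ->
    ar' "link" = ar "link" -> ar' "w" = ar "w" -> forall vr',
    vr' "m" = vr "m" -> vr' "n" = vr "n" -> vr' "S" = vr "S" ->
    vr' "pend" = vr "h" -> vr' "v" = ar "link" (vr "v") -> vr' "D" = D - 1 ->
    vr' "i" = i + 1 -> greedy n w (State vr' ar') ->
    scanning n w (State vr' ar')).
  { intros ar' A1 A2 A3 A4 A5 vr' V1 V2 V3 V4 V5 V6 V7 G.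
    unfold scanning, tree_of; cbn [var arr].
    rewrite A1, A2, A3, A4, A5, V1, V2, V3, V4, V5, V6, V7.
    ands; auto; try lia; first [exact HT|simpl in Hm; lia|exact HD]. }
  assert (Hq' : D <> 0 -> parsed w (upd pocz i (vr "q")) (upd kon (i + D - 1) 1) (i + D)
                  (F ++ [Factor (vr "q") D]) \/ vr "s" <> i).
  { intros HD0; destruct (Nat.eq_dec (vr "s") i) as [E|]; [left|auto].
    rewrite E in *; destruct (Hq ltac:(lia)) as [Hq1 Hq2].
    apply parsed_factor; auto; try lia.
    - eapply parsed_ext; eauto; intros x Hx; rewrite !upd_other by lia; auto.
    - apply upd_same.
    - intros x Hx; rewrite upd_other by lia; apply Hz; lia.
    - apply upd_same.
    - intros x Hx; rewrite upd_other by lia; apply Hz; lia. }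
  wpsplit; try lia; try (apply Hgoal; try reflexivity; clear Hgoal); try exact Hk.
  - unfold greedy; cbv [var arr String.eqb Ascii.eqb Bool.eqb]; rewrite Epocz, Ekon.
    rewrite E, E0 in *; ands; try lia.
    + intros x Hx; apply Hz; lia.
    + exists (F ++ [Free (w i)]); split.
      * destruct (Hz i) as [Z1 Z2]; [lia|]; apply parsed_free; auto.
      * rewrite length_app; apply (farthest_step w i (List.length F) 0); auto.
  - unfold greedy; cbv [var arr String.eqb Ascii.eqb Bool.eqb]; rewrite Epocz, Ekon.
    destruct (Hq' E0) as [HF'|]; [|contradiction].
    rewrite E in *; ands; try lia.
    + intros x Hx; destruct (Hz x) as [Z1 Z2]; [lia|].
      destruct (Nat.eqb_spec x i); [lia|]; destruct (Nat.eqb_spec x (i + D - 1)); [lia|]; auto.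
    + exists (F ++ [Factor (vr "q") D]); split; [exact HF'|].
      rewrite length_app; replace D with (Nat.max 1 D) by lia.
      apply farthest_step; auto.
  - unfold greedy; cbv [var arr String.eqb Ascii.eqb Bool.eqb]; rewrite Epocz, Ekon.
    ands; try lia; auto.
    exists F; auto.
Qed.

Lemma lz77_correct W n w A s :
  text n w -> (forall x, 1 <= x <= n -> w x <= A) -> A * stride n + stride n + 10 < W ->
  1 <= n -> bounded W s -> var s "n" = n -> arr s "w" = w ->
  (forall a x, a <> "w" -> arr s a x = 0) ->
  runs W lz77 s (fun t s' =>
    t <= 300 * n /\ arr s' "w" = w /\ var s' "n" = n /\
    exists F, parsed w (arr s' "pocz") (arr s' "kon") (n + 1) F /\
              farthest w (n + 1) (List.length F)).
Proof.
  intros Htext HA HW Hn HB En Ew Hz.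
  apply wp_runs; auto; destruct s as [vr ar]; cbn [var arr] in *.
  assert (Hsn : n + n + 3 = stride n) by reflexivity.
  unfold lz77; wpsimpl; rewrite En; wpsplit; try lia.
  intros HB1.
  eapply runs_conseq.
  (* The second summand of the potential pays for the bounded part of each round that the search
     potential does not cover. *)
  - apply runs_while with (I := scanning n w)
      (P := fun s => search_potential n s + 90 * (n + 1 - var s "i")); auto.
    + intros s _ _; simpl; auto.
    + clear HB1; intros s HB1 Hs Hb.
      simpl in Hb; apply Nat.leb_le in Hb.
      pose proof Hs as (Sn & SS & Sw & Si & SiD & ST & Sm & SD & Sg).
      rewrite Sn in Hb.
      destruct s as [vs as_]; cbn [var arr] in *.
      apply wp_seq; split; [exact I|].
      apply wp_seq; split; [simpl; lia|].
      apply wp_seq.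
      match goal with |- wp W descend ?s0 _ => set (s1 := s0) end.
      intros HB2.
      assert (Hsearch : searching n w s1 true).
      { unfold searching; ands; auto; try exact ST; try exact SD; simpl; lia. }
      eapply runs_conseq.
      { eapply runs_frame; [exact HB2|].
        apply (descend_correct W n w A); auto. }
      cbn beta; intros t s2 ((Hs2 & Hst & Ht) & HB3 & Fv & Fa).
      apply wp_seq.
      assert (Em : var s2 "m" = vs "m") by (rewrite Fv; reflexivity).
      assert (Ei : var s2 "i" = vs "i") by (rewrite Fv; reflexivity).
      assert (Es : var s2 "s" = vs "s") by (rewrite Fv; reflexivity).
      assert (Ep : arr s2 "pocz" = as_ "pocz") by (rewrite Fa; reflexivity).
      assert (Ek : arr s2 "kon" = as_ "kon") by (rewrite Fa; reflexivity).
      eapply wp_mono.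
      { apply (insert_correct W n w A); auto; rewrite Em, Ei; lia. }
      cbn beta; intros t1 s3 [Hins Ht1].
      match goal with |- wp W ?c s3 _ => change c with emit_advance end.
      pose proof Hs2 as (S2n & S2S & S2w & S2i & S2iD & S2T & S2D).
      pose proof (descent_matched S2D) as S2m.
      destruct Sg as (G1 & G2 & F & G3 & G4); cbn [var arr] in *.
      eapply wp_mono.
      { eapply emit_correct with (F := F); [..|exact Hins]; auto; try lia;
          rewrite ?Es, ?Ep, ?Ek, ?Ei; auto. }
      cbn beta; intros t2 s4 (H4 & E4i & E4D & E4d & Ht2).
      split; auto.
      unfold search_potential in *; rewrite E4i, E4D, E4d, Ei in *.
      assert (Q3 : var s1 "i" = vs "i" /\ var s1 "D" = vs "D" /\ var s1 "v" = vs "v" /\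
                   arr s1 "d" = as_ "d") by (ands; reflexivity).
      destruct Q3 as (Q3 & Q4 & Q5 & Q6); rewrite Q3, Q4, Q5, Q6 in *.
      change (var (State vs as_)) with vs; change (arr (State vs as_)) with as_.
      lia.
    + match goal with |- scanning _ _ ?s0 => set (s1 := s0) end.
      assert (H1 : one_node (tree_of s1)).
      { unfold one_node, tree_of, s1; simpl; ands; auto; intros; apply Hz; discriminate. }
      unfold scanning, greedy; ands; try (simpl; lia); auto.
      * apply one_node_trie; exact H1.
      * apply one_node_descent; exact H1.
      * intros x Hx; split; apply Hz; discriminate.
      * exists []; split; [constructor|].
        intros e k' He Hk; inversion He; simpl in *; lia.
  - cbn beta; intros t s' (Hs' & Hb & Ht).
    destruct Hs' as (Sn & SS & Sw & Si & SiD & ST & Sm & SD & Sg & Sz & F & HF & Hfar).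
    simpl in Hb; apply Nat.leb_gt in Hb.
    assert (var s' "s" = n + 1) by lia.
    rewrite H in *; ands; auto.
    + unfold search_potential in Ht; cbv [var arr String.eqb Ascii.eqb Bool.eqb] in Ht; lia.
    + exists F; auto.
Qed.

Lemma eqf_ext w w' n a b l :
  (forall i, 1 <= i < n -> w' i = w i) -> 1 <= a -> 1 <= b -> a + l <= n -> b + l <= n ->
  eqf w a b l -> eqf w' a b l.
Proof. intros H Ha Hb Hal Hbl He y Hy; rewrite !H by lia; auto. Qed.

Lemma parsed_word_ext w w' pocz kon b F :
  parsed w pocz kon b F -> (forall i, 1 <= i < b -> w' i = w i) -> parsed w' pocz kon b F.
Proof.
  induction 1 as [|b F HF IH H1 H2|b F j l HF IH H1 H2 H3 H4 H5 H6 H7]; intros H.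
  - constructor.
  - pose proof (parsed_pos HF); rewrite <- (H b) by lia.
    apply parsed_free; auto; apply IH; intros; apply H; lia.
  - apply parsed_factor; auto; [apply IH; intros; apply H; lia|].
    apply eqf_ext with w (b + l); auto; lia.
Qed.

Lemma reach_ext w w' e k :
  (forall i, 1 <= i -> w' i = w i) -> reach w e k -> reach w' e k.
Proof.
  intros H; induction 1 as [| |b k l Hr IH (j & Hj & He)]; constructor; auto.
  exists j; split; auto; intros y Hy; rewrite !H by lia; auto.
Qed.

(** The largest numbers met are the indices [a * stride + v] of the child table, with [a] at most
    [N ^ c]. The exponent 5 suffices since [N + 1] is at least 2, which gives
    [(N + 1) ^ 4 >= 16]. *)
Lemma word_bound_large c N : 1 <= N -> N ^ c * stride N + stride N + 10 < word_bound (c + 5) N.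
Proof.
  intros HN; unfold word_bound, stride; rewrite Nat.pow_add_r.
  assert (H1 : N ^ c <= (N + 1) ^ c) by (apply Nat.pow_le_mono_l; lia).
  assert (H2 : 1 <= (N + 1) ^ c).
  { rewrite <- (Nat.pow_1_l c) at 1; apply Nat.pow_le_mono_l; lia. }
  assert (H3 : 16 * (N + 1) <= (N + 1) ^ 5).
  { replace ((N + 1) ^ 5) with ((N + 1) ^ 4 * (N + 1)) by (simpl; ring).
    apply Nat.mul_le_mono_r; change 16 with (2 ^ 4); apply Nat.pow_le_mono_l; lia. }
  apply Nat.lt_le_trans with ((N + 1) ^ c * (16 * (N + 1))); [|apply Nat.mul_le_mono_l; auto].
  remember ((N + 1) ^ c) as P; nia.
Qed.

Lemma init_bounded c w k :
  admissible c w -> c + 5 <= k -> bounded (word_bound k (length w)) (init w).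
Proof.
  intros [Hne Hw] Hk.
  assert (HN : 1 <= length w) by (destruct w; simpl; [congruence|lia]).
  assert (HW : length w ^ c + length w + 2 < word_bound k (length w)).
  { apply Nat.lt_le_trans with (word_bound (c + 5) (length w)).
    - pose proof (word_bound_large c (length w) HN); unfold stride in *; nia.
    - unfold word_bound; apply Nat.pow_le_mono_r; lia. }
  split; intros; unfold init; cbn [var arr].
  - destruct (String.eqb _ _); lia.
  - destruct (String.eqb a "w" && (1 <=? i))%bool; [|lia].
    destruct (nth_in_or_default (i - 1) w 0) as [Hin| ->]; [|lia].
    rewrite Forall_forall in Hw; specialize (Hw _ Hin); lia.
Qed.

Theorem lz77_linear c : linear_lz77 c lz77.
Proof.
  exists 300, (c + 5); intros w Hw.
  pose proof (init_bounded c w (c + 5) Hw (le_n _)) as HB.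
  destruct Hw as [Hne Hw].
  assert (HN : 1 <= length w) by (destruct w; simpl; [congruence|lia]).
  rewrite Forall_forall in Hw.
  assert (Hin : forall x, 1 <= x <= length w -> In (nth (x - 1) w 0) w)
    by (intros; apply nth_In; lia).
  assert (Hl : forall i, 1 <= i -> arr (init w) "w" i = letter w i).
  { intros [|i] Hi; [lia|reflexivity]. }
  destruct (lz77_correct (word_bound (c + 5) (length w)) (length w) (arr (init w) "w")
              (length w ^ c) (init w)) as (t & s & HE & Ht & Hws & Hns & F & HF & Hfar); auto.
  - split.
    + intros x Hx; rewrite Hl by lia; specialize (Hw _ (Hin x Hx)); unfold letter; lia.
    + rewrite Hl by lia; apply nth_overflow; lia.
  - intros x Hx; rewrite Hl by lia; apply Hw, Hin; auto.
  - apply word_bound_large; auto.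
  - intros a x Ha; simpl; apply String.eqb_neq in Ha; now rewrite Ha.
  - exists t, s, F.
    assert (HF' : parsed (letter w) (arr s "pocz") (arr s "kon") (length w + 1) F).
    { apply parsed_word_ext with (1 := HF); intros; symmetry; apply Hl; lia. }
    assert (HLZ : is_lz77 w F) by (eapply parsed_is_lz77; eauto).
    split; auto; split; auto; split; [|split].
    + split; auto; intros i Hi; rewrite Hws; apply Hl; lia.
    + apply farthest_smallest; auto.
      intros e k He Hk; apply (Hfar e k); auto; eapply reach_ext; [|exact He]; exact Hl.
    + apply parsed_stores; auto.
Qed.

(** * Pairing *)

Definition factor_at (w pz kn : nat -> nat) (b j l : nat) : Prop :=
  1 <= j < b /\ 1 <= l /\ pz b = j /\
  (forall i, b < i < b + l -> pz i = 0) /\ kn (b + l - 1) = 1 /\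
  (forall i, b <= i < b + l - 1 -> kn i = 0) /\ eqf w j b l.

(** A factorisation of the positions [b], ..., [n] with [m] factors and [f] free letters. *)
Inductive rest (n : nat) (w pz kn : nat -> nat) : nat -> nat -> nat -> Prop :=
| rest_nil : rest n w pz kn (n + 1) 0 0
| rest_free b m f :
    pz b = 0 -> kn b = 0 -> rest n w pz kn (b + 1) m f -> rest n w pz kn b m (f + 1)
| rest_factor b j l m f :
    factor_at w pz kn b j l -> rest n w pz kn (b + l) m f -> rest n w pz kn b (m + 1) f.

(** The same for the positions before [b], where every pair has both ends free or both
    ends in the same factor, which is paired like its definition. *)
Inductive done (pr w pz kn : nat -> nat) : nat -> nat -> nat -> Prop :=
| done_nil : done pr w pz kn 1 0 0
| done_single b m f :
    done pr w pz kn b m f -> pr b = pN -> pz b = 0 -> kn b = 0 ->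
    done pr w pz kn (b + 1) m (f + 1)
| done_pair b m f :
    done pr w pz kn b m f -> pr b = pL -> pr (b + 1) = pR ->
    pz b = 0 -> kn b = 0 -> pz (b + 1) = 0 -> kn (b + 1) = 0 ->
    done pr w pz kn (b + 2) m (f + 2)
| done_factor b j l m f :
    done pr w pz kn b m f -> factor_at w pz kn b j l -> eqf pr j b l ->
    pr b = pL -> pr (b + l - 1) = pR ->
    done pr w pz kn (b + l) (m + 1) f.

Lemma rest_le n w pz kn b m f : rest n w pz kn b m f -> b <= n + 1.
Proof. induction 1; auto; try lia. Qed.

Lemma done_pos pr w pz kn b m f : done pr w pz kn b m f -> 1 <= b.
Proof. induction 1; lia. Qed.

Arguments rest_le {n w pz kn b m f}.
Arguments done_pos {pr w pz kn b m f}.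

Lemma factor_at_ext w pz kn pz' kn' b j l :
  factor_at w pz kn b j l ->
  (forall i, b <= i < b + l -> pz' i = pz i /\ kn' i = kn i) ->
  factor_at w pz' kn' b j l.
Proof.
  intros (H1 & H2 & H3 & H4 & H5 & H6 & H7) H; unfold factor_at; ands; auto; try lia.
  - destruct (H b) as [-> _]; [lia|auto].
  - intros i Hi; destruct (H i) as [-> _]; [lia|auto].
  - destruct (H (b + l - 1)) as [_ ->]; [lia|auto].
  - intros i Hi; destruct (H i) as [_ ->]; [lia|auto].
Qed.

Lemma rest_ext n w pz kn pz' kn' b m f :
  rest n w pz kn b m f ->
  (forall i, b <= i <= n -> pz' i = pz i /\ kn' i = kn i) ->
  rest n w pz' kn' b m f.
Proof.
  induction 1 as [|b m f H1 H2 H3 IH|b j l m f H1 H2 IH]; intros H.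
  - constructor.
  - pose proof (rest_le H3).
    destruct (H b) as [E1 E2]; [lia|].
    apply rest_free; try congruence; apply IH; intros; apply H; lia.
  - pose proof (rest_le H2); pose proof H1 as (_ & Hl & _).
    apply rest_factor with j l; [|apply IH; intros; apply H; lia].
    eapply factor_at_ext; eauto; intros; apply H; lia.
Qed.

Lemma done_ext pr w pz kn pr' pz' kn' b m f :
  done pr w pz kn b m f ->
  (forall i, 1 <= i < b -> pr' i = pr i /\ pz' i = pz i /\ kn' i = kn i) ->
  done pr' w pz' kn' b m f.
Proof.
  induction 1 as [|b m f H1 IH H2 H3 H4|b m f H1 IH H2 H3 H4 H5 H6 H7|b j l m f H1 IH H2 H3 H4 H5];
    intros H; try pose proof (done_pos H1).
  - constructor.
  - destruct (H b) as (E1 & E2 & E3); [lia|].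
    apply done_single; try congruence; apply IH; intros; apply H; lia.
  - destruct (H b) as (E1 & E2 & E3); [lia|].
    destruct (H (b + 1)) as (E4 & E5 & E6); [lia|].
    apply done_pair; try congruence; apply IH; intros; apply H; lia.
  - pose proof H2 as (Hj & Hl & _).
    apply done_factor with j.
    + apply IH; intros; apply H; lia.
    + eapply factor_at_ext; eauto; intros i Hi; destruct (H i) as (_ & E); auto; lia.
    + intros y Hy; destruct (H (j + y)) as (-> & _); [lia|].
      destruct (H (b + y)) as (-> & _); [lia|]; auto.
    + destruct (H b) as (-> & _); [lia|auto].
    + destruct (H (b + l - 1)) as (-> & _); [lia|auto].
Qed.

Lemma rest_free_inv n w pz kn b m f :
  rest n w pz kn b m f -> b <= n -> pz b = 0 ->
  exists f', f = f' + 1 /\ kn b = 0 /\ rest n w pz kn (b + 1) m f'.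
Proof.
  intros H Hb Hz; inversion H; subst; [lia|eauto|].
  destruct H0 as (A & _ & B & _); lia.
Qed.

Lemma rest_factor_inv n w pz kn b m f :
  rest n w pz kn b m f -> b <= n -> pz b <> 0 ->
  exists l m', m = m' + 1 /\ factor_at w pz kn b (pz b) l /\ b + l <= n + 1 /\
    rest n w pz kn (b + l) m' f.
Proof.
  intros H Hb Hz; inversion H; subst; [lia|congruence|].
  pose proof (rest_le H1).
  pose proof H0 as (A & B & C & _); rewrite C; eauto 8.
Qed.

Arguments rest_free_inv {n w pz kn b m f}.
Arguments rest_factor_inv {n w pz kn b m f}.

Lemma rest_frees n w pz kn b k m f :
  rest n w pz kn (b + k) m f -> (forall i, b <= i < b + k -> pz i = 0 /\ kn i = 0) ->
  rest n w pz kn b m (f + k).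
Proof.
  revert b; induction k as [|k IH]; intros b H Hz.
  - now rewrite !Nat.add_0_r in *.
  - rewrite Nat.add_succ_r, <- Nat.add_1_r; destruct (Hz b) as [Z1 Z2]; [lia|].
    apply rest_free; auto; apply IH.
    + now replace (b + 1 + k) with (b + S k) by lia.
    + intros; apply Hz; lia.
Qed.

(** The clause [wf_first] holds because a factor at position 2 can only have its definition at
    position 1 and is then opened as a free letter, so that the first two letters always form a
    pair. It starts the induction for the shrinking of the word. *)
Record wfpair (pr : nat -> nat) (i : nat) : Prop := {
  wf_range : forall x, 1 <= x < i -> pr x <= 2;
  wf_LR : forall x, 1 <= x -> x + 1 < i -> (pr x = pL <-> pr (x + 1) = pR);
  wf_NN : forall x, 1 <= x -> x + 1 < i -> pr x = pN -> pr (x + 1) <> pN;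
  wf_first : pr 1 = if 2 <? i then pL else pN
}.

Arguments wf_range {pr i}.
Arguments wf_first {pr i}.

Record pairing_at (n : nat) (w pr pz kn : nat -> nat) (i md fd mr fr : nat) : Prop := {
  pa_range : 2 <= i <= n + 1;
  pa_wf : wfpair pr i;
  pa_last : pr (i - 1) <> pL;
  pa_done : done pr w pz kn i md fd;
  pa_rest : rest n w pz kn i mr fr
}.

Arguments pa_range {n w pr pz kn i md fd mr fr}.
Arguments pa_wf {n w pr pz kn i md fd mr fr}.
Arguments pa_last {n w pr pz kn i md fd mr fr}.
Arguments pa_rest {n w pr pz kn i md fd mr fr}.

(** Finished factors and pairs end in [pR], so an unpaired letter before [i] is a single free letter
    and may be paired with the free letter at [i]. *)
Lemma pair_step n w pr pz kn i md fd mr fr :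
  pairing_at n w pr pz kn i md fd mr fr -> i <= n -> pz i = 0 -> pr (i - 1) = pN ->
  pairing_at n w (upd (upd pr (i - 1) pL) i pR) pz kn (i + 1) md (fd + 1) mr (fr - 1).
Proof.
  intros [Hi [Hw1 Hw2 Hw3 Hw4] Hlast Hd Hr] Hin Hz HN.
  destruct (rest_free_inv Hr Hin Hz) as (f' & -> & Hk & Hr').
  set (pr' := upd (upd pr (i - 1) pL) i pR).
  assert (E1 : pr' i = pR) by apply upd_same.
  assert (E2 : pr' (i - 1) = pL) by (unfold pr'; rewrite upd_other by lia; apply upd_same).
  assert (E3 : forall x, x < i - 1 -> pr' x = pr x)
    by (intros; unfold pr'; rewrite !upd_other by lia; auto).
  clearbody pr'; unfold pN, pL, pR in *.
  constructor; try lia.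
  - constructor; unfold pN, pL, pR.
    + intros x Hx; destruct (Nat.eq_dec x i) as [->|]; [lia|].
      destruct (Nat.eq_dec x (i - 1)) as [->|]; [lia|].
      rewrite E3 by lia; apply Hw1; lia.
    + intros x Hx Hx'; destruct (Nat.eq_dec x (i - 1)) as [->|].
      { replace (i - 1 + 1) with i by lia; rewrite E1, E2; tauto. }
      rewrite (E3 x) by lia; destruct (Nat.eq_dec (x + 1) (i - 1)) as [E|].
      { rewrite E, E2; specialize (Hw2 x Hx ltac:(lia)); rewrite E, HN in Hw2; lia. }
      rewrite E3 by lia; apply Hw2; lia.
    + intros x Hx Hx'; destruct (Nat.eq_dec x (i - 1)) as [->|]; [lia|].
      rewrite (E3 x) by lia; destruct (Nat.eq_dec (x + 1) (i - 1)) as [E|].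
      { rewrite E, E2; lia. }
      rewrite E3 by lia; apply Hw3; lia.
    + destruct (Nat.ltb_spec 2 (i + 1)); [|lia].
      destruct (Nat.ltb_spec 2 i).
      * destruct (Nat.eq_dec i 3) as [->|]; [|rewrite E3 by lia; auto].
        rewrite E3 by lia; auto.
      * replace 1 with (i - 1) at 1 by lia; auto.
  - rewrite Nat.add_sub, E1; unfold pL; lia.
  - inversion Hd as [E|b m f H1 H2 H3 H4 E|b m f H1 H2 H3 H4 H5 H6 H7 E|b j l m f H1 H2 H3 H4 H5 E].
    + lia.
    + subst i md fd; rewrite Nat.add_sub in *.
      replace (b + 1 + 1) with (b + 2) by lia; replace (f + 1 + 1) with (f + 2) by lia.
      apply done_pair; auto.
      eapply done_ext; eauto; intros x Hx; rewrite E3 by lia; auto.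
    + subst i; replace (b + 2 - 1) with (b + 1) in HN by lia; unfold pR in *; lia.
    + subst i; unfold pR in *; lia.
  - now rewrite Nat.add_sub.
Qed.

Lemma single_step n w pr pz kn i md fd mr fr :
  pairing_at n w pr pz kn i md fd mr fr -> i <= n -> pz i = 0 -> pr (i - 1) <> pN ->
  pairing_at n w (upd pr i pN) pz kn (i + 1) md (fd + 1) mr (fr - 1).
Proof.
  intros [Hi [Hw1 Hw2 Hw3 Hw4] Hlast Hd Hr] Hin Hz HN.
  destruct (rest_free_inv Hr Hin Hz) as (f' & -> & Hk & Hr').
  assert (Hi2 : i <> 2).
  { intros ->; simpl in *; congruence. }
  set (pr' := upd pr i pN).
  assert (E1 : pr' i = pN) by apply upd_same.
  assert (E3 : forall x, x < i -> pr' x = pr x)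
    by (intros; unfold pr'; rewrite !upd_other by lia; auto).
  constructor; try lia.
  - constructor.
    + intros x Hx; destruct (Nat.eq_dec x i) as [->|]; [unfold pN in *; lia|].
      rewrite E3 by lia; apply Hw1; lia.
    + intros x Hx Hx'; destruct (Nat.eq_dec (x + 1) i) as [E|].
      { rewrite E, E1, E3 by lia; replace x with (i - 1) by lia.
        unfold pN, pL, pR in *; lia. }
      rewrite !E3 by lia; apply Hw2; lia.
    + intros x Hx Hx'; destruct (Nat.eq_dec (x + 1) i) as [E|].
      { rewrite E3 by lia; replace x with (i - 1) by lia; contradiction. }
      rewrite !E3 by lia; apply Hw3; lia.
    + rewrite E3, Hw4 by lia; destruct (Nat.ltb_spec 2 i), (Nat.ltb_spec 2 (i + 1)); auto; lia.
  - rewrite Nat.add_sub, E1; unfold pN, pL; lia.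
  - apply done_single; auto.
    eapply done_ext; eauto; intros x Hx; rewrite E3 by lia; auto.
  - now rewrite Nat.add_sub.
Qed.

(** By induction on the position, as the definition may overlap the copy. At the seam nothing can go
    wrong: position [b - 1] is not [pL], and position [b] is [pL]. *)
Lemma copy_wfpair pr pr' b j l :
  wfpair pr b -> 2 < b -> pr (b - 1) <> pL -> 1 <= j -> j + 1 < b -> pr j = pL ->
  (forall x, x < b -> pr' x = pr x) -> eqf pr' j b l -> 2 <= l ->
  wfpair pr' (b + l) /\ pr' b = pL /\ pr' (b + 1) = pR.
Proof.
  intros [Hw1 Hw2 Hw3 Hw4] Hb Hlast Hj Hjb HL E He Hl.
  assert (Eb : pr' b = pL).
  { rewrite <- (Nat.add_0_r b), <- He, Nat.add_0_r, E by lia; auto. }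
  split; [|split; auto].
  - constructor.
    + intros x; induction x as [x IH] using lt_wf_ind; intros Hx.
      destruct (le_lt_dec b x); [|rewrite E by lia; apply Hw1; lia].
      replace x with (b + (x - b)) by lia; rewrite <- He by lia; apply IH; lia.
    + intros x; induction x as [x IH] using lt_wf_ind; intros Hx Hx'.
      destruct (Nat.eq_dec x (b - 1)) as [->|].
      { replace (b - 1 + 1) with b by lia; rewrite Eb, E by lia.
        unfold pL, pR in *; lia. }
      destruct (le_lt_dec b x); [|rewrite !E by lia; apply Hw2; lia].
      replace x with (b + (x - b)) by lia.
      replace (b + (x - b) + 1) with (b + (x - b + 1)) by lia.
      rewrite <- !He, Nat.add_assoc by lia; apply IH; lia.
    + intros x; induction x as [x IH] using lt_wf_ind; intros Hx Hx'.
      destruct (Nat.eq_dec x (b - 1)) as [->|].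
      { replace (b - 1 + 1) with b by lia; rewrite Eb; discriminate. }
      destruct (le_lt_dec b x); [|rewrite !E by lia; apply Hw3; lia].
      replace x with (b + (x - b)) by lia.
      replace (b + (x - b) + 1) with (b + (x - b + 1)) by lia.
      rewrite <- !He, Nat.add_assoc by lia; apply IH; lia.
    + rewrite E, Hw4 by lia; destruct (Nat.ltb_spec 2 b), (Nat.ltb_spec 2 (b + l)); auto; lia.
  - rewrite <- He by lia; rewrite E by lia; apply Hw2; auto; lia.
Qed.

Lemma wfpair_le pr i i' : wfpair pr i -> 2 < i' <= i -> wfpair pr i'.
Proof.
  intros [Hw1 Hw2 Hw3 Hw4] Hi; constructor.
  - intros; apply Hw1; lia.
  - intros; apply Hw2; lia.
  - intros; apply Hw3; lia.
  - rewrite Hw4; destruct (Nat.ltb_spec 2 i), (Nat.ltb_spec 2 i'); auto; lia.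
Qed.

Lemma wfpair_ext pr pr' i : wfpair pr i -> 1 < i ->
  (forall x, 1 <= x < i -> pr' x = pr x) -> wfpair pr' i.
Proof.
  intros [Hw1 Hw2 Hw3 Hw4] Hi E; constructor; intros; rewrite ?E in * by lia; auto.
Qed.

(** Two non-[pR] positions in a row are [pN pL], and [pR] precedes them. *)
Lemma wfpair_three pr i x : wfpair pr i -> 1 <= x -> x + 2 < i ->
  pr (x + 1) <> pR -> pr (x + 2) <> pR -> pr x = pR.
Proof.
  intros [Hw1 Hw2 Hw3 Hw4] Hx Hi H1 H2.
  pose proof (Hw1 x ltac:(lia)); pose proof (Hw1 (x + 1) ltac:(lia)).
  pose proof (Hw2 x ltac:(lia) ltac:(lia)); pose proof (Hw2 (x + 1) ltac:(lia) ltac:(lia)).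
  pose proof (Hw3 x ltac:(lia) ltac:(lia)).
  replace (x + 1 + 1) with (x + 2) in * by lia.
  unfold pN, pL, pR in *; lia.
Qed.

Local Open Scope prog_scope.

Definition copy_body : com :=
  "pair".["i" <- "pair".["j"]] ;; "i" <- "i" + 1 ;; "j" <- "j" + 1.

Definition copy_loop : com := While (BNot ("kon".["i" - 1] =? 1)) copy_body.

Definition pop_loop : com :=
  While ("pair".["i" - 1] <>? pR)
    ("i" <- "i" - 1 ;;
     "kon".["i" - 1 <- 1] ;;
     "kon".["i" <- 0] ;;
     "pair".["i" <- pN]).

Definition pair_factor : com :=
  "j" <- "pocz".["i"] ;; (copy_body ;; copy_loop) ;; pop_loop.

Definition open_position : com :=
  If ("pocz".["i"] <>? 0)
    (If ("kon".["i"] =? 1)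
       ("pocz".["i" <- 0] ;; "kon".["i" <- 0])
    (If ("pocz".["i"] =? "i" - 1)
       ("pocz".["i" + 1 <- "i" - 1] ;; "pocz".["i" <- 0])
    (If ("pair".["pocz".["i"]] <>? pL)
       ("pocz".["i" + 1 <- "pocz".["i"] + 1] ;; "pocz".["i" <- 0])
       pair_factor)))
    Skip.

Definition pair_free : com :=
  If ("pocz".["i"] =? 0)
    (If ("pair".["i" - 1] =? pN)
       ("pair".["i" - 1 <- pL] ;; "pair".["i" <- pR])
       ("pair".["i" <- pN]) ;;
     "i" <- "i" + 1)
    Skip.

Lemma pairing_def :
  pairing = ("pair".[1 <- pN] ;; "i" <- 2 ;;
             While ("i" <=? "n") (open_position ;; pair_free)).
Proof. reflexivity. Qed.

Local Close Scope prog_scope.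
Local Open Scope list_scope.
Local Open Scope nat_scope.

Lemma copy_loop_correct W b j l kn pr s k :
  b + l + 4 < W -> bounded W s -> 1 <= k <= l -> 1 <= j < b ->
  var s "i" = b + k -> var s "j" = j + k -> arr s "kon" = kn ->
  kn (b + l - 1) = 1 -> (forall i, b <= i < b + l - 1 -> kn i = 0) ->
  (forall x, x < b -> arr s "pair" x = pr x) -> eqf (arr s "pair") j b k ->
  runs W copy_loop s (fun t s' =>
    var s' "i" = b + l /\ (forall x, x < b -> arr s' "pair" x = pr x) /\
    eqf (arr s' "pair") j b l /\ t <= 10 * l).
Proof.
  intros HW HB Hk Hj Hi Hj' Hkn K1 K2 Hpr He.
  eapply runs_conseq.
  - apply runs_while with
      (I := fun s => exists k, 1 <= k <= l /\ var s "i" = b + k /\ var s "j" = j + k /\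
              arr s "kon" = kn /\ (forall x, x < b -> arr s "pair" x = pr x) /\
              eqf (arr s "pair") j b k)
      (P := fun s => 10 * (b + l - var s "i")); auto.
    + intros s' _ (k' & Hk' & E1 & _); simpl; lia.
    + clear s HB Hi Hj' Hkn Hpr He Hk k.
      intros [vr ar] HB (k & Hk & E1 & E2 & E3 & E4 & E5) Hb; cbn [var arr] in *.
      simpl in Hb; apply negb_true_iff, Nat.eqb_neq in Hb; rewrite E1, E3 in Hb.
      assert (k <> l) by (intros ->; contradiction).
      unfold copy_body; wpsimpl; wpsplit; try lia.
      rewrite E1, E2.
      assert (F : forall x, x < b + k ->
                (if x =? b + k then ar "pair" (j + k) else ar "pair" x) = ar "pair" x).
      { intros x Hx; destruct (Nat.eqb_spec x (b + k)); [lia|auto]. }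
      exists (k + 1); ands; auto; try lia.
      * intros x Hx; rewrite F by lia; auto.
      * intros y Hy; rewrite F by lia.
        destruct (Nat.eq_dec y k) as [->|]; [now rewrite Nat.eqb_refl|].
        rewrite F by lia; apply E5; lia.
    + exists k; auto 10.
  - cbn beta; intros t s' ((k' & Hk' & E1 & E2 & E3 & E4 & E5) & Hb & Ht).
    simpl in Hb; apply negb_false_iff, Nat.eqb_eq in Hb; rewrite E1, E3 in Hb.
    assert (k' = l).
    { destruct (Nat.eq_dec k' l); auto; rewrite K2 in Hb by lia; discriminate. }
    subst k'; ands; auto; lia.
Qed.

(** At most two letters are given back, since two neighbours other than [pR] are preceded by [pR];
    and [pR] at [b + 1] keeps at least two letters in the factor. The potential [i + 2 - (b + l)]
    counts the removals still possible. *)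
Lemma pop_loop_correct W b l kn pr s :
  b + l + 4 < W -> bounded W s -> 2 <= b -> 2 <= l ->
  var s "i" = b + l -> arr s "kon" = kn -> arr s "pair" = pr ->
  wfpair pr (b + l) -> pr b = pL -> pr (b + 1) = pR ->
  kn (b + l - 1) = 1 -> (forall i, b <= i < b + l - 1 -> kn i = 0) ->
  runs W pop_loop s (fun t s' =>
    exists k, 2 <= k <= l /\ l <= k + 2 /\ var s' "i" = b + k /\
      arr s' "kon" (b + k - 1) = 1 /\
      (forall i, b <= i < b + k - 1 \/ b + k <= i < b + l -> arr s' "kon" i = 0) /\
      (forall i, i < b \/ b + l <= i -> arr s' "kon" i = kn i) /\
      (forall x, x < b + k -> arr s' "pair" x = pr x) /\
      pr (b + k - 1) = pR /\ t <= 40).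
Proof.
  intros HW HB Hb Hl Hi Hkn Hpr Hwf HbL HbR K1 K2.
  eapply runs_conseq.
  - apply runs_while with
      (I := fun s => exists k, 2 <= k <= l /\ l <= k + 2 /\ var s "i" = b + k /\
         arr s "kon" (b + k - 1) = 1 /\
         (forall i, b <= i < b + k - 1 \/ b + k <= i < b + l -> arr s "kon" i = 0) /\
         (forall i, i < b \/ b + l <= i -> arr s "kon" i = kn i) /\
         (forall x, x < b + k -> arr s "pair" x = pr x) /\
         (forall x, b + k <= x < b + l -> pr x <> pR))
      (P := fun s => 10 * (var s "i" + 2 - (b + l))); auto.
    + intros s' _ (k & Hk & _ & E & _); simpl; unfold pR; lia.
    + clear s HB Hi Hkn Hpr.
      intros [vr ar] HB (k & Hk & Hlk & E1 & E2 & E3 & E4 & E5 & E6) Hc; cbn [var arr] in *.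
      simpl in Hc; apply negb_true_iff, Nat.eqb_neq in Hc.
      rewrite E1, E5 in Hc by lia.
      assert (Hk2 : k <> 2) by (intros ->; apply Hc; rewrite <- HbR; f_equal; lia).
      assert (Hkl : l < k + 2).
      { destruct (Nat.eq_dec l (k + 2)) as [El|]; [exfalso|lia]; apply Hc.
        apply (wfpair_three pr (b + l) (b + k - 1)); auto; try lia; apply E6; lia. }
      unfold pop_loop; wpsimpl; unfold pN in *; wpsplit; try lia.
      rewrite E1.
      assert (Fk : forall x, (if x =? b + k - 1 then 0 else if x =? b + k - 1 - 1 then 1 else ar "kon" x) =
                   upd (upd (ar "kon") (b + k - 1 - 1) 1) (b + k - 1) 0 x) by reflexivity.
      exists (k - 1); ands; auto; try lia.
      * rewrite Fk, upd_other by lia; replace (b + (k - 1) - 1) with (b + k - 1 - 1) by lia.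
        apply upd_same.
      * intros x Hx; rewrite Fk.
        destruct (Nat.eq_dec x (b + k - 1)) as [->|]; [apply upd_same|].
        rewrite !upd_other by lia; apply E3; lia.
      * intros x Hx; rewrite Fk, !upd_other by lia; apply E4; lia.
      * intros x Hx; destruct (Nat.eqb_spec x (b + k - 1)); [lia|]; apply E5; lia.
      * intros x Hx; destruct (Nat.eq_dec x (b + k - 1)) as [->|]; [auto|apply E6; lia].
    + exists l; subst kn pr; ands; auto; try lia.
      intros i [Hx|Hx]; [auto|lia].
  - cbn beta; intros t s' ((k & Hk & Hlk & E1 & E2 & E3 & E4 & E5 & E6) & Hc & Ht).
    simpl in Hc; apply negb_false_iff, Nat.eqb_eq in Hc; rewrite E1, E5 in Hc by lia.
    exists k; ands; auto; rewrite Hi in Ht; lia.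
Qed.

(** * Credits for released letters *)

(** A factor may still release five free letters: one if its definition ends just
    before it, two until its definition starts with [pL], and two at its end.  The
    slack is the number of these already released by the factor starting at [i]. *)
Definition slack (n : nat) (pr pz : nat -> nat) (i : nat) : nat :=
  if n <? i then 0 else if pz i =? 0 then 0 else if pz i =? i - 1 then 0 else
  if pr (pz i) =? pR then 1 else if pr (pz i) =? pN then 2 else 3.

Definition pair_inv (n : nat) (w : nat -> nat) (m0 K : nat) (pr pz kn : nat -> nat)
    (i : nat) : Prop :=
  exists md fd mr fr, pairing_at n w pr pz kn i md fd mr fr /\ md + mr <= m0 /\
    fd + fr + 5 * mr <= K + slack n pr pz i.

(** The next letter is free; the credit is stated for the pairing after it is handled. *)
Definition free_next (n : nat) (w : nat -> nat) (m0 K : nat) (pr pz kn : nat -> nat)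
    (i : nat) : Prop :=
  i <= n /\ pz i = 0 /\
  exists md fd mr fr, pairing_at n w pr pz kn i md fd mr fr /\ md + mr <= m0 /\
    forall pr', wfpair pr' (i + 1) -> (forall x, x < i - 1 -> pr' x = pr x) ->
      fd + fr + 5 * mr <= K + slack n pr' pz (i + 1).

(** In the second alternative a factor has just been copied. That it ends in [pR] matters at
    [i = n + 1], where step (B) may still run: it must not change the pairing of the last letter. *)
Definition opened (n : nat) (w : nat -> nat) (m0 K : nat) (s : state) : Prop :=
  let pr := arr s "pair" in let pz := arr s "pocz" in let kn := arr s "kon" in
  let i := var s "i" in
  free_next n w m0 K pr pz kn i \/
  (pair_inv n w m0 K pr pz kn i /\ pr (i - 1) = pR /\ (i <= n -> pz i <> 0)).

Lemma pairing_at_ext n w pr pz kn pr' pz' kn' i md fd mr fr :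
  pairing_at n w pr pz kn i md fd mr fr ->
  (forall x, 1 <= x < i -> pr' x = pr x) ->
  (forall x, 1 <= x <= n -> pz' x = pz x /\ kn' x = kn x) ->
  pairing_at n w pr' pz' kn' i md fd mr fr.
Proof.
  intros [H1 H2 H3 H4 H5] Hp Hz; constructor; auto.
  - eapply wfpair_ext; eauto; lia.
  - rewrite Hp by lia; auto.
  - eapply done_ext; eauto; intros x Hx; destruct (Hz x); [lia|]; split; auto.
  - eapply rest_ext; eauto; intros x Hx; apply Hz; pose proof (done_pos H4); lia.
Qed.

(** The five credits of the vanishing factor cover its only remaining letter and the at most three
    released before. *)
Lemma open_short n w m0 K pr pz kn i :
  pair_inv n w m0 K pr pz kn i -> i <= n -> pz i <> 0 -> kn i = 1 ->
  free_next n w m0 K pr (upd pz i 0) (upd kn i 0) i.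
Proof.
  intros (md & fd & mr & fr & [H1 H2 H3 H4 H5] & Hm & Hc) Hi Hz Hk.
  destruct (rest_factor_inv H5 Hi Hz) as (l & m' & -> & HF & Hl & Hr).
  destruct HF as (F1 & F2 & F3 & F4 & F5 & F6 & F7).
  assert (l = 1).
  { destruct (Nat.eq_dec l 1); auto; rewrite F6 in Hk by lia; discriminate. }
  subst l; split; auto; split; [apply upd_same|].
  exists md, fd, m', (fr + 1); split; [|split; [lia|]].
  - constructor; auto.
    + eapply done_ext; eauto; intros x Hx; rewrite !upd_other by lia; auto.
    + apply rest_free; try apply upd_same.
      eapply rest_ext; eauto; intros x Hx; rewrite !upd_other by lia; auto.
  - intros pr' _ _; unfold slack in Hc.
    destruct (n <? i), (pz i =? 0), (pz i =? i - 1), (pr (pz i) =? pR), (pr (pz i) =? pN); lia.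
Qed.

(** A factor defined just before itself repeats one letter, so its definition may stay at [i - 1]
    when its first letter is released; from then on it no longer starts just before the factor. In
    the other case the definition moves along with the factor. *)
Lemma open_shift n w m0 K pr pz kn i :
  pair_inv n w m0 K pr pz kn i -> i <= n -> pz i <> 0 -> kn i <> 1 ->
  (pz i = i - 1 \/ pr (pz i) <> pL) ->
  free_next n w m0 K pr
    (upd (upd pz (i + 1) (if pz i =? i - 1 then i - 1 else pz i + 1)) i 0) kn i.
Proof.
  intros (md & fd & mr & fr & [H1 H2 H3 H4 H5] & Hm & Hc) Hi Hz Hk Hcase.
  destruct (rest_factor_inv H5 Hi Hz) as (l & m' & -> & HF & Hl & Hr).
  destruct HF as (F1 & F2 & F3 & F4 & F5 & F6 & F7).
  assert (Hl1 : 2 <= l).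
  { destruct (Nat.eq_dec l 1) as [->|]; [|lia]. rewrite Nat.add_sub in F5; contradiction. }
  set (q := if pz i =? i - 1 then i - 1 else pz i + 1).
  assert (Hq : 1 <= q < i + 1 /\ eqf w q (i + 1) (l - 1)).
  { unfold q; destruct (Nat.eqb_spec (pz i) (i - 1)) as [E|E].
    - split; [lia|]; intros y Hy.
      rewrite E in F7; pose proof (F7 (S y) ltac:(lia)) as G1; pose proof (F7 y ltac:(lia)) as G2.
      replace (i - 1 + S y) with (i + y) in G1 by lia.
      replace (i + 1 + y) with (i + S y) by lia; congruence.
    - split; [lia|]; apply eqf_tail; auto. }
  destruct Hq as [Hq1 Hq2].
  split; auto; split; [apply upd_same|].
  exists md, fd, (m' + 1), (fr + 1); split; [|split; [lia|]].
  - constructor; auto.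
    + eapply done_ext; eauto; intros x Hx; rewrite !upd_other by lia; auto.
    + apply rest_free; [apply upd_same|apply F6; lia|].
      apply rest_factor with q (l - 1).
      * unfold factor_at; ands; auto; try lia.
        -- rewrite upd_other by lia; apply upd_same.
        -- intros x Hx; rewrite !upd_other by lia; apply F4; lia.
        -- replace (i + 1 + (l - 1) - 1) with (i + l - 1) by lia; auto.
        -- intros x Hx; apply F6; lia.
      * replace (i + 1 + (l - 1)) with (i + l) by lia.
        eapply rest_ext; eauto; intros x Hx; rewrite !upd_other by lia; auto.
  - intros pr' [W1 W2 W3 _] Hpr'; unfold slack in *.
    rewrite upd_other, upd_same by lia; fold q.
    destruct (Nat.ltb_spec n i); [lia|]; destruct (Nat.ltb_spec n (i + 1)); [lia|].
    destruct (Nat.eqb_spec (pz i) 0); [lia|]; destruct (Nat.eqb_spec q 0); [lia|].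
    unfold q; unfold q in Hq1; destruct (Nat.eqb_spec (pz i) (i - 1)) as [E|E].
    + destruct (Nat.eqb_spec (i - 1) (i + 1 - 1)); [lia|].
      destruct (pr' (i - 1) =? pR), (pr' (i - 1) =? pN); lia.
    + destruct Hcase as [|Hcase]; [contradiction|].
      destruct (Nat.eqb_spec (pz i + 1) (i + 1 - 1)); [lia|].
      (* Each release has to raise the slack. The start of the definition is [pR] or [pN]: what
         follows [pR] is not [pR], and what follows [pN] is [pL]. So the values run through a part
         of [pR], [pN], [pL], with slack 1, 2, 3. *)
      pose proof (W1 (pz i) ltac:(lia)).
      pose proof (W2 (pz i) ltac:(lia) ltac:(lia)).
      pose proof (W3 (pz i) ltac:(lia) ltac:(lia)).
      rewrite Hpr' in * by lia; unfold pN, pL, pR in *.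
      destruct (Nat.eqb_spec (pr (pz i)) 2), (Nat.eqb_spec (pr (pz i)) 0),
        (Nat.eqb_spec (pr' (pz i + 1)) 2), (Nat.eqb_spec (pr' (pz i + 1)) 0); lia.
Qed.

(** At most three letters were released at the front and [l - k], at most two, are released at the
    end; together they use up the five credits, and the slack restarts from 0. *)
Lemma open_factor n w m0 K pr pz kn i l md fd mr fr k pr' kn' :
  pairing_at n w pr pz kn i md fd (mr + 1) fr -> md + (mr + 1) <= m0 ->
  fd + fr + 5 * (mr + 1) <= K + 3 ->
  factor_at w pz kn i (pz i) l -> rest n w pz kn (i + l) mr fr ->
  2 <= k <= l -> l <= k + 2 -> i + l <= n + 1 ->
  (forall x, x < i -> pr' x = pr x) -> eqf pr' (pz i) i k ->
  wfpair pr' (i + k) -> pr' i = pL -> pr' (i + k - 1) = pR ->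
  kn' (i + k - 1) = 1 ->
  (forall x, i <= x < i + k - 1 \/ i + k <= x < i + l -> kn' x = 0) ->
  (forall x, x < i \/ i + l <= x -> kn' x = kn x) ->
  pairing_at n w pr' pz kn' (i + k) (md + 1) fd mr (fr + (l - k)) /\
  fd + (fr + (l - k)) + 5 * mr <= K.
Proof.
  intros [H1 H2 H3 H4 H5] Hm Hc HF Hr Hk Hlk Hl Hp He Hw HpL HpR K1 K2 K3.
  destruct HF as (F1 & F2 & F3 & F4 & F5 & F6 & F7).
  split; [|lia]; constructor; auto; try lia.
  - rewrite HpR; discriminate.
  - apply done_factor with (pz i); auto.
    + eapply done_ext; eauto; intros x Hx; rewrite Hp, K3 by lia; auto.
    + unfold factor_at; ands; auto; try lia.
      * intros x Hx; apply F4; lia.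
      * eapply eqf_le; eauto; lia.
  - apply rest_frees.
    + replace (i + k + (l - k)) with (i + l) by lia.
      eapply rest_ext; eauto; intros x Hx; rewrite K3 by lia; auto.
    + intros x Hx; split; [apply F4; lia|apply K2; lia].
Qed.

Lemma slack_nonneg_free n w m0 K pr pz kn i md fd mr fr :
  i <= n -> pz i = 0 -> pairing_at n w pr pz kn i md fd mr fr -> md + mr <= m0 ->
  fd + fr + 5 * mr <= K -> free_next n w m0 K pr pz kn i.
Proof.
  intros Hi Hz H Hm Hc; split; auto; split; auto.
  exists md, fd, mr, fr; split; auto; split; auto; intros; lia.
Qed.

Lemma open_position_correct W n w m0 K s :
  n + 10 < W -> bounded W s -> arr s "w" = w -> var s "i" <= n ->
  pair_inv n w m0 K (arr s "pair") (arr s "pocz") (arr s "kon") (var s "i") ->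
  runs W open_position s (fun t s' =>
    opened n w m0 K s' /\ var s "i" <= var s' "i" /\ var s' "i" <= n + 1 /\
    (var s' "i" = var s "i" -> free_next n w m0 K (arr s' "pair") (arr s' "pocz")
       (arr s' "kon") (var s' "i")) /\
    t <= 30 + 30 * (var s' "i" - var s "i")).
Proof.
  intros HW HB Hw Hi HI.
  apply wp_runs; auto; destruct s as [vr ar]; cbn [var arr] in *.
  pose proof HI as (md & fd & mr & fr & HP & Hm & Hc).
  unfold open_position, pair_factor, copy_loop, pop_loop, copy_body; wpsimpl.
  assert (Hlit : pN < W /\ pL < W /\ pR < W) by (unfold pN, pL, pR; lia).
  assert (Hpz : ar "pocz" (vr "i") <> 0 -> 1 <= ar "pocz" (vr "i") < vr "i").
  { intros Hz.
    destruct (rest_factor_inv (pa_rest HP) Hi Hz)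
      as (l & m' & _ & (F1 & _) & _); exact F1. }
  destruct (Nat.eqb_spec (ar "pocz" (vr "i")) 0) as [E0|E0]; cbv [negb].
  { wpsplit; try lia; unfold opened; cbv [var arr String.eqb Ascii.eqb Bool.eqb].
    - left; eapply slack_nonneg_free; eauto.
      unfold slack in Hc; rewrite E0 in Hc; destruct (n <? vr "i"); simpl in Hc; lia.
    - intros _; eapply slack_nonneg_free; eauto.
      unfold slack in Hc; rewrite E0 in Hc; destruct (n <? vr "i"); simpl in Hc; lia. }
  destruct (Nat.eqb_spec (ar "kon" (vr "i")) 1) as [E1|E1].
  { pose proof (open_short _ _ _ _ _ _ _ _ HI Hi E0 E1) as Hf.
    wpsplit; try lia; unfold opened; cbv [var arr String.eqb Ascii.eqb Bool.eqb];
      [left|intros _]; exact Hf. }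
  pose proof (open_shift _ _ _ _ _ _ _ _ HI Hi E0 E1) as Hf.
  destruct (Nat.eqb_spec (ar "pocz" (vr "i")) (vr "i" - 1)) as [E2|E2].
  { wpsplit; try lia; unfold opened; cbv [var arr String.eqb Ascii.eqb Bool.eqb];
      [left|intros _]; apply Hf; auto. }
  destruct (Nat.eqb_spec (ar "pair" (ar "pocz" (vr "i"))) pL) as [E3|E3];
    cbv [negb].
  2:{ wpsplit; try lia; unfold opened; cbv [var arr String.eqb Ascii.eqb Bool.eqb];
      [left|intros _]; apply Hf; auto. }
  wpsplit; try lia.
  set (b := vr "i") in *; set (j := ar "pocz" b) in *.
  destruct (rest_factor_inv (pa_rest HP) Hi E0)
    as (l & m' & -> & HF & Hl & Hrest); fold j in HF.
  pose proof HF as (F1 & F2 & F3 & F4 & F5 & F6 & F7).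
  assert (Hl2 : 2 <= l).
  { destruct (Nat.eq_dec l 1) as [->|]; [|lia]. rewrite Nat.add_sub in F5; contradiction. }
  intros HB1.
  match goal with |- runs W _ ?s0 _ => set (s1 := s0) in * end.
  assert (Hp1 : forall x, x < b -> arr s1 "pair" x = ar "pair" x).
  { intros x Hx; unfold s1; simpl; destruct (Nat.eqb_spec x b); [lia|auto]. }
  assert (Hp2 : arr s1 "pair" b = ar "pair" j).
  { unfold s1; simpl; now rewrite Nat.eqb_refl. }
  eapply runs_conseq.
  { eapply runs_frame; [exact HB1|].
    apply (copy_loop_correct W b j l (ar "kon") (ar "pair") s1 1); auto; try lia;
      try reflexivity.
    - intros y Hy; replace y with 0 by lia; rewrite !Nat.add_0_r, Hp1, Hp2 by lia; auto. }
  cbn beta; intros t1 s2 ((S1 & S2 & S3 & S4) & _ & Fv & Fa) HB2.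
  assert (Ep2 : arr s2 "pocz" = ar "pocz") by (rewrite Fa; reflexivity).
  pose proof (pa_wf HP) as Hwf.
  destruct (copy_wfpair (ar "pair") (arr s2 "pair") b j l Hwf) as (C1 & C2 & C3); auto; try lia.
  { exact (pa_last HP). }
  eapply runs_conseq.
  { eapply runs_frame; [exact HB2|].
    apply (pop_loop_correct W b l (ar "kon") (arr s2 "pair") s2); auto; lia. }
  cbn beta; intros t2 s3 ((k & Hk & Hlk & T1 & T2 & T3 & T4 & T5 & T6 & T7) & _ & Gv & Ga).
  assert (Ep3 : arr s3 "pocz" = ar "pocz") by (rewrite Ga; [exact Ep2|reflexivity]).
  assert (Hsl : slack n (ar "pair") (ar "pocz") b <= 3).
  { unfold slack; destruct (n <? b), (ar "pocz" b =? 0), (ar "pocz" b =? b - 1),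
      (ar "pair" (ar "pocz" b) =? pR), (ar "pair" (ar "pocz" b) =? pN); lia. }
  destruct (open_factor n w m0 K (ar "pair") (ar "pocz") (ar "kon") b l md fd m' fr k
              (arr s3 "pair") (arr s3 "kon")) as [HP3 HC3]; auto; try lia.
  { intros x Hx; rewrite T5, S2 by lia; auto. }
  { intros y Hy; fold j; rewrite !T5 by lia; apply S3; lia. }
  { eapply wfpair_ext; [apply (wfpair_le _ _ (b + k) C1); lia|lia|].
    intros x Hx; apply T5; lia. }
  { rewrite T5 by lia; auto. }
  { rewrite T5 by lia; auto. }
  unfold opened; destruct s3 as [v3 a3]; cbn [var arr] in *; rewrite T1, Ep3; ands; try lia.
  destruct (Nat.eq_dec (ar "pocz" (b + k)) 0) as [Z|Z];
    [destruct (le_lt_dec (b + k) n) as [Hn|Hn]|].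
  - left; eapply slack_nonneg_free; eauto; lia.
  - right; split; [|split; [rewrite T5 by lia; auto|lia]].
    exists (md + 1), fd, m', (fr + (l - k)); ands; auto; lia.
  - right; split; [|split; [rewrite T5 by lia; auto|auto]].
    exists (md + 1), fd, m', (fr + (l - k)); ands; auto; lia.
Qed.

(** When a copied factor ends the word, step (B) may run once more beyond it, depending on what
    [pocz] holds at [n + 1]. The register then stands at [n + 2] while the logical position remains
    [n + 1]. *)
Definition pairing_inv (n : nat) (w : nat -> nat) (m0 K : nat) (s : state) : Prop :=
  var s "n" = n /\ arr s "w" = w /\
  exists i, pair_inv n w m0 K (arr s "pair") (arr s "pocz") (arr s "kon") i /\
    (var s "i" = i \/ (i = n + 1 /\ var s "i" = n + 2)).

Lemma pair_free_correct W n w m0 K s :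
  n + 10 < W -> var s "n" = n -> arr s "w" = w -> 2 <= var s "i" <= n + 1 ->
  opened n w m0 K s ->
  wp W pair_free s (fun t s' =>
    pairing_inv n w m0 K s' /\ var s "i" <= var s' "i" <= n + 2 /\
    (free_next n w m0 K (arr s "pair") (arr s "pocz") (arr s "kon") (var s "i") ->
     var s' "i" = var s "i" + 1) /\ t <= 10).
Proof.
  intros HW Hn Hw Hi Ho; destruct s as [vr ar]; unfold opened in Ho; cbn [var arr] in *.
  unfold pair_free; wpsimpl.
  assert (Hlit : pN < W /\ pL < W /\ pR < W) by (unfold pN, pL, pR; lia).
  destruct (Nat.eqb_spec (ar "pocz" (vr "i")) 0) as [E0|E0].
  - destruct Ho as [Hf|(HI & HR & Hz)].
    + destruct Hf as (Hin & Hz & md & fd & mr & fr & HP & Hm & Hc).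
      pose proof (rest_free_inv (pa_rest HP) Hin Hz)
        as (f' & Ef & _).
      wpsplit; try lia; try (intros; lia);
        unfold pairing_inv; cbv [var arr String.eqb Ascii.eqb Bool.eqb]; ands; auto.
      * pose proof (pair_step _ _ _ _ _ _ _ _ _ _ HP Hin Hz E) as HP'.
        exists (vr "i" + 1); split; [|left; auto].
        exists md, (fd + 1), mr, (fr - 1); split; [exact HP'|split; auto].
        enough (fd + fr + 5 * mr <=
                K + slack n (upd (upd (ar "pair") (vr "i" - 1) pL) (vr "i") pR)
                      (ar "pocz") (vr "i" + 1)).
        { replace (fd + 1 + (fr - 1)) with (fd + fr) by lia; exact H. }
        apply Hc; [exact (pa_wf HP')|].
        intros x Hx; rewrite !upd_other by lia; auto.
      * pose proof (single_step _ _ _ _ _ _ _ _ _ _ HP Hin Hz E) as HP'.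
        exists (vr "i" + 1); split; [|left; auto].
        exists md, (fd + 1), mr, (fr - 1); split; [exact HP'|split; auto].
        enough (fd + fr + 5 * mr <=
                K + slack n (upd (ar "pair") (vr "i") pN) (ar "pocz") (vr "i" + 1)).
        { replace (fd + 1 + (fr - 1)) with (fd + fr) by lia; exact H. }
        apply Hc; [exact (pa_wf HP')|].
        intros x Hx; rewrite !upd_other by lia; auto.
    + assert (En : vr "i" = n + 1).
      { destruct (Nat.eq_dec (vr "i") (n + 1)); auto; exfalso; apply Hz; auto; lia. }
      rewrite HR; wpsplit; try (unfold pR, pN in *; lia); try (intros; lia).
      unfold pairing_inv; cbv [var arr String.eqb Ascii.eqb Bool.eqb]; ands; auto.
      exists (n + 1); split; [|right; lia].
      rewrite En in HI; destruct HI as (md & fd & mr & fr & HP & Hm & Hc).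
      exists md, fd, mr, fr; ands; auto.
      * eapply pairing_at_ext; eauto; rewrite En; intros x Hx.
        destruct (Nat.eqb_spec x (n + 1)); [lia|auto].
      * unfold slack in *; destruct (Nat.ltb_spec n (n + 1)); lia.
  - wpsplit; try lia; unfold pairing_inv; cbn [var arr]; ands; auto; try lia.
    + destruct Ho as [(_ & Hz & _)|(HI & _)]; [contradiction|eauto].
    + intros (_ & Hz & _); contradiction.
Qed.

Lemma pairing_correct W n w m f s :
  n + 10 < W -> 2 <= n -> bounded W s -> var s "n" = n -> arr s "w" = w ->
  rest n w (arr s "pocz") (arr s "kon") 1 m f ->
  runs W pairing s (fun t s' =>
    t <= 90 * n /\
    wfpair (arr s' "pair") (n + 1) /\ arr s' "pair" n <> pL /\
    exists m' f', m' <= m /\ f' <= f + 5 * m /\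
      done (arr s' "pair") w (arr s' "pocz") (arr s' "kon") (n + 1) m' f').
Proof.
  intros HW Hn HB En Ew Hr.
  rewrite pairing_def; apply wp_runs; auto; destruct s as [vr ar]; cbn [var arr] in *.
  assert (Hlit : pN < W /\ pL < W /\ pR < W) by (unfold pN, pL, pR; lia).
  apply wp_seq; split; [simpl; lia|]; split; [simpl; lia|].
  apply wp_seq; split; [simpl; lia|].
  match goal with |- wp W _ ?s0 _ => set (s1 := s0) end.
  intros HB1.
  assert (Hz1 : ar "pocz" 1 = 0).
  { inversion Hr; subst; auto; [lia|]. destruct H as (A & _); lia. }
  eapply runs_conseq.
  - apply runs_while_runs with
      (I := fun s => pairing_inv n w m (f + 5 * m) s /\ 2 <= var s "i" <= n + 2)
      (P := fun s => 80 * (n + 2 - var s "i")); auto.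
    + intros s _ _; simpl; auto.
    + clear HB1; intros s HB1 ((Sn & Sw & i & HI & Hi) & Hi2) Hb.
      simpl in Hb; apply Nat.leb_le in Hb; rewrite Sn in Hb.
      assert (var s "i" = i) by lia; subst i; clear Hi.
      apply runs_seq; eapply runs_conseq.
      { eapply runs_frame; [exact HB1|].
        apply (open_position_correct W n w m (f + 5 * m) s HW HB1 Sw Hb HI). }
      cbn beta; intros t1 s2 ((Ho & Hle & Hle' & Hfree & Ht1) & HB2 & Fv & Fa).
      apply wp_runs; auto.
      eapply wp_mono; [apply (pair_free_correct W n w m (f + 5 * m) s2); auto|].
      * rewrite Fv; auto.
      * rewrite Fa; auto.
      * lia.
      * cbn beta; intros t2 s3 (HJ & Hle3 & Hf3 & Ht2).
        assert (var s "i" < var s3 "i").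
        { destruct (Nat.eq_dec (var s2 "i") (var s "i")) as [E|]; [|lia].
          rewrite (Hf3 (Hfree E)); lia. }
        split; [split; [auto|lia]|lia].
    + split; [|simpl; lia].
      split; [exact En|]; split; [exact Ew|]; exists 2; split; [|left; auto].
      destruct (rest_free_inv Hr ltac:(lia) Hz1) as (f' & -> & Hk1 & Hr').
      exists 0, 1, m, f'; split; [|split; lia].
      constructor; auto; try lia.
      * constructor; intros; try lia; auto.
        replace x with 1 by lia; unfold s1; simpl; unfold pN; lia.
      * apply (done_single _ _ _ _ 1 0 0); auto; constructor.
  - cbn beta; intros t s' (((Sn & Sw & i & HI & Hi) & Hi2) & Hb & Ht).
    simpl in Hb; apply Nat.leb_gt in Hb; rewrite Sn in Hb.
    destruct HI as (md & fd & mr & fr & [H1 H2 H3 H4 H5] & Hm & Hc).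
    assert (i = n + 1) by lia; subst i.
    rewrite Nat.add_sub in H3; ands; auto.
    + change (var s1 "i") with 2 in Ht; lia.
    + exists md, fd; ands; auto; try lia.
      unfold slack in Hc; destruct (Nat.ltb_spec n (n + 1)); lia.
Qed.

(** * Replacing pairs *)

(** The structure of [done] read from the other end: pairing appends on the right, whereas replacing
    consumes from the left and needs to know what is still ahead. *)
Inductive todo (n : nat) (pr w pz kn : nat -> nat) : nat -> nat -> nat -> Prop :=
| todo_nil : todo n pr w pz kn (n + 1) 0 0
| todo_single b m f :
    pr b = pN -> pz b = 0 -> kn b = 0 ->
    todo n pr w pz kn (b + 1) m f -> todo n pr w pz kn b m (f + 1)
| todo_pair b m f :
    pr b = pL -> pr (b + 1) = pR -> pz b = 0 -> kn b = 0 -> pz (b + 1) = 0 -> kn (b + 1) = 0 ->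
    todo n pr w pz kn (b + 2) m f -> todo n pr w pz kn b m (f + 2)
| todo_factor b j l m f :
    factor_at w pz kn b j l -> eqf pr j b l -> pr b = pL -> pr (b + l - 1) = pR ->
    todo n pr w pz kn (b + l) m f -> todo n pr w pz kn b (m + 1) f.

Lemma done_todo n pr w pz kn b m f m' f' :
  done pr w pz kn b m f -> todo n pr w pz kn b m' f' -> todo n pr w pz kn 1 (m + m') (f + f').
Proof.
  intros H; revert m' f'.
  induction H as [|b m f H1 IH H2 H3 H4|b m f H1 IH H2 H3 H4 H5 H6 H7|b j l m f H1 IH H2 H3 H4 H5];
    intros m' f' H.
  - auto.
  - replace (f + 1 + f') with (f + (f' + 1)) by lia; apply IH, todo_single; auto.
  - replace (f + 2 + f') with (f + (f' + 2)) by lia; apply IH, todo_pair; auto.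
  - replace (m + 1 + m') with (m + (m' + 1)) by lia; eapply IH, todo_factor; eauto.
Qed.

Lemma todo_le n pr w pz kn b m f : todo n pr w pz kn b m f -> b <= n + 1.
Proof. induction 1; lia. Qed.

Arguments todo_le {n pr w pz kn b m f}.

Definition is_free (f : phrase) : bool := match f with Free _ => true | _ => false end.
Definition frees (F : list phrase) : nat := List.length (filter is_free F).
Definition facs (F : list phrase) : nat := List.length (filter (fun f => negb (is_free f)) F).

Lemma frees_app F f : frees (F ++ [f]) = frees F + (if is_free f then 1 else 0).
Proof. unfold frees; rewrite filter_app, length_app; simpl; destruct (is_free f); auto. Qed.

Lemma facs_app F f : facs (F ++ [f]) = facs F + (if is_free f then 0 else 1).
Proof. unfold facs; rewrite filter_app, length_app; simpl; destruct (is_free f); auto. Qed.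

Lemma parsed_rest n w pz kn b F m f :
  parsed w pz kn b F -> rest n w pz kn b m f -> rest n w pz kn 1 (facs F + m) (frees F + f).
Proof.
  intros H; revert m f.
  induction H as [|b F HF IH H1 H2|b F j l HF IH H1 H2 H3 H4 H5 H6 H7]; intros m f H.
  - auto.
  - rewrite facs_app, frees_app; simpl; rewrite Nat.add_0_r.
    replace (frees F + 1 + f) with (frees F + (f + 1)) by lia; apply IH, rest_free; auto.
  - rewrite facs_app, frees_app; simpl; rewrite Nat.add_0_r.
    replace (facs F + 1 + m) with (facs F + (m + 1)) by lia; apply IH.
    apply rest_factor with j l; auto; unfold factor_at; ands; auto; lia.
Qed.

(** [posf pr x] is the position in the new word of the letter at [x], or of the pair
    starting there. *)
Fixpoint heads (pr : nat -> nat) (k : nat) : nat :=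
  match k with
  | 0 => 0
  | S k => heads pr k + (if pr (S k) =? pR then 0 else 1)
  end.

Definition posf (pr : nat -> nat) (x : nat) : nat := 1 + heads pr (x - 1).

Lemma posf_S pr x : 1 <= x -> posf pr (x + 1) = posf pr x + (if pr x =? pR then 0 else 1).
Proof.
  intros Hx; unfold posf; destruct x as [|x]; [lia|].
  replace (S x + 1 - 1) with (S x) by lia; replace (S x - 1) with x by lia.
  reflexivity.
Qed.

Lemma posf_mono pr x y : 1 <= x <= y -> posf pr x <= posf pr y.
Proof.
  intros [Hx Hy]; induction Hy as [|y Hy IH]; auto.
  rewrite <- (Nat.add_1_r y), posf_S by lia; lia.
Qed.

Lemma posf_lt pr x y : 1 <= x -> x < y -> pr x <> pR -> posf pr x < posf pr y.
Proof.
  intros Hx Hy HR; apply Nat.lt_le_trans with (posf pr (x + 1)).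
  - rewrite posf_S by lia; apply Nat.eqb_neq in HR; rewrite HR; lia.
  - apply posf_mono; lia.
Qed.

(** Equal pairings move the new pointer equally. Therefore a factor and its definition advance in
    step in the new word, and the image of a factor is again a factor. *)
Lemma posf_shift pr j b l y :
  1 <= j -> 1 <= b -> eqf pr j b l -> y <= l ->
  posf pr (b + y) + posf pr j = posf pr b + posf pr (j + y).
Proof.
  intros Hj Hb He; induction y as [|y IH]; intros Hy; [rewrite !Nat.add_0_r; lia|].
  rewrite <- (Nat.add_1_r y), !Nat.add_assoc, !posf_S by lia.
  rewrite (He y) by lia; specialize (IH ltac:(lia)); lia.
Qed.

Lemma posf_pos pr x : 1 <= posf pr x.
Proof. unfold posf; lia. Qed.

Lemma posf_le pr x : 1 <= x -> posf pr x <= x.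
Proof.
  intros Hx; unfold posf; enough (forall k, heads pr k <= k) as H by (specialize (H (x - 1)); lia).
  induction k as [|k IH]; simpl; auto; destruct (pr (S k) =? pR); lia.
Qed.

Lemma wf_next pr n x : wfpair pr n -> 1 <= x -> x < n -> pr (x - 1) <> pL -> pr x <> pR.
Proof.
  intros [W1 W2 W3 W4] Hx Hn HL.
  destruct (Nat.eq_dec x 1) as [->|].
  - rewrite W4; destruct (2 <? n); unfold pL, pN, pR; lia.
  - intros HR; apply HL; apply W2; try lia; replace (x - 1 + 1) with x by lia; auto.
Qed.

(** Position [x] is a single letter copied to the new word, or a pair whose letter
    [w' (posf pr x)] was introduced in this round, as one of [f0], ..., [f1 - 1]. *)
Definition coded (pr w w' lf rt : nat -> nat) (f0 f1 x : nat) : Prop :=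
  (pr x = pN -> w' (posf pr x) = w x) /\
  (pr x = pL -> f0 <= w' (posf pr x) < f1 /\
     lf (w' (posf pr x)) = w x /\ rt (w' (posf pr x)) = w (x + 1)).

(** The second half of [rw_fresh] holds because a new letter takes one place instead of two. At the
    end it says that rules added plus new length do not exceed the old length. *)
Record rewritten (n : nat) (w pr : nat -> nat) (s : state) (i f0 : nat) (l0 r0 : nat -> nat) : Prop := {
  rw_i : var s "i" = i;
  rw_i' : var s "i'" = posf pr i;
  rw_pos : forall x, 1 <= x < i -> pr x <> pR -> arr s "pos" x = posf pr x;
  rw_coded : forall x, 1 <= x < i ->
    coded pr w (arr s "w'") (arr s "left") (arr s "right") f0 (var s "fresh") x;
  rw_fresh : f0 <= var s "fresh" /\ var s "fresh" - f0 + posf pr i <= i;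
  rw_old : forall c, c < f0 -> arr s "left" c = l0 c /\ arr s "right" c = r0 c;
  rw_new : forall c, f0 <= c < var s "fresh" -> exists x, 1 <= x < n /\
    arr s "left" c = w x /\ arr s "right" c = w (x + 1)
}.

Arguments rw_i {n w pr s i f0 l0 r0}.
Arguments rw_i' {n w pr s i f0 l0 r0}.
Arguments rw_pos {n w pr s i f0 l0 r0}.

Definition given (n : nat) (w pr pz kn : nat -> nat) (s : state) : Prop :=
  var s "n" = n /\ arr s "w" = w /\ arr s "pair" = pr /\ arr s "pocz" = pz /\
  arr s "kon" = kn.

Local Open Scope prog_scope.

Definition copy_letter : com :=
  "pos".["i" <- "i'"] ;;
  "w'".["i'" <- "w'".["j'"]] ;;
  "j'" <- "j'" + 1 ;;
  advance' ;;
  If ("pair".["i"] =? pL) ("i" <- "i" + 2) ("i" <- "i" + 1).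

Definition new_factor : com :=
  "j'" <- "pos".["pocz".["i"]] ;;
  "pocz'".["i'" <- "j'"] ;;
  (copy_letter ;; While (BNot ("kon".["i" - 1] =? 1)) copy_letter) ;;
  "kon'".["i'" - 1 <- 1].

Definition new_letter : com :=
  "pos".["i" <- "i'"] ;;
  If ("pair".["i"] =? pL)
    ("w'".["i'" <- "fresh"] ;;
     "left".["fresh" <- "w".["i"]] ;;
     "right".["fresh" <- "w".["i" + 1]] ;;
     "fresh" <- "fresh" + 1 ;;
     "i" <- "i" + 2)
    ("w'".["i'" <- "w".["i"]] ;;
     "i" <- "i" + 1) ;;
  advance'.

Definition copy_back : com :=
  While ("i" <=? "n") (
    "w".["i" <- "w'".["i"]] ;;
    "pocz".["i" <- "pocz'".["i"]] ;;
    "kon".["i" <- "kon'".["i"]] ;;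
    "i" <- "i" + 1).

Lemma replace_def :
  replace = ("i" <- 1 ;; "i'" <- 0 ;; advance' ;;
             While ("i" <=? "n") (If ("pocz".["i"] <>? 0) new_factor new_letter) ;;
             "n" <- "i'" - 1 ;; "i" <- 1 ;; copy_back).
Proof. reflexivity. Qed.

Local Close Scope prog_scope.
Local Open Scope list_scope.
Local Open Scope nat_scope.

Lemma coded_ext pr w w1 w2 l1 l2 r1 r2 f0 f1 f2 x :
  coded pr w w1 l1 r1 f0 f1 x -> w2 (posf pr x) = w1 (posf pr x) -> f1 <= f2 ->
  (forall c, c < f1 -> l2 c = l1 c /\ r2 c = r1 c) ->
  coded pr w w2 l2 r2 f0 f2 x.
Proof.
  intros [H1 H2] E Hf Hl; split; intros Hp; rewrite E; auto.
  destruct (H2 Hp) as (A & B & C); destruct (Hl (w1 (posf pr x))) as [-> ->]; [lia|].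
  ands; auto; lia.
Qed.

(** Inside a factor at [b] with definition [j], after [y] letters of the old word. *)
Definition copying (n : nat) (w pr : nat -> nat) (s : state) (b j l y f0 : nat)
    (l0 r0 wo po ko : nat -> nat) (fr : nat) : Prop :=
  rewritten n w pr s (b + y) f0 l0 r0 /\ y <= l /\ (y < l -> pr (b + y) <> pR) /\
  var s "j'" = posf pr (j + y) /\ var s "fresh" = fr /\
  (forall x, x < posf pr b ->
     arr s "w'" x = wo x /\ arr s "pocz'" x = po x /\ arr s "kon'" x = ko x) /\
  arr s "pocz'" (posf pr b) = posf pr j /\
  (forall x, posf pr b < x <= posf pr (b + y) -> arr s "pocz'" x = 0) /\
  (forall x, posf pr b <= x <= posf pr (b + y) -> arr s "kon'" x = 0) /\
  (forall z, posf pr b + z < posf pr (b + y) ->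
     arr s "w'" (posf pr j + z) = arr s "w'" (posf pr b + z)).

Ltac upds := repeat (rewrite upd_same || rewrite upd_other by lia).

(** As [j < b], position [j + y] is already rewritten, even if the factor overlaps its definition.
    Its code also fits [b + y], where word and pairing are the same. The final [pR] of the factor
    keeps a pair from crossing its end. *)
Lemma copying_step n w pr pz kn s s' b j l y y1 f0 l0 r0 wo po ko fr :
  copying n w pr s b j l y f0 l0 r0 wo po ko fr ->
  factor_at w pz kn b j l -> eqf pr j b l -> pr (b + l - 1) = pR ->
  wfpair pr (n + 1) -> b + l <= n + 1 -> y < l ->
  let p := posf pr (b + y) in
  y1 = (if pr (b + y) =? pL then y + 2 else y + 1) ->
  var s' "i" = b + y1 -> var s' "i'" = p + 1 -> var s' "j'" = posf pr (j + y) + 1 ->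
  var s' "fresh" = var s "fresh" ->
  arr s' "pos" = upd (arr s "pos") (b + y) p ->
  arr s' "w'" = upd (arr s "w'") p (arr s "w'" (posf pr (j + y))) ->
  arr s' "pocz'" = upd (arr s "pocz'") (p + 1) 0 ->
  arr s' "kon'" = upd (arr s "kon'") (p + 1) 0 ->
  arr s' "left" = arr s "left" -> arr s' "right" = arr s "right" ->
  copying n w pr s' b j l y1 f0 l0 r0 wo po ko fr.
Proof.
  intros [[R1 R2 R3 R4 R6 R7 R8] (C1 & C2 & C3 & C4 & C5 & C6 & C7 & C8 & C9)]
    (F1 & F2 & _ & _ & _ & _ & F7) He HR Hwf Hbl Hy p Ey1 V1 V2 V3 V4 A1 A2 A3 A4 A5 A6.
  pose proof Hwf as [W1 W2 W3 W4].
  pose proof (C2 Hy) as HnR.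
  assert (Hp1 : posf pr (b + y + 1) = p + 1).
  { rewrite posf_S by lia; apply Nat.eqb_neq in HnR; rewrite HnR; auto. }
  assert (Hcase : (y1 = y + 1 /\ pr (b + y) = pN) \/
                  (y1 = y + 2 /\ pr (b + y) = pL /\ pr (b + y + 1) = pR /\ y + 2 <= l)).
  { pose proof (W1 (b + y) ltac:(lia)).
    destruct (Nat.eqb_spec (pr (b + y)) pL) as [E|E].
    - right; split; auto; split; auto.
      assert (y <> l - 1).
      { intros ->; replace (b + (l - 1)) with (b + l - 1) in E by lia.
        rewrite HR in E; discriminate. }
      split; [apply W2; auto; lia|lia].
    - left; split; auto; unfold pN, pL, pR in *; lia. }
  assert (Hlast : pr (b + y1 - 1) <> pL).
  { destruct Hcase as [(-> & H)|(-> & H & H' & _)].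
    - replace (b + (y + 1) - 1) with (b + y) by lia; rewrite H; discriminate.
    - replace (b + (y + 2) - 1) with (b + y + 1) by lia; rewrite H'; discriminate. }
  assert (Hp2 : posf pr (b + y1) = p + 1).
  { destruct Hcase as [(-> & H)|(-> & H & H' & _)].
    - now rewrite Nat.add_assoc.
    - replace (b + (y + 2)) with (b + y + 1 + 1) by lia.
      rewrite posf_S, H', Hp1 by lia; simpl; lia. }
  assert (Hy1 : y < y1 <= l) by lia.
  pose proof (posf_shift pr j b l y ltac:(lia) ltac:(lia) He ltac:(lia)) as S1.
  pose proof (posf_shift pr j b l y1 ltac:(lia) ltac:(lia) He ltac:(lia)) as S2.
  fold p in S1.
  assert (Hjp : posf pr (j + y) < p).
  { apply posf_lt; try lia; rewrite He by lia; auto. }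
  assert (Hbp : posf pr b <= p) by (apply posf_mono; lia).
  split; [constructor|].
  - auto.
  - lia.
  - intros x Hx Hx'; rewrite A1; destruct (Nat.eq_dec x (b + y)) as [->|]; upds; auto.
    apply R3; auto; destruct Hcase as [(-> & H)|(-> & H & H' & _)]; [lia|].
    destruct (Nat.eq_dec x (b + y + 1)) as [->|]; [congruence|lia].
  - intros x Hx; rewrite A2, A5, A6, V4.
    destruct (Nat.eq_dec (pr x) pR) as [ER|NR].
    { split; rewrite ER; discriminate. }
    destruct (Nat.eq_dec x (b + y)) as [->|].
    + destruct (R4 (j + y) ltac:(lia)) as [G1 G2]; rewrite He in G1, G2 by lia.
      split; fold p; rewrite upd_same; intros Hpx.
      * rewrite G1, F7 by (auto; lia); auto.
      * destruct (G2 Hpx) as (G3 & G4 & G5); ands; try lia; [rewrite G4; apply F7; lia|].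
        rewrite G5; rewrite <- !Nat.add_assoc; apply F7.
        destruct Hcase as [(-> & H)|(-> & H & H' & _)]; [rewrite H in Hpx; discriminate|lia].
    + assert (Hxb : x < b + y).
      { destruct Hcase as [(-> & H)|(-> & H & H' & _)]; [lia|].
        destruct (Nat.eq_dec x (b + y + 1)) as [->|]; [congruence|lia]. }
      assert (posf pr x < p) by (apply posf_lt; auto; lia).
      eapply coded_ext; [apply R4; lia| | |]; auto; upds; auto.
  - rewrite V4, Hp2; fold p in R6; lia.
  - rewrite A5, A6; auto.
  - rewrite A5, A6, V4; auto.
  - fold p in C4, C5, C6, C7, C8, C9.
    rewrite Hp2, V3, V4, A2, A3, A4; ands; auto; try lia.
    + intros Hyl; apply (wf_next _ _ _ Hwf); auto; lia.
    + intros x Hx; destruct (C5 x Hx) as (G1 & G2 & G3); upds; auto.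
    + upds; auto.
    + intros x Hx; destruct (Nat.eq_dec x (p + 1)) as [->|]; upds; auto; apply C7; lia.
    + intros x Hx; destruct (Nat.eq_dec x (p + 1)) as [->|]; upds; auto; apply C8; lia.
    + intros z Hz; destruct (Nat.eq_dec (posf pr b + z) p) as [Ez|].
      * rewrite Ez; upds; f_equal; lia.
      * upds; apply C9; lia.
Qed.

Lemma copy_letter_correct W n w pr pz kn s b j l y f0 l0 r0 wo po ko fr :
  n + 10 < W -> given n w pr pz kn s ->
  copying n w pr s b j l y f0 l0 r0 wo po ko fr ->
  factor_at w pz kn b j l -> eqf pr j b l -> pr (b + l - 1) = pR ->
  wfpair pr (n + 1) -> b + l <= n + 1 -> y < l ->
  wp W copy_letter s (fun t s' => t <= 10 /\ given n w pr pz kn s' /\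
    exists y1, y < y1 <= l /\ copying n w pr s' b j l y1 f0 l0 r0 wo po ko fr).
Proof.
  intros HW Hg HC HF He HR Hwf Hbl Hy.
  pose proof HC as [[R1 R2 R3 R4 R6 R7 R8] (C1 & C2 & C3 & C4 & C5 & C6 & C7 & C8 & C9)].
  pose proof HF as (F1 & F2 & _).
  assert (Hlit : pL < W) by (unfold pL; lia).
  pose proof (posf_le pr (j + y) ltac:(lia)).
  assert (Hstep : forall s', given n w pr pz kn s' ->
    copying n w pr s' b j l (if pr (b + y) =? pL then y + 2 else y + 1) f0 l0 r0 wo po ko fr ->
    given n w pr pz kn s' /\
    exists y1, y < y1 <= l /\ copying n w pr s' b j l y1 f0 l0 r0 wo po ko fr).
  { intros s' H1 H2; split; auto; pose proof (proj1 (proj2 H2)) as Hl.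
    eexists; split; [|exact H2]; destruct (pr (b + y) =? pL); lia. }
  destruct Hg as (Hn & Hw & Hpr & Hpz & Hkn).
  destruct s as [vr ar]; cbn [var arr] in *.
  pose proof (copying_step n w pr pz kn (State vr ar)) as Hcs.
  unfold copy_letter, advance'; wpsimpl; rewrite Hpr, R1.
  destruct (pr (b + y) =? pL) eqn:Eq; wpsplit; try lia; try apply Hstep.
  all: try (unfold given; ands; auto; fail).
  all: eapply Hcs; eauto; cbv [var arr String.eqb Ascii.eqb Bool.eqb];
    rewrite ?Eq, ?R1, ?R2, ?C3; try reflexivity; lia.
Qed.

(** Each new letter turns two free letters into one, so free phrases written plus letters introduced
    equal the old free letters consumed. Summed over the rounds, this balance bounds the number of
    rules. *)
Definition replacing (n : nat) (w pr pz kn : nat -> nat) (m f f0 : nat)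
    (l0 r0 : nat -> nat) (s : state) (i : nat) : Prop :=
  given n w pr pz kn s /\ 1 <= i /\ rewritten n w pr s i f0 l0 r0 /\
  arr s "pocz'" (posf pr i) = 0 /\ arr s "kon'" (posf pr i) = 0 /\
  exists md fd mr fr F, todo n pr w pz kn i mr fr /\ md + mr = m /\ fd + fr = f /\
    parsed (arr s "w'") (arr s "pocz'") (arr s "kon'") (posf pr i) F /\
    facs F = md /\ frees F + (var s "fresh" - f0) = fd.

Lemma new_factor_correct W n w pr pz kn m f f0 l0 r0 s i :
  n + 10 < W -> bounded W s -> wfpair pr (n + 1) ->
  replacing n w pr pz kn m f f0 l0 r0 s i -> i <= n -> pz i <> 0 ->
  runs W new_factor s (fun t s' => exists i', i < i' <= n + 1 /\
    replacing n w pr pz kn m f f0 l0 r0 s' i' /\ t <= 30 * (i' - i)).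
Proof.
  intros HW HB Hwf (Hg & Hi1 & Hrw & Hz & Hk & md & fd & mr & fr & F &
    Htodo & Hm & Hf & HF & HFm & HFf)
    Hi Hpz.
  inversion Htodo as [|b m' f' Hp1 Hp2 Hp3 H1|b m' f' Hp1 Hp2 Hp3 Hp4 Hp5 Hp6 H1
                     |b j l m' f' Hfac He HpL HpR H1]; subst; try lia; try congruence.
  pose proof Hfac as (F1 & F2 & F3 & F4 & F5 & F6 & F7).
  pose proof (todo_le H1) as Hbl.
  pose proof (posf_le pr (i + l) ltac:(lia)) as Hpil.
  assert (HjR : pr j <> pR).
  { specialize (He 0 ltac:(lia)); rewrite !Nat.add_0_r in He; rewrite He, HpL; discriminate. }
  pose proof (posf_lt pr j i ltac:(lia) ltac:(lia) HjR) as Hjlt.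
  assert (Hlt : posf pr i < posf pr (i + l)).
  { apply posf_lt; try lia; rewrite HpL; discriminate. }
  pose proof (rw_i Hrw) as Ei.
  pose proof (rw_i' Hrw) as Ei'.
  apply wp_runs; auto.
  apply wp_seq; split; [exact I|].
  match goal with |- wp W _ ?s0 _ => set (s1 := s0) end.
  assert (Ej : var s1 "j'" = posf pr j).
  { unfold s1; destruct Hg as (_ & _ & _ & Gz & _); simpl.
    rewrite Ei, Gz, F3; apply (rw_pos Hrw); auto. }
  apply wp_seq; split; [exact I|]; split; [exact I|].
  match goal with |- wp W _ ?s0 _ => set (s2 := s0) end.
  assert (Hg2 : given n w pr pz kn s2).
  { destruct Hg as (G1 & G2 & G3 & G4 & G5); unfold given, s2, s1; ands; auto. }
  assert (Hpz2 : arr s2 "pocz'" = upd (arr s "pocz'") (posf pr i) (posf pr j)).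
  { unfold upd; rewrite <- Ei', <- Ej; reflexivity. }
  assert (HC : copying n w pr s2 i j l 0 f0 l0 r0 (arr s "w'") (arr s "pocz'") (arr s "kon'")
                 (var s "fresh")).
  { split; [|rewrite Hpz2, !Nat.add_0_r; ands].
    - rewrite Nat.add_0_r; destruct Hrw as [R1 R2 R3 R4 R6 R7 R8]; constructor; auto.
    - lia.
    - intros _; rewrite HpL; discriminate.
    - exact Ej.
    - reflexivity.
    - intros x Hx; upds; ands; reflexivity.
    - apply upd_same.
    - intros x Hx; lia.
    - intros x Hx; replace x with (posf pr i) by lia; exact Hk.
    - intros z Hz'; lia. }
  apply wp_seq, wp_seq.
  eapply wp_mono; [apply (copy_letter_correct W n w pr pz kn s2 i j l 0 f0 l0 r0
    (arr s "w'") (arr s "pocz'") (arr s "kon'") (var s "fresh")); auto; lia|].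
  cbn beta; intros t3 s3 (Ht3 & Hg3 & y & Hy & HC3) HB3.
  eapply runs_conseq.
  { apply runs_while with
      (I := fun s' => given n w pr pz kn s' /\ exists y, 1 <= y <= l /\
         copying n w pr s' i j l y f0 l0 r0 (arr s "w'") (arr s "pocz'") (arr s "kon'")
           (var s "fresh"))
      (P := fun s' => 20 * (i + l - var s' "i")); auto.
    - intros s' _ (_ & y' & Hy' & HC' & _).
      pose proof (rw_i HC'); simpl; lia.
    - intros s' _ (Hg' & y' & Hy' & HC') Hb.
      pose proof (rw_i (proj1 HC')) as Ei2.
      simpl in Hb; apply negb_true_iff, Nat.eqb_neq in Hb.
      destruct Hg' as (G1 & G2 & G3 & G4 & G5); rewrite G5, Ei2 in Hb.
      assert (y' <> l) by (intros ->; contradiction).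
      eapply wp_mono; [apply (copy_letter_correct W n w pr pz kn s' i j l y' f0 l0 r0
        (arr s "w'") (arr s "pocz'") (arr s "kon'") (var s "fresh")); auto|].
      + unfold given; auto.
      + lia.
      + cbn beta; intros t4 s4 (Ht4 & Hg4 & y4 & Hy4 & HC4).
        pose proof (rw_i (proj1 HC4)) as Ei4.
        split; [split; auto; exists y4; split; auto; lia|lia].
    - split; auto; exists y; split; auto; lia. }
  cbn beta; intros t4 s4 ((Hg4 & y4 & Hy4 & HC4) & Hb & Ht4).
  pose proof HC4 as [Hrw4 (C1 & C2 & C3 & C4 & C5 & C6 & C7 & C8 & C9)].
  pose proof (rw_i Hrw4) as Ei4.
  pose proof (rw_i' Hrw4) as Ei4'.
  pose proof (rw_i (proj1 HC3)) as Ei3.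
  simpl in Hb; apply negb_false_iff, Nat.eqb_eq in Hb.
  assert (y4 = l).
  { destruct (Nat.eq_dec y4 l); auto; exfalso.
    destruct Hg4 as (_ & _ & _ & _ & G5); rewrite G5, Ei4, F6 in Hb by lia; discriminate. }
  subst y4.
  split; [simpl; lia|split; [simpl; lia|]].
  exists (i + l); split; [lia|]; split; [|lia].
  match goal with |- replacing _ _ _ _ _ _ _ _ _ _ ?s0 _ => set (s5 := s0) end.
  assert (Hko5 : arr s5 "kon'" = upd (arr s4 "kon'") (posf pr (i + l) - 1) 1).
  { rewrite <- Ei4'; reflexivity. }
  split; [|split; [lia|split; [|rewrite Hko5; split; [|split]]]].
  - exact Hg4.
  - destruct Hrw4; constructor; auto.
  - apply C7; lia.
  - upds; apply C8; lia.
  - exists (facs F + 1), (frees F + (var s "fresh" - f0)), m', fr,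
      (F ++ [Factor (posf pr j) (posf pr (i + l) - posf pr i)]).
    rewrite facs_app, frees_app; cbn [is_free]; ands; auto; try lia.
    + replace (posf pr (i + l)) with (posf pr i + (posf pr (i + l) - posf pr i)) at 2 by lia.
      pose proof (posf_pos pr j).
      apply parsed_factor; try lia.
      * eapply parsed_ext; [eapply parsed_word_ext; [exact HF|]|].
        -- intros x Hx; apply C5; lia.
        -- intros x Hx; destruct (C5 x (proj2 Hx)) as (_ & <- & <-); upds; auto.
      * exact C6.
      * intros x Hx; apply C7; lia.
      * replace (posf pr i + (posf pr (i + l) - posf pr i) - 1) with (posf pr (i + l) - 1) by lia.
        apply upd_same.
      * intros x Hx; upds; apply C8; lia.
      * intros z Hz'; apply C9; lia.
Qed.

Lemma new_letter_correct W n w pr pz kn m f f0 l0 r0 s i :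
  n + 10 < W -> f0 + n + 10 < W -> wfpair pr (n + 1) -> pr n <> pL ->
  replacing n w pr pz kn m f f0 l0 r0 s i -> i <= n -> pz i = 0 ->
  wp W new_letter s (fun t s' => exists i', i < i' <= n + 1 /\
    replacing n w pr pz kn m f f0 l0 r0 s' i' /\ t <= 20).
Proof.
  intros HW HW2 Hwf HnL (Hg & Hi1 & Hrw & Hz & Hk & md & fd & mr & fr & F &
    Htodo & Hm & Hf & HF & HFm & HFf)
    Hi Hpz.
  destruct Hrw as [R1 R2 R3 R4 R6 R7 R8].
  assert (Hlit : pL < W) by (unfold pL; lia).
  set (p := posf pr i) in *.
  destruct Hg as (Hn & Hw & Hpr & Hpz' & Hkn).
  destruct s as [vr ar]; cbn [var arr] in *.
  assert (Hold : forall x, 1 <= x < i -> pr x <> pR -> posf pr x < p)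
    by (intros; apply posf_lt; lia || auto).
  unfold new_letter, advance'; wpsimpl; rewrite Hpr, R1, R2.
  inversion Htodo as [|b m' f' Hp1 Hp2 Hp3 H1|b m' f' Hp1 Hp2 Hp3 Hp4 Hp5 Hp6 H1
                     |b j l m' f' Hfac He HpL HpR H1]; try subst b; try lia.
  - assert (Hp' : posf pr (i + 1) = p + 1).
    { rewrite posf_S, Hp1 by lia; reflexivity. }
    rewrite Hp1; wpsplit; try lia; try discriminate.
    exists (i + 1); split; [lia|]; split; [|lia].
    match goal with |- replacing _ _ _ _ _ _ _ _ _ _ ?s0 _ => set (s5 := s0) end.
    assert (Ew : arr s5 "w'" = upd (ar "w'") p (w i)) by (rewrite <- Hw; reflexivity).
    split; [|split; [lia|split; [|split; [|split]]]].
    + unfold given; ands; auto.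
    + constructor; auto.
      * intros x Hx HxR; change (arr s5 "pos") with (upd (ar "pos") i p).
        destruct (Nat.eq_dec x i) as [->|]; upds; auto; apply R3; auto; lia.
      * intros x Hx; rewrite Ew.
        destruct (Nat.eq_dec (pr x) pR) as [ER|NR].
        { split; rewrite ER; discriminate. }
        destruct (Nat.eq_dec x i) as [->|].
        { split; intros Hpx; [fold p; apply upd_same|].
          rewrite Hp1 in Hpx; discriminate. }
        specialize (Hold x ltac:(lia) NR).
        eapply coded_ext; [apply R4; lia| | |]; auto; upds; auto.
      * change (var s5 "fresh") with (vr "fresh"); lia.
    + rewrite Hp'; change (arr s5 "pocz'") with (upd (ar "pocz'") (p + 1) 0); apply upd_same.
    + rewrite Hp'; change (arr s5 "kon'") with (upd (ar "kon'") (p + 1) 0); apply upd_same.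
    + exists md, (fd + 1), mr, f', (F ++ [Free (w i)]).
      rewrite facs_app, frees_app; cbn [is_free]; subst mr; ands; auto; try lia.
      * rewrite Hp'; replace (w i) with (arr s5 "w'" p) by (rewrite Ew; apply upd_same).
        apply parsed_free.
        -- eapply parsed_ext; [eapply parsed_word_ext; [exact HF|]|].
           ++ intros x Hx; rewrite Ew; upds; auto.
           ++ intros x Hx; change (arr s5 "pocz'") with (upd (ar "pocz'") (p + 1) 0).
              change (arr s5 "kon'") with (upd (ar "kon'") (p + 1) 0); upds; auto.
        -- change (arr s5 "pocz'") with (upd (ar "pocz'") (p + 1) 0); upds; auto.
        -- change (arr s5 "kon'") with (upd (ar "kon'") (p + 1) 0); upds; auto.
      * change (var s5 "fresh") with (vr "fresh"); lia.
  - assert (Hi2 : i + 1 <= n).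
    { destruct (Nat.eq_dec i n) as [->|]; [contradiction|lia]. }
    assert (Hp' : posf pr (i + 2) = p + 1).
    { replace (i + 2) with (i + 1 + 1) by lia; rewrite !posf_S, Hp1, Hp2 by lia.
      fold p; unfold pL, pR; simpl; lia. }
    rewrite Hp1; wpsplit; try lia; try contradiction.
    exists (i + 2); split; [lia|]; split; [|lia].
    match goal with |- replacing _ _ _ _ _ _ _ _ _ _ ?s0 _ => set (s5 := s0) end.
    assert (Ew : arr s5 "w'" = upd (ar "w'") p (vr "fresh")) by reflexivity.
    assert (El : arr s5 "left" = upd (ar "left") (vr "fresh") (w i)) by (rewrite <- Hw; reflexivity).
    assert (Er : arr s5 "right" = upd (ar "right") (vr "fresh") (w (i + 1)))
      by (rewrite <- Hw; reflexivity).
    assert (Ef : var s5 "fresh" = vr "fresh" + 1) by reflexivity.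
    split; [|split; [lia|split; [|split; [|split]]]].
    + unfold given; ands; auto.
    + constructor; auto.
      * intros x Hx HxR; change (arr s5 "pos") with (upd (ar "pos") i p).
        destruct (Nat.eq_dec x i) as [->|]; upds; auto; apply R3; auto.
        destruct (Nat.eq_dec x (i + 1)) as [->|]; [contradiction|lia].
      * intros x Hx; rewrite Ew, El, Er, Ef.
        destruct (Nat.eq_dec (pr x) pR) as [ER|NR].
        { split; rewrite ER; discriminate. }
        destruct (Nat.eq_dec x i) as [->|].
        { split; intros Hpx; [rewrite Hp1 in Hpx; discriminate|].
          fold p; rewrite !upd_same; ands; auto; lia. }
        assert (x < i) by (destruct (Nat.eq_dec x (i + 1)) as [->|]; [contradiction|lia]).
        specialize (Hold x ltac:(lia) NR).
        eapply coded_ext with (f1 := vr "fresh"); [apply R4; lia| | |]; upds; auto; try lia.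
        intros c Hc; upds; auto.
      * rewrite Ef; lia.
      * intros c Hc; rewrite El, Er; upds; auto.
      * intros c Hc; rewrite El, Er; rewrite Ef in Hc.
        destruct (Nat.eq_dec c (vr "fresh")) as [->|].
        { exists i; rewrite !upd_same; ands; auto; lia. }
        destruct (R8 c ltac:(lia)) as (x & Hx & E1 & E2); exists x; upds; auto.
    + rewrite Hp'; change (arr s5 "pocz'") with (upd (ar "pocz'") (p + 1) 0); apply upd_same.
    + rewrite Hp'; change (arr s5 "kon'") with (upd (ar "kon'") (p + 1) 0); apply upd_same.
    + exists md, (fd + 2), mr, f', (F ++ [Free (arr s5 "w'" p)]).
      rewrite facs_app, frees_app; cbn [is_free]; subst mr; ands; auto; try lia.
      rewrite Hp'; apply parsed_free.
      * eapply parsed_ext; [eapply parsed_word_ext; [exact HF|]|].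
        -- intros x Hx; rewrite Ew; upds; auto.
        -- intros x Hx; change (arr s5 "pocz'") with (upd (ar "pocz'") (p + 1) 0).
           change (arr s5 "kon'") with (upd (ar "kon'") (p + 1) 0); upds; auto.
      * change (arr s5 "pocz'") with (upd (ar "pocz'") (p + 1) 0); upds; auto.
      * change (arr s5 "kon'") with (upd (ar "kon'") (p + 1) 0); upds; auto.
  - destruct Hfac as (F1 & F2 & F3 & _); lia.
Qed.

Lemma runs_if W b c1 c2 s Q :
  bounded W s -> bsafe W s b ->
  runs W (if bev s b then c1 else c2) s (fun t => Q (S t)) -> runs W (If b c1 c2) s Q.
Proof.
  intros HB Hb (t & s' & HE & HQ); exists (S t), s'; split; auto.
  econstructor; [apply beval_bev; auto|auto].
Qed.

Lemma copy_back_correct W n s :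
  n + 10 < W -> bounded W s -> var s "n" = n -> var s "i" = 1 ->
  runs W copy_back s (fun t s' => t <= 20 * n + 1 /\
    forall x, 1 <= x <= n -> arr s' "w" x = arr s "w'" x /\
      arr s' "pocz" x = arr s "pocz'" x /\ arr s' "kon" x = arr s "kon'" x).
Proof.
  intros HW HB Hn Hi.
  eapply runs_conseq.
  - apply runs_while with
      (I := fun s' => var s' "n" = n /\ 1 <= var s' "i" <= n + 1 /\
         arr s' "w'" = arr s "w'" /\ arr s' "pocz'" = arr s "pocz'" /\ arr s' "kon'" = arr s "kon'" /\
         forall x, 1 <= x < var s' "i" -> arr s' "w" x = arr s "w'" x /\
           arr s' "pocz" x = arr s "pocz'" x /\ arr s' "kon" x = arr s "kon'" x)
      (P := fun s' => 20 * (n + 1 - var s' "i")); auto.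
    + intros s' _ _; simpl; auto.
    + intros [vr ar] HB' (E1 & E2 & E3 & E4 & E5 & E6) Hb; cbn [var arr] in *.
      simpl in Hb; apply Nat.leb_le in Hb.
      wpsimpl; wpsplit; auto; try lia.
      intros x Hx; destruct (Nat.eqb_spec x (vr "i")) as [->|].
      * destruct s as [v a]; cbn [arr] in *; rewrite E3, E4, E5; auto.
      * destruct (E6 x ltac:(lia)) as (A & B & C).
        destruct s as [v a]; cbn [arr] in *; auto.
    + ands; auto; try lia.
  - cbn beta; intros t s' ((E1 & E2 & E3 & E4 & E5 & E6) & Hb & Ht).
    simpl in Hb; apply Nat.leb_gt in Hb; rewrite Hi in Ht.
    split; [lia|]; intros x Hx; apply E6; lia.
Qed.

Lemma replace_correct W n w pr pz kn m f f0 s :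
  1 <= n -> f0 + n + 10 < W -> bounded W s -> wfpair pr (n + 1) -> pr n <> pL ->
  given n w pr pz kn s -> done pr w pz kn (n + 1) m f -> var s "fresh" = f0 ->
  runs W replace s (fun t s' => t <= 100 * n /\ exists q f',
    var s' "n" + 1 = posf pr (n + 1) /\
    rest (var s' "n") (arr s' "w") (arr s' "pocz") (arr s' "kon") 1 m f' /\
    f' + q = f /\ var s' "fresh" = f0 + q /\ q + var s' "n" <= n /\
    (forall x, 1 <= x <= n ->
       coded pr w (arr s' "w") (arr s' "left") (arr s' "right") f0 (f0 + q) x) /\
    (forall c, c < f0 -> arr s' "left" c = arr s "left" c /\
                         arr s' "right" c = arr s "right" c) /\
    (forall c, f0 <= c < f0 + q -> exists x, 1 <= x < n /\
       arr s' "left" c = w x /\ arr s' "right" c = w (x + 1))).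
Proof.
  intros Hn HW HB Hwf HnL Hg Hdone Hf0.
  pose proof (done_todo _ _ _ _ _ _ _ _ _ _ Hdone (todo_nil n pr w pz kn)) as Htodo.
  rewrite !Nat.add_0_r in Htodo.
  rewrite replace_def; apply wp_runs; auto.
  apply wp_seq; split; [simpl; lia|].
  apply wp_seq; split; [simpl; lia|].
  apply wp_seq.
  unfold advance'; apply wp_seq; split; [simpl; lia|].
  apply wp_seq; split; [exact I|split; [simpl; lia|]].
  split; [exact I|split; [simpl; lia|]].
  apply wp_seq.
  match goal with |- wp W _ ?s0 _ => set (s1 := s0) end.
  intros HB1.
  assert (Hstart : replacing n w pr pz kn m f f0 (arr s "left") (arr s "right") s1 1).
  { split; [exact Hg|]; split; [lia|].
    split; [constructor; try (intros; lia); auto|].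
    - change (var s1 "fresh") with (var s "fresh"); unfold posf; simpl; lia.
    - change (var s1 "fresh") with (var s "fresh"); intros; lia.
    - split; [reflexivity|split; [reflexivity|]].
      exists 0, 0, m, f, []; ands; auto; [constructor|].
      change (var s1 "fresh") with (var s "fresh"); unfold frees; simpl; lia. }
  eapply runs_conseq.
  { eapply runs_frame; [exact HB1|].
    apply runs_while_runs with
      (I := fun s' => exists i, i <= n + 1 /\
         replacing n w pr pz kn m f f0 (arr s "left") (arr s "right") s' i)
      (P := fun s' => 40 * (n + 1 - var s' "i")); auto.
    - intros s' _ _; simpl; auto.
    - intros s' HB' (i & Hi & HI) Hb.
      pose proof HI as ((G1 & G2 & G3 & G4 & G5) & Hi1 & Hrw & _).
      pose proof (rw_i Hrw) as Ei.
      simpl in Hb; apply Nat.leb_le in Hb; rewrite G1, Ei in Hb.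
      apply runs_if; auto; [simpl; lia|].
      simpl; rewrite Ei, G4; destruct (Nat.eqb_spec (pz i) 0) as [Ez|Ez]; simpl.
      + apply wp_runs; auto.
        eapply wp_mono.
        { apply (new_letter_correct W n w pr pz kn m f f0 (arr s "left") (arr s "right") s' i);
            auto; lia. }
        cbn beta; intros t s2 (i2 & Hi2 & HI2 & Ht).
        pose proof (rw_i (proj1 (proj2 (proj2 HI2)))) as Ei2.
        split; [exists i2; split; auto; lia|lia].
      + eapply runs_conseq.
        { apply (new_factor_correct W n w pr pz kn m f f0 (arr s "left") (arr s "right") s' i);
            auto; lia. }
        cbn beta; intros t s2 (i2 & Hi2 & HI2 & Ht).
        pose proof (rw_i (proj1 (proj2 (proj2 HI2)))) as Ei2.
        split; [exists i2; split; auto; lia|lia].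
    - exists 1; split; auto; lia. }
  cbn beta; intros t2 s2 (((i & Hi & HI) & Hb & Ht2) & HB2 & Fv & Fa).
  destruct HI as (Hg2 & Hi1 & Hrw & Hz & Hk & md & fd & mr & fr & F &
    Htodo2 & Hm & Hf & HF & HFm & HFf).
  destruct Hrw as [R1 R2 R3 R4 R6 R7 R8].
  simpl in Hb; apply Nat.leb_gt in Hb; rewrite R1, (proj1 Hg2) in Hb.
  assert (Ein : i = n + 1) by lia; clear Hb; rewrite Ein in *; clear Ein.
  assert (Hmf : mr = 0 /\ fr = 0).
  { inversion Htodo2 as [|b m' f' Hp1 Hp2 Hp3 H1|b m' f' Hp1 Hp2 Hp3 Hp4 Hp5 Hp6 H1
                     |b j l m' f' Hfac He HpL HpR H1]; auto; exfalso;
      try (pose proof (todo_le H1)); try lia.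
    destruct Hfac as (_ & Hl & _); lia. }
  destruct Hmf; subst mr fr.
  apply wp_seq; split; [simpl; rewrite R2; lia|].
  apply wp_seq; split; [simpl; lia|].
  match goal with |- wp W _ ?s0 _ => set (s3 := s0) end.
  intros HB3.
  set (n' := posf pr (n + 1) - 1).
  eapply runs_conseq.
  { eapply runs_frame; [exact HB3|].
    apply (copy_back_correct W n' s3); auto; [lia|].
    unfold n'; rewrite <- R2; reflexivity. }
  cbn beta; intros t4 s4 ((Ht4 & Hcp) & _ & Gv & Ga).
  change (arr s3) with (arr s2) in *.
  assert (En : var s4 "n" = n').
  { rewrite Gv by reflexivity; unfold n'; rewrite <- R2; reflexivity. }
  assert (Ef : var s4 "fresh" = var s2 "fresh") by (rewrite Gv; reflexivity).
  assert (El : arr s4 "left" = arr s2 "left") by (rewrite Ga; reflexivity).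
  assert (Er : arr s4 "right" = arr s2 "right") by (rewrite Ga; reflexivity).
  assert (Hn' : n' + 1 = posf pr (n + 1)) by (unfold n'; pose proof (posf_pos pr (n + 1)); lia).
  split.
  { change (var s1 "i") with 1 in Ht2; lia. }
  exists (var s2 "fresh" - f0), (frees F); rewrite En, Ef, El, Er; ands; auto; try lia.
  - replace m with (facs F + 0) by lia; replace (frees F) with (frees F + 0) by lia.
    apply parsed_rest with (n' + 1); [|constructor].
    rewrite Hn'; eapply parsed_ext; [eapply parsed_word_ext; [exact HF|]|].
    + intros x Hx; apply Hcp; lia.
    + intros x Hx; split; apply Hcp; lia.
  - intros x Hx; destruct (Nat.eq_dec (pr x) pR) as [ER|NR].
    { split; rewrite ER; discriminate. }
    eapply coded_ext; [apply R4; lia| | |]; auto; [|lia].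
    pose proof (posf_lt pr x (n + 1) ltac:(lia) ltac:(lia) NR).
    pose proof (posf_pos pr x); apply Hcp; lia.
  - intros c Hc; apply R8; lia.
Qed.

(** * Letters, rules and derivations *)

Record listed (w sg : nat -> nat) (ns base i : nat) : Prop := {
  listed_count : ns <= i - 1;
  listed_from : forall k, 1 <= k <= ns -> exists x, 1 <= x < i /\ sg k = w x;
  listed_base : forall k, 1 <= k <= ns -> sg k < base;
  listed_inj : forall k k', 1 <= k <= ns -> 1 <= k' <= ns -> sg k = sg k' -> k = k';
  listed_all : forall x, 1 <= x < i -> exists k, 1 <= k <= ns /\ sg k = w x
}.

Arguments listed_count {w sg ns base i}.

Lemma listed_skip w sg ns base i k :
  listed w sg ns base i -> 1 <= k <= ns -> sg k = w i -> listed w sg ns base (i + 1).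
Proof.
  intros [H1 H2 H3 H4 H5] Hk E; constructor; auto; try lia.
  - intros k' Hk'; destruct (H2 k' Hk') as (x & Hx & Ex); exists x; split; auto; lia.
  - intros x Hx; destruct (Nat.eq_dec x i) as [->|]; [eauto|apply H5; lia].
Qed.

Lemma listed_add w sg ns base base' i :
  1 <= i -> listed w sg ns base i -> (forall k, 1 <= k <= ns -> sg k <> w i) ->
  base <= base' -> w i < base' ->
  listed w (upd sg (ns + 1) (w i)) (ns + 1) base' (i + 1).
Proof.
  intros Hi [H1 H2 H3 H4 H5] Hne Hb Hb'.
  assert (E : forall k, k <= ns -> upd sg (ns + 1) (w i) k = sg k)
    by (intros; apply upd_other; lia).
  constructor; try lia.
  - intros k Hk; destruct (Nat.eq_dec k (ns + 1)) as [->|].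
    + exists i; rewrite upd_same; split; auto; lia.
    + rewrite E by lia; destruct (H2 k ltac:(lia)) as (x & Hx & Ex); exists x; split; auto; lia.
  - intros k Hk; destruct (Nat.eq_dec k (ns + 1)) as [->|]; [now rewrite upd_same|].
    rewrite E by lia; specialize (H3 k ltac:(lia)); lia.
  - intros k k' Hk Hk'.
    destruct (Nat.eq_dec k (ns + 1)) as [->|], (Nat.eq_dec k' (ns + 1)) as [->|]; auto;
      rewrite ?upd_same, ?E by lia.
    + intros Ew; exfalso; apply (Hne k'); auto; lia.
    + intros Ew; exfalso; apply (Hne k); auto; lia.
    + apply H4; lia.
  - intros x Hx; destruct (Nat.eq_dec x i) as [->|].
    + exists (ns + 1); rewrite upd_same; split; auto; lia.
    + destruct (H5 x ltac:(lia)) as (k & Hk & Ek); exists k; rewrite E by lia; split; auto; lia.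
Qed.

(** The preceding subroutine may have left anything in [seen]. Only the cells indexed by letters of
    the word are ever read, and the first loop clears exactly these in linear time. *)
Lemma alphabet_correct W n w A s :
  A + n + 10 < W -> bounded W s -> var s "n" = n -> arr s "w" = w ->
  (forall x, 1 <= x <= n -> w x <= A) ->
  runs W alphabet s (fun t s' => t <= 60 * n + 20 /\
    listed w (arr s' "sigma") (var s' "nsigma") (var s' "base") (n + 1) /\
    var s' "base" <= A + 1 /\ var s' "fresh" = var s' "base").
Proof.
  intros HW HB Hn Hw HA; apply wp_runs; auto; unfold alphabet.
  apply wp_seq; split; [simpl; lia|].
  match goal with |- wp W _ ?s0 _ => set (s1 := s0) end.
  apply wp_seq; intros HB1.
  eapply runs_conseq.
  { eapply runs_frame; [exact HB1|].
    apply runs_while with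
      (I := fun s => var s "n" = n /\ arr s "w" = w /\ 1 <= var s "i" <= n + 1 /\
         forall x, 1 <= x < var s "i" -> arr s "seen" (w x) = 0)
      (P := fun s => 10 * (n + 1 - var s "i")); auto.
    - intros s' _ _; simpl; auto.
    - intros [vr ar] HB' (E1 & E2 & E3 & E4) Hb; cbn [var arr] in *.
      simpl in Hb; apply Nat.leb_le in Hb.
      wpsimpl; wpsplit; auto; try lia.
      intros x Hx; rewrite E2; destruct (Nat.eqb_spec (w x) (w (vr "i"))) as [|Ne]; auto.
      apply E4; destruct (Nat.eq_dec x (vr "i")) as [->|]; [congruence|lia].
    - unfold s1; simpl; ands; auto; try lia; intros; lia. }
  cbn beta; intros t1 s2 (((E1 & E2 & E3 & E4) & Hb & Ht) & HB2 & _ & _).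
  simpl in Hb; apply Nat.leb_gt in Hb.
  assert (Hseen : forall x, 1 <= x <= n -> arr s2 "seen" (w x) = 0) by (intros; apply E4; lia).
  change (var s1 "i") with 1 in Ht.
  do 3 (apply wp_seq; split; [simpl; lia|]).
  match goal with |- wp W _ ?s0 _ => set (s3 := s0) end.
  apply wp_seq; intros HB3.
  eapply runs_conseq.
  { eapply runs_frame; [exact HB3|].
    apply runs_while with
      (I := fun s => var s "n" = n /\ arr s "w" = w /\ 1 <= var s "i" <= n + 1 /\
         var s "base" <= A + 1 /\
         listed w (arr s "sigma") (var s "nsigma") (var s "base") (var s "i") /\
         forall x, 1 <= x <= n ->
           (arr s "seen" (w x) = 0 -> forall k, 1 <= k <= var s "nsigma" -> arr s "sigma" k <> w x) /\
           (arr s "seen" (w x) <> 0 -> exists k, 1 <= k <= var s "nsigma" /\ arr s "sigma" k = w x))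
      (P := fun s => 30 * (n + 1 - var s "i")); auto.
    - intros s' _ _; simpl; auto.
    - intros [vr ar] HB' (F1 & F2 & F3 & F4 & F5 & F6) Hbb; cbn [var arr] in *.
      simpl in Hbb; apply Nat.leb_le in Hbb.
      pose proof (listed_count F5).
      pose proof (HA (vr "i") ltac:(lia)).
      assert (Hnew : forall base', ar "seen" (w (vr "i")) = 0 -> vr "base" <= base' ->
        w (vr "i") < base' ->
        listed w (upd (ar "sigma") (vr "nsigma" + 1) (w (vr "i"))) (vr "nsigma" + 1) base' (vr "i" + 1) /\
        forall x, 1 <= x <= n ->
          (upd (ar "seen") (w (vr "i")) 1 (w x) = 0 -> forall k, 1 <= k <= vr "nsigma" + 1 ->
             upd (ar "sigma") (vr "nsigma" + 1) (w (vr "i")) k <> w x) /\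
          (upd (ar "seen") (w (vr "i")) 1 (w x) <> 0 -> exists k, 1 <= k <= vr "nsigma" + 1 /\
             upd (ar "sigma") (vr "nsigma" + 1) (w (vr "i")) k = w x)).
      { intros base' Hs Hb1 Hb2; destruct (F6 (vr "i") ltac:(lia)) as [K1 _]; specialize (K1 Hs).
        split; [apply listed_add with (vr "base"); auto; lia|].
        intros x Hx; destruct (F6 x Hx) as [K2 K3]; split; intros Hsx.
        - assert (Ne : w x <> w (vr "i")) by (intros Ex; rewrite Ex, upd_same in Hsx; lia).
          rewrite upd_other in Hsx by auto; intros k Hk.
          destruct (Nat.eq_dec k (vr "nsigma" + 1)) as [->|]; [rewrite upd_same; auto|].
          rewrite upd_other by auto; apply K2; auto; lia.
        - destruct (Nat.eq_dec (w x) (w (vr "i"))) as [Ex|Ne].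
          + exists (vr "nsigma" + 1); rewrite upd_same; split; auto; lia.
          + rewrite upd_other in Hsx by auto; destruct (K3 Hsx) as (k & Hk & Ek).
            exists k; rewrite upd_other by lia; split; auto; lia. }
      wpsimpl; rewrite F2; wpsplit; auto; try lia.
      + exact (proj1 (Hnew (w (vr "i") + 1) E ltac:(lia) ltac:(lia))).
      + exact (proj2 (Hnew (w (vr "i") + 1) E ltac:(lia) ltac:(lia))).
      + exact (proj1 (Hnew (vr "base") E ltac:(lia) ltac:(lia))).
      + exact (proj2 (Hnew (vr "base") E ltac:(lia) ltac:(lia))).
      + destruct (F6 (vr "i") ltac:(lia)) as [_ K]; destruct (K E) as (k & Hk & Ek).
        eapply listed_skip; eauto.
    - unfold s3; simpl; ands; auto; try lia.
      + constructor; intros; lia.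
      + intros x Hx; split; intros Hs; [intros k; lia|].
        rewrite Hseen in Hs by auto; contradiction. }
  cbn beta; intros t2 s4 (((F1 & F2 & F3 & F4 & F5 & F6) & Hb2 & Ht2) & HB4 & _ & _).
  simpl in Hb2; apply Nat.leb_gt in Hb2.
  change (var s3 "i") with 1 in Ht2.
  assert (Ei : var s4 "i" = n + 1) by lia; rewrite Ei in F5.
  destruct s4 as [vr ar]; cbn [var arr] in *.
  wpsimpl; wpsplit; auto; lia.
Qed.

Lemma derives_mono R R' x u :
  (forall r, In r R -> In r R') -> derives R x u -> derives R' x u.
Proof. intros H; induction 1; [eapply derives_ter|eapply derives_bin]; eauto. Qed.

(** The letters at the positions [1], ..., [k] derive [v]. *)
Inductive gen (R : list (nat * rhs)) (w : nat -> nat) : nat -> word -> Prop :=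
| gen_nil : gen R w 0 []
| gen_S k v u : gen R w k v -> derives R (w (S k)) u -> gen R w (S k) (v ++ u).

Definition rules (sg lf rt : nat -> nat) (ns b f : nat) : list (nat * rhs) :=
  map (fun i => (sg i, Ter (sg i))) (seq 1 ns) ++
  map (fun c => (c, Bin (lf c) (rt c))) (seq b (f - b)).

Lemma in_rules_ter sg lf rt ns b f k :
  1 <= k <= ns -> In (sg k, Ter (sg k)) (rules sg lf rt ns b f).
Proof.
  intros Hk; apply in_or_app; left.
  apply (in_map (fun i => (sg i, Ter (sg i)))), in_seq; lia.
Qed.

Lemma in_rules_bin sg lf rt ns b f c :
  b <= c < f -> In (c, Bin (lf c) (rt c)) (rules sg lf rt ns b f).
Proof.
  intros Hc; apply in_or_app; right.
  apply (in_map (fun c => (c, Bin (lf c) (rt c)))), in_seq; lia.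
Qed.

Lemma rules_mono sg lf rt lf' rt' ns b f f' r :
  f <= f' -> (forall c, c < f -> lf' c = lf c /\ rt' c = rt c) ->
  In r (rules sg lf rt ns b f) -> In r (rules sg lf' rt' ns b f').
Proof.
  intros Hf H Hr; apply in_app_or in Hr as [Hr|Hr]; apply in_or_app; [auto|right].
  apply in_map_iff in Hr as (c & <- & Hc); apply in_seq in Hc.
  destruct (H c) as [<- <-]; [lia|].
  apply (in_map (fun c => (c, Bin (lf' c) (rt' c)))), in_seq; lia.
Qed.

(** An unpaired letter keeps its derivation, and a letter standing for a pair derives the
    concatenation. Old rules survive because rounds only write rules from [f0] on. The induction
    runs over prefixes that do not cut a pair. *)
Lemma gen_replaced n pr w w' sg lf rt lf' rt' ns b f0 f1 v :
  wfpair pr (n + 1) -> b <= f0 -> f0 <= f1 ->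
  (forall c, c < f0 -> lf' c = lf c /\ rt' c = rt c) ->
  (forall x, 1 <= x <= n -> coded pr w w' lf' rt' f0 f1 x) ->
  pr n <> pL ->
  gen (rules sg lf rt ns b f0) w n v ->
  gen (rules sg lf' rt' ns b f1) w' (heads pr n) v.
Proof.
  intros [W1 W2 W3 W4] Hb Hf Hold Hcode.
  assert (Hmono : forall x u, derives (rules sg lf rt ns b f0) x u ->
            derives (rules sg lf' rt' ns b f1) x u).
  { intros x u; apply derives_mono; intros; eapply rules_mono; eauto. }
  enough (H : forall k v, k <= n -> pr k <> pL \/ k = 0 -> gen (rules sg lf rt ns b f0) w k v ->
            gen (rules sg lf' rt' ns b f1) w' (heads pr k) v) by (intros; apply H; auto).
  clear v; induction k as [k IH] using lt_wf_ind; intros v Hk HL Hg.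
  inversion Hg as [|k1 v1 u1 Hg1 Hd1]; subst; [constructor|].
  pose proof (W1 (S k1) ltac:(lia)) as Hr; cbn [heads].
  destruct HL as [HL|]; [|lia].
  destruct (Nat.eqb_spec (pr (S k1)) pR) as [ER|NR].
  - destruct Hg1 as [|k2 v2 u2 Hg2 Hd2].
    { rewrite W4 in ER; destruct (2 <? n + 1); discriminate. }
    assert (EL : pr (S k2) = pL) by (apply W2; try lia; now rewrite Nat.add_1_r).
    cbn [heads]; rewrite EL; cbn [Nat.eqb pL pR]; rewrite Nat.add_0_r, Nat.add_1_r, <- app_assoc.
    destruct (Hcode (S k2) ltac:(lia)) as [_ Hc]; destruct (Hc EL) as (C1 & C2 & C3).
    unfold posf in *; rewrite Nat.sub_succ, Nat.sub_0_r in *.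
    constructor.
    + apply IH; auto; try lia.
      destruct k2 as [|k2]; auto; left; intros EL2.
      assert (pr (S k2 + 1) = pR) by (apply W2; auto; lia).
      rewrite Nat.add_1_r, EL in H; discriminate.
    + eapply derives_bin; [apply in_rules_bin|..].
      * split; [exact (Nat.le_trans _ _ _ Hb (proj1 C1))|exact (proj2 C1)].
      * change (S (heads pr k2)) with (1 + heads pr k2); rewrite C2; auto.
      * change (S (heads pr k2)) with (1 + heads pr k2); rewrite C3, Nat.add_1_r; auto.
  - assert (EN : pr (S k1) = pN) by (unfold pN, pL, pR in *; lia).
    destruct (Hcode (S k1) ltac:(lia)) as [Hc _]; specialize (Hc EN).
    unfold posf in *; rewrite Nat.sub_succ, Nat.sub_0_r in *.
    rewrite Nat.add_1_r; constructor.
    + apply IH; auto; try lia.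
      destruct k1 as [|k1]; auto; left; intros EL2.
      assert (pr (S k1 + 1) = pR) by (apply W2; auto; lia).
      rewrite Nat.add_1_r in H; contradiction.
    + change (S (heads pr k1)) with (1 + heads pr k1); rewrite Hc; auto.
Qed.

Lemma heads_shrink n pr :
  2 <= n -> wfpair pr (n + 1) -> pr n <> pL -> 3 * heads pr n <= 2 * n.
Proof.
  intros Hn [W1 W2 W3 W4] HL.
  destruct (Nat.ltb_spec 2 (n + 1)); [|lia].
  assert (E2 : pr 2 = pR) by (apply (W2 1); auto; lia).
  (* A pair costs 3 for its letter but brings 4 on the right, and the surplus 1 is kept as long as
     [pR] is last. An unpaired letter costs 3 and brings 2; being preceded by [pR], it can spend the
     surplus. *)
  enough (H1 : forall k, 2 <= k <= n -> pr k <> pL ->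
    3 * heads pr k + (if pr k =? pR then 1 else 0) <= 2 * k)
    by (specialize (H1 n ltac:(lia) HL); lia).
  clear HL; induction k as [k IH] using lt_wf_ind; intros Hk HL.
  destruct (Nat.eq_dec k 2) as [->|].
  { cbn [heads]; rewrite W4, E2; simpl; lia. }
  destruct k as [|[|[|k]]]; try lia.
  pose proof (W1 (S (S (S k))) ltac:(lia)) as R3.
  pose proof (W1 (S (S k)) ltac:(lia)) as R2.
  pose proof (W2 (S (S k)) ltac:(lia) ltac:(lia)) as L2.
  pose proof (W2 (S k) ltac:(lia) ltac:(lia)) as L1.
  pose proof (W3 (S (S k)) ltac:(lia) ltac:(lia)) as N2.
  rewrite !Nat.add_1_r in *.
  cbn [heads]; destruct (Nat.eqb_spec (pr (S (S (S k)))) pR) as [ER|NR].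
  - assert (EL : pr (S (S k)) = pL) by tauto.
    assert (Hk1 : k <> 0) by (intros ->; rewrite E2 in EL; discriminate).
    assert (HL1 : pr (S k) <> pL) by (intros E; apply L1 in E; rewrite E in EL; discriminate).
    specialize (IH (S k) ltac:(lia) ltac:(lia) HL1).
    cbn [heads] in IH; rewrite EL; destruct (pr (S k) =? pR); cbn [Nat.eqb pL pR]; lia.
  - assert (ER : pr (S (S k)) = pR) by (unfold pN, pL, pR in *; lia).
    assert (HL2 : pr (S (S k)) <> pL) by (rewrite ER; discriminate).
    specialize (IH (S (S k)) ltac:(lia) ltac:(lia) HL2).
    cbn [heads] in IH; rewrite ER in *; rewrite Nat.eqb_refl in *; lia.
Qed.

(** Following definitions leftwards from a position ends at a free letter. Hence the alphabet of the
    word has no more letters than the factorisation has phrases. *)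
Lemma parsed_free_letters w pz kn b F x :
  parsed w pz kn b F -> 1 <= x < b -> In (Free (w x)) F.
Proof.
  intros H; revert x.
  induction H as [|b F HF IH H1 H2|b F j l HF IH H1 H2 H3 H4 H5 H6 H7]; intros x Hx.
  - lia.
  - apply in_or_app; destruct (Nat.eq_dec x b) as [->|]; [right; left; auto|left; apply IH; lia].
  - induction x as [x IHx] using lt_wf_ind.
    destruct (le_lt_dec b x); [|apply in_or_app; left; apply IH; lia].
    replace x with (b + (x - b)) by lia; rewrite <- H7 by lia; apply IHx; lia.
Qed.

Lemma facs_frees F : facs F + frees F = length F.
Proof.
  unfold facs, frees; induction F as [|f F IH]; auto; simpl; destruct (is_free f); simpl; lia.
Qed.

(** * Rounds of pairing and replacing *)

(** Letters that a rule for [c] may use: those of the alphabet and new letters introduced earlier.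
    This makes the grammar acyclic. *)
Definition known (sg : nat -> nat) (ns b c x : nat) : Prop :=
  (exists k, 1 <= k <= ns /\ sg k = x) \/ b <= x < c.

(** After [r] rounds; every earlier round [r'], whose word had at most [x] letters, bounds
    the number of rules introduced so far. *)
Record main_inv (u : word) (ns base l : nat) (sg : nat -> nat) (s : state) (r : nat) : Prop := {
  mi_n : 1 <= var s "n";
  mi_sg : arr s "sigma" = sg /\ var s "nsigma" = ns /\ var s "base" = base;
  mi_size : base <= var s "fresh" /\ var s "fresh" - base + var s "n" <= length u;
  mi_letters : forall x, 1 <= x <= var s "n" -> known sg ns base (var s "fresh") (arr s "w" x);
  mi_rules : forall c, base <= c < var s "fresh" ->
    known sg ns base c (arr s "left" c) /\ known sg ns base c (arr s "right" c);
  mi_gen : gen (rules sg (arr s "left") (arr s "right") ns base (var s "fresh"))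
               (arr s "w") (var s "n") u;
  mi_rest : exists m f,
    rest (var s "n") (arr s "w") (arr s "pocz") (arr s "kon") 1 m f /\ m <= l /\
    var s "fresh" - base + f <= l + 5 * l * r;
  mi_shrink : var s "n" * 3 ^ r <= length u * 2 ^ r;
  mi_history : forall r', r' <= r -> exists x, x * 3 ^ r' <= length u * 2 ^ r' /\
    var s "fresh" - base + var s "n" <= l + 5 * l * r' + x
}.

Arguments mi_n {u ns base l sg s r}.

Lemma known_mono sg ns b c c' x : known sg ns b c x -> c <= c' -> known sg ns b c' x.
Proof. intros [H|H] Hc; [left; auto|right; lia]. Qed.

Lemma round_correct W u ns base l sg s r :
  length u + base + 20 < W -> bounded W s -> main_inv u ns base l sg s r -> 2 <= var s "n" ->
  runs W (Seq pairing replace) s (fun t s' =>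
    main_inv u ns base l sg s' (r + 1) /\ 3 * var s' "n" <= 2 * var s "n" /\
    t <= 200 * var s "n").
Proof.
  intros HW HB [M1 (M2 & M2' & M2'') M3 M4 M5 M6 (m & f & Hr & Hm & Hf) M8 M9] Hn.
  set (n := var s "n") in *; set (w := arr s "w") in *; set (f0 := var s "fresh") in *.
  apply runs_seq; eapply runs_conseq.
  { eapply runs_frame; [exact HB|].
    apply (pairing_correct W n w m f s); auto; lia. }
  cbn beta; intros t1 s1 ((Ht1 & Hwf & HnL & m1 & f1 & Hm1 & Hf1 & Hdone) & HB1 & Fv & Fa).
  assert (V : var s1 "n" = n /\ var s1 "fresh" = f0 /\ var s1 "nsigma" = ns /\ var s1 "base" = base)
    by (ands; rewrite Fv; auto).
  assert (A : arr s1 "w" = w /\ arr s1 "sigma" = sg /\ arr s1 "left" = arr s "left" /\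
              arr s1 "right" = arr s "right") by (ands; rewrite Fa; auto).
  destruct V as (V1 & V2 & V3 & V4), A as (A1 & A2 & A3 & A4).
  eapply runs_conseq.
  { eapply runs_frame; [exact HB1|].
    apply (replace_correct W n w (arr s1 "pair") (arr s1 "pocz") (arr s1 "kon") m1 f1 f0 s1);
      auto; [lia|]; unfold given; auto. }
  cbn beta; intros t2 s2 ((Ht2 & q & f' & En & Hr2 & Hff & Efr & Hq & Hcode & Hold & Hnew) & _ & Gv & Ga).
  set (pr := arr s1 "pair") in *; set (n2 := var s2 "n") in *.
  rewrite A3, A4 in Hold.
  assert (Hn2 : n2 = heads pr n) by (unfold posf in En; rewrite Nat.add_sub in En; lia).
  assert (Hsh : 3 * n2 <= 2 * n) by (rewrite Hn2; apply heads_shrink; auto).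
  assert (Hpr1 : pr 1 = pL).
  { rewrite (wf_first Hwf); destruct (Nat.ltb_spec 2 (n + 1)); auto; lia. }
  assert (Hletter : forall y, 1 <= y <= n2 -> known sg ns base (f0 + q) (arr s2 "w" y)).
  { enough (H : forall k, k <= n -> forall y, 1 <= y <= heads pr k ->
              known sg ns base (f0 + q) (arr s2 "w" y)) by (intros y Hy; apply (H n); lia).
    induction k as [|k IH]; intros Hk y Hy; cbn [heads] in Hy; [lia|].
    destruct (Nat.eqb_spec (pr (S k)) pR) as [ER|NR]; [apply IH; lia|].
    destruct (Nat.eq_dec y (heads pr k + 1)) as [->|]; [|apply IH; lia].
    destruct (Hcode (S k) ltac:(lia)) as [C1 C2].
    unfold posf in *; rewrite Nat.sub_succ, Nat.sub_0_r, Nat.add_comm in *.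
    pose proof (wf_range Hwf (S k) ltac:(lia)).
    destruct (Nat.eq_dec (pr (S k)) pL) as [EL|NL].
    - right; destruct (C2 EL); lia.
    - rewrite C1 by (unfold pN, pL, pR in *; lia); eapply known_mono; [apply M4; lia|lia]. }
  assert (Gv' : var s2 "nsigma" = ns /\ var s2 "base" = base) by (rewrite !Gv; auto).
  split; [|split; [exact Hsh|lia]].
  constructor; fold n2; rewrite ?Efr; auto.
  - rewrite Hn2; destruct n as [|n0]; [lia|].
    clear - Hpr1; induction n0 as [|n0 IH]; [simpl; rewrite Hpr1; simpl; lia|].
    cbn [heads] in *; lia.
  - rewrite Ga by auto; ands; auto; apply Gv'.
  - lia.
  - intros c Hc; destruct (le_lt_dec f0 c) as [Hge|Hlt].
    + destruct (Hnew c ltac:(lia)) as (x & Hx & -> & ->).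
      split; eapply known_mono; try (apply M4; lia); lia.
    + destruct (Hold c Hlt) as [-> ->]; apply M5; lia.
  - rewrite Hn2; eapply gen_replaced with (f0 := f0); eauto; lia.
  - exists m1, f'; split; auto; split; [lia|]; nia.
  - rewrite !Nat.pow_add_r, !Nat.pow_1_r; nia.
  (* The number of rules plus the length of the word never grows, so the earlier bounds persist. The
     bound for the new round takes the current length as [x]. *)
  - intros r' Hr'; destruct (Nat.eq_dec r' (r + 1)) as [->|].
    + exists n2; split; [rewrite !Nat.pow_add_r, !Nat.pow_1_r; nia|nia].
    + destruct (M9 r' ltac:(lia)) as (x & Hx & Hle); exists x; split; auto; lia.
Qed.

Lemma output_rules s :
  slp_rules (output s) = rules (arr s "sigma") (arr s "left") (arr s "right")
    (var s "nsigma") (var s "base") (var s "fresh").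
Proof. reflexivity. Qed.

Lemma rules_names sg lf rt ns b f :
  map fst (rules sg lf rt ns b f) = map sg (seq 1 ns) ++ seq b (f - b).
Proof.
  unfold rules; rewrite map_app, !map_map; f_equal; simpl.
  apply map_id.
Qed.

Lemma prefix_unique {A} (x : A) P P' Q Q' :
  NoDup (P ++ x :: Q) -> P ++ x :: Q = P' ++ x :: Q' -> P = P'.
Proof.
  revert P'; induction P as [|a P IH]; intros [|a' P'] Hnd E; simpl in *; auto;
    inversion E; subst; inversion Hnd as [|? ? Hni Hnd']; subst.
  - exfalso; apply Hni; apply in_or_app; right; left; auto.
  - exfalso; apply Hni; apply in_or_app; right; left; auto.
  - f_equal; eauto.
Qed.

Lemma rules_nodup (sg : nat -> nat) ns b k :
  (forall k k', 1 <= k <= ns -> 1 <= k' <= ns -> sg k = sg k' -> k = k') ->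
  (forall k, 1 <= k <= ns -> sg k < b) -> NoDup (map sg (seq 1 ns) ++ seq b k).
Proof.
  intros Hinj Hlt; apply NoDup_app.
  - apply NoDup_map_NoDup_ForallPairs; [|apply seq_NoDup].
    intros i i' H H'; apply in_seq in H, H'; apply Hinj; lia.
  - apply seq_NoDup.
  - intros x Hx Hx'; apply in_seq in Hx'.
    apply in_map_iff in Hx as (i & <- & Hi); apply in_seq in Hi.
    specialize (Hlt i ltac:(lia)); lia.
Qed.

(** The names are distinct, so what precedes the rule of [X] is determined: the alphabet and the new
    letters below [X], which is what [known] allows. *)
Lemma rules_wf sg lf rt ns b f st :
  (forall k k', 1 <= k <= ns -> 1 <= k' <= ns -> sg k = sg k' -> k = k') ->
  (forall k, 1 <= k <= ns -> sg k < b) ->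
  (forall c, b <= c < f -> known sg ns b c (lf c) /\ known sg ns b c (rt c)) ->
  slp_wf (SLP (rules sg lf rt ns b f) st).
Proof.
  intros Hinj Hlt Hk; split; cbn [slp_rules].
  - rewrite rules_names; apply rules_nodup; auto.
  - intros R1 X Y Z R2 E.
    assert (Hin : In (X, Bin Y Z) (rules sg lf rt ns b f))
      by (rewrite E; apply in_or_app; right; left; auto).
    assert (HX : b <= X < f /\ Y = lf X /\ Z = rt X).
    { apply in_app_or in Hin as [Hin|Hin]; apply in_map_iff in Hin as (c & Ec & Hc);
        inversion Ec; subst; apply in_seq in Hc; ands; auto; lia. }
    destruct HX as (HX & -> & ->).
    assert (En : map fst R1 ++ X :: map fst R2 =
                 (map sg (seq 1 ns) ++ seq b (X - b)) ++ X :: seq (S X) (f - X - 1)).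
    { transitivity (map fst (rules sg lf rt ns b f)).
      - rewrite E, map_app; reflexivity.
      - rewrite rules_names, <- app_assoc; f_equal.
        replace (f - b) with (X - b + S (f - X - 1)) by lia.
        rewrite seq_app; cbn [seq]; repeat f_equal; lia. }
    assert (HR1 : map fst R1 = map sg (seq 1 ns) ++ seq b (X - b)).
    { eapply prefix_unique; [|exact En]; rewrite <- map_cons with (f := fst) (x := (X, Bin (lf X) (rt X))).
      rewrite <- map_app, <- E, rules_names; apply rules_nodup; auto. }
    rewrite HR1; destruct (Hk X HX) as [K1 K2].
    assert (Hkn : forall y, known sg ns b X y -> In y (map sg (seq 1 ns) ++ seq b (X - b))).
    { intros y [(k & Hk' & <-)|Hy]; apply in_or_app; [left|right].
      - apply in_map, in_seq; lia.
      - apply in_seq; lia. }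
    auto.
Qed.

Lemma gen_prefix sg lf rt ns b f u k :
  (forall x, 1 <= x <= length u -> exists k, 1 <= k <= ns /\ sg k = letter u x) ->
  k <= length u -> gen (rules sg lf rt ns b f) (letter u) k (firstn k u).
Proof.
  intros H; induction k as [|k IH]; intros Hk; [constructor|].
  rewrite firstn_letter, Nat.sub_succ, Nat.sub_0_r by lia.
  constructor; [apply IH; lia|].
  destruct (H (S k) ltac:(lia)) as (j & Hj & Ej).
  apply derives_ter; rewrite <- Ej; apply in_rules_ter; auto.
Qed.

Lemma gen_ext R w w' k v :
  (forall x, 1 <= x <= k -> w' x = w x) -> gen R w k v -> gen R w' k v.
Proof.
  intros H Hg; induction Hg as [|k v u Hg IH Hd]; constructor.
  - apply IH; intros; apply H; lia.
  - rewrite H by lia; auto.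
Qed.

Definition rounds : com := While (BLe 2 "n") (Seq pairing replace).

Lemma rounds_correct W u A F s :
  1 <= length u -> length u + A + 30 < W -> bounded W s -> stores_word s u ->
  (forall x, 1 <= x <= length u -> letter u x <= A) ->
  is_lz77 u F -> stores_lz77 s u F ->
  runs W (Seq alphabet rounds) s (fun t s' =>
    t <= 700 * length u /\ slp_generates (output s') u /\
    exists ns q, slp_size (output s') = ns + q /\ ns <= length F /\ ns <= length u /\
      q <= length u /\
      forall r, exists x, x * 3 ^ r <= length u * 2 ^ r /\
        q <= length F + 5 * length F * r + x).
Proof.
  intros HN HW HB [Hn Hw] HA HF HS.
  set (N := length u) in *; set (l := length F).
  assert (Hparse : parsed (letter u) (arr s "pocz") (arr s "kon") (N + 1) F).
  { pose proof (lz77_parsed s u F F [] HF HS (eq_sym (app_nil_r _))) as H.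
    rewrite <- (proj1 HF) in H; exact H. }
  assert (Hrest : rest N (arr s "w") (arr s "pocz") (arr s "kon") 1 (facs F) (frees F)).
  { replace (facs F) with (facs F + 0) by lia; replace (frees F) with (frees F + 0) by lia.
    apply parsed_rest with (N + 1); [|constructor].
    eapply parsed_word_ext; [exact Hparse|]; intros; apply Hw; unfold N in *; lia. }
  pose proof (facs_frees F) as Hfl; fold l in Hfl.
  apply runs_seq; eapply runs_conseq.
  { eapply runs_frame; [exact HB|].
    apply (alphabet_correct W N (arr s "w") A s); auto; [lia|].
    intros x Hx; rewrite Hw by auto; apply HA; auto. }
  cbn beta; intros t1 s1 ((Ht1 & Hlist & Hbase & Hfresh) & HB1 & Fv & Fa).
  assert (V : var s1 "n" = N) by (rewrite Fv; auto).
  assert (A1 : arr s1 "w" = arr s "w" /\ arr s1 "pocz" = arr s "pocz" /\ arr s1 "kon" = arr s "kon")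
    by (ands; rewrite Fa; auto).
  destruct A1 as (A1 & A2 & A3).
  set (ns := var s1 "nsigma") in *; set (base := var s1 "base") in *;
    set (sg := arr s1 "sigma") in *.
  destruct Hlist as [L1 L2 L3 L4 L5].
  assert (Hns : ns <= l).
  (* The listed letters give pairwise different phrases [Free a], all of which occur in [F]. *)
  { rewrite <- (length_seq ns 1), <- (length_map (fun k => Free (sg k))).
    apply NoDup_incl_length.
    - apply NoDup_map_NoDup_ForallPairs; [|apply seq_NoDup].
      intros k k' H H' E; inversion E; apply in_seq in H, H'; apply L4; auto; lia.
    - intros p Hp; apply in_map_iff in Hp as (k & <- & Hk); apply in_seq in Hk.
      destruct (L2 k ltac:(lia)) as (x & Hx & ->).
      rewrite Hw by (unfold N in *; lia); apply (parsed_free_letters _ _ _ _ _ x Hparse); lia. }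
  assert (HM : main_inv u ns base l sg s1 0).
  { constructor; rewrite ?V, ?Hfresh, ?A1, ?A2, ?A3; auto; try lia.
    - intros x Hx; left; destruct (L5 x ltac:(lia)) as (k & Hk & Ek); eauto.
    - apply gen_ext with (letter u); [intros; apply Hw; auto|].
      pose proof (firstn_all u) as Hall; rewrite <- Hall at 2.
      apply gen_prefix; [|auto]; intros x Hx.
      destruct (L5 x ltac:(unfold N; lia)) as (k & Hk & Ek).
      exists k; rewrite Ek, Hw by auto; auto.
    - exists (facs F), (frees F); split; auto; lia.
    - intros r' Hr'; exists N; replace r' with 0 by lia; simpl; split; fold N; lia. }
  eapply runs_conseq.
  (* A round on [n] letters takes at most [200 * n] steps and a test, and two thirds of the letters
     remain. So a potential of [3 * 201 * n] drops by at least [201 * n]. *)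
  { apply runs_while_runs with (I := fun s => exists r, main_inv u ns base l sg s r)
      (P := fun s => 603 * var s "n"); auto.
    - intros s' _ _; simpl; lia.
    - intros s2 HB2 (r & HM2) Hb.
      simpl in Hb; destruct (var s2 "n") as [|[|n2]] eqn:En; try discriminate.
      eapply runs_conseq; [apply (round_correct W u ns base l sg s2 r); auto; [unfold N in *; lia|lia]|].
      cbn beta; intros t s3 (HM3 & Hsh & Ht); split; [eauto|].
      pose proof (mi_n HM3); lia.
    - eauto. }
  cbn beta; intros t2 s2 ((r & HM2) & Hb & Ht2).
  destruct HM2 as [M1 (M2 & M2' & M2'') M3 M4 M5 M6 (m & f & Hr & Hm & Hf) M8 M9].
  assert (E1 : var s2 "n" = 1).
  { simpl in Hb; destruct (var s2 "n") as [|[|n2]]; try discriminate; lia. }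
  split; [rewrite V in Ht2; lia|]; split; [split|].
  - unfold output; rewrite M2', M2''.
    fold (rules (arr s2 "sigma") (arr s2 "left") (arr s2 "right") ns base (var s2 "fresh")).
    rewrite M2; apply rules_wf; auto.
  - rewrite output_rules, M2, M2', M2''; change (slp_start (output s2)) with (arr s2 "w" 1).
    rewrite E1 in M6; inversion M6 as [|k v x Hg Hd]; subst.
    inversion Hg; subst; exact Hd.
  - exists ns, (var s2 "fresh" - base).
    assert (Hlen : slp_size (output s2) = ns + (var s2 "fresh" - base)).
    { unfold slp_size; rewrite output_rules, M2', M2''; unfold rules.
      rewrite length_app, !length_map, !length_seq; auto. }
    ands; auto; try (unfold N in *; lia).
    intros r'; destruct (le_lt_dec r' r) as [Hle|Hlt].
    + destruct (M9 r' Hle) as (x & Hx & Hq); exists x; split; auto; lia.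
    (* For more rounds than were made, no letter remains to be counted and the bound of the last
       round suffices. *)
    + exists 0; split; [lia|]; nia.
Qed.

(** * Factorisations from grammars *)

Definition valid_prefix (u : word) (F : list phrase) : Prop :=
  forall F1 j l F2, F = F1 ++ Factor j l :: F2 ->
    1 <= j <= length (unfactor u F1) /\ 1 <= l /\ j + l - 1 <= length u.

Lemma valid_prefix_free u F a : valid_prefix u F -> valid_prefix u (F ++ [Free a]).
Proof.
  intros H F1 j l F2 E; apply snoc_inv in E as [(_ & _ & E)|(F2' & _ & E)];
    [discriminate|eapply H; eauto].
Qed.

Lemma valid_prefix_factor u F j l :
  valid_prefix u F -> 1 <= j <= length (unfactor u F) -> 1 <= l -> j + l - 1 <= length u ->
  valid_prefix u (F ++ [Factor j l]).
Proof.
  intros H Hj Hl Hjl F1 j' l' F2 E; apply snoc_inv in E as [(_ & <- & E)|(F2' & _ & E)];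
    [inversion E; subst; auto|eapply H; eauto].
Qed.

Lemma reach_factorisation u b k :
  reach (letter u) b k -> b <= length u + 1 ->
  exists F, unfactor u F = firstn (b - 1) u /\ valid_prefix u F /\ length F <= k /\ 1 <= b.
Proof.
  induction 1 as [|b k Hr IH|b k l Hr IH (j & Hj & He)]; intros Hb.
  - exists []; ands; auto; intros [|] * E; discriminate.
  - destruct IH as (F & E & HV & HF & Hb1); [lia|].
    exists (F ++ [Free (letter u b)]).
    split; [|split; [|split; [rewrite length_app; simpl; lia|lia]]].
    + rewrite unfactor_app, unfactor_one, E; simpl.
      rewrite Nat.add_sub; symmetry; apply firstn_letter; lia.
    + apply valid_prefix_free; auto.
  - destruct IH as (F & E & HV & HF & Hb1); [lia|].
    (* [reach] admits empty factors, a factorisation does not. They are dropped, so the number of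
       phrases may fall below [k]. *)
    destruct (Nat.eq_dec l 0) as [->|Hl].
    { exists F; rewrite Nat.add_0_r; ands; auto; lia. }
    exists (F ++ [Factor j l]).
    split; [|split; [|split; [rewrite length_app; simpl; lia|lia]]].
    + rewrite unfactor_app, unfactor_one, E; simpl.
      replace (b + l - 1) with (b - 1 + l) by lia; rewrite firstn_add; f_equal.
      symmetry; apply (subword_eq u b j l); auto; try lia; apply eqf_sym; auto.
    + apply valid_prefix_factor; auto; try lia.
      rewrite E, length_firstn; lia.
Qed.

Definition occurs (u : word) (b : nat) (v : word) : Prop :=
  1 <= b /\ forall k, k < length v -> letter u (b + k) = nth k v 0.

(** A strict order when names are distinct, and in a well-formed grammar derivations descend in it.
    It shows that no nonterminal occurs below itself. *)
Definition before (R : list (nat * rhs)) (X Y : nat) : Prop :=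
  exists R1 r R2, R = R1 ++ (X, r) :: R2 /\ In Y (map fst R1).

Lemma before_irrefl R X : NoDup (map fst R) -> ~ before R X X.
Proof.
  intros Hnd (R1 & r & R2 & -> & Hin); rewrite map_app in Hnd; simpl in Hnd.
  apply NoDup_remove_2 in Hnd; apply Hnd, in_or_app; auto.
Qed.

Lemma before_trans R X Y Z : NoDup (map fst R) -> before R X Y -> before R Y Z -> before R X Z.
Proof.
  intros Hnd (R1 & r & R2 & E & Hin) (R1' & r' & R2' & E' & Hin').
  exists R1, r, R2; split; auto.
  apply in_map_iff in Hin as ((Y' & ry) & EY & Hin); simpl in EY; subst Y'.
  apply in_split in Hin as (P1 & P2 & ->).
  enough (map fst P1 = map fst R1') as E1
    by (rewrite map_app; apply in_or_app; left; rewrite E1; auto).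
  apply (prefix_unique Y _ _ (map fst P2 ++ X :: map fst R2) (map fst R2')).
  - rewrite E in Hnd; rewrite !map_app in Hnd; simpl in Hnd.
    rewrite <- app_assoc in Hnd; exact Hnd.
  - transitivity (map fst R).
    + rewrite E, !map_app; simpl; rewrite <- app_assoc; auto.
    + rewrite E', map_app; auto.
Qed.

Lemma rule_unique (R : list (nat * rhs)) X r r' :
  NoDup (map fst R) -> In (X, r) R -> In (X, r') R -> r = r'.
Proof.
  induction R as [|[Y ry] R IH]; intros Hnd H H'; [contradiction|].
  simpl in Hnd; inversion Hnd as [|? ? Hni Hnd']; subst.
  destruct H as [H|H], H' as [H'|H']; try congruence; auto.
  - exfalso; apply Hni; inversion H; subst; apply (in_map fst) in H'; auto.
  - exfalso; apply Hni; inversion H'; subst; apply (in_map fst) in H; auto.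
Qed.

Lemma derives_unique R X v v' :
  NoDup (map fst R) -> derives R X v -> derives R X v' -> v = v'.
Proof.
  intros Hnd H; revert v'; induction H as [X a Hin|X Y Z u v Hin H1 IH1 H2 IH2]; intros v' H';
    inversion H' as [X' a' Hin'|X' Y' Z' u' w' Hin' H1' H2']; subst;
    pose proof (rule_unique _ _ _ _ Hnd Hin Hin') as E; inversion E; subst; auto.
  f_equal; auto.
Qed.

(** Reading the derivation tree from left to right, a nonterminal met before is a factor,
    and every other inner node is charged to its nonterminal. *)
Lemma slp_reach R u X v :
  slp_wf (SLP R X) -> derives R X v -> forall b k S,
  reach (letter u) b k -> occurs u b v -> NoDup S ->
  (forall Y y, In Y S -> derives R Y y -> exists j, 1 <= j /\ j < b /\ occurs u j y) ->
  exists k' S', reach (letter u) (b + length v) k' /\ NoDup S' /\ In X S' /\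
    (forall Y, In Y S -> In Y S') /\
    (forall Y, In Y S' -> In Y S \/ Y = X \/ before R X Y) /\
    (forall Y y, In Y S' -> derives R Y y -> exists j, 1 <= j /\ j < b + length v /\ occurs u j y) /\
    k' + length S <= k + length S' + 1 /\ (S = [] -> k' <= k + length S').
Proof.
  intros [Hnd Hbin] Hd; simpl in Hnd, Hbin.
  assert (Hlen : forall X v, derives R X v -> 1 <= length v)
    by (induction 1; simpl; rewrite ?length_app; lia).
  assert (Hseen : forall X v b S, derives R X v -> occurs u b v ->
    (forall Y y, In Y S -> derives R Y y -> exists j, 1 <= j /\ j < b + length v /\ occurs u j y) ->
    forall Y y, In Y (X :: S) -> derives R Y y -> exists j, 1 <= j /\ j < b + length v /\ occurs u j y).
  { intros X0 v0 b S HX Hoc HS Y y [<-|HY] Hy; eauto.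
    rewrite (derives_unique _ _ _ _ Hnd Hy HX); exists b; specialize (Hlen _ _ HX).
    pose proof (proj1 Hoc); ands; auto; lia. }
  induction Hd as [X a Hin|X Y Z v1 v2 Hin H1 IH1 H2 IH2]; intros b k S Hr Hoc HS Hsee.
  - destruct (in_dec Nat.eq_dec X S) as [HX|HX].
    + destruct (Hsee X [a] HX (derives_ter _ _ _ Hin)) as (j & Hj & Hjb & Hj1 & Hj2).
      exists (k + 1), S; ands; auto; try lia.
      * apply reach_factor; auto; exists j; split; [lia|].
        destruct Hoc as [_ Hoc]; intros y Hy; rewrite Hoc, Hj2; auto.
      * intros Y y HY Hy; destruct (Hsee Y y HY Hy) as (j' & ? & ? & ?).
        exists j'; ands; auto; lia.
      * intros ->; contradiction.
    + exists (k + 1), (X :: S); ands; auto; try (simpl; lia).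
      * apply reach_free; auto.
      * constructor; auto.
      * intros; right; auto.
      * intros Y [<-|HY]; auto.
      * apply (Hseen X [a]); auto; [apply derives_ter; auto|].
        intros Y y HY Hy; destruct (Hsee Y y HY Hy) as (j' & ? & ? & ?).
        exists j'; ands; auto; lia.
  - destruct (in_dec Nat.eq_dec X S) as [HX|HX].
    + destruct (Hsee X (v1 ++ v2) HX (derives_bin _ _ _ _ _ _ Hin H1 H2))
        as (j & Hj & Hjb & Hj1 & Hj2).
      exists (k + 1), S; ands; auto; try lia.
      * apply reach_factor; auto; exists j; split; [lia|].
        destruct Hoc as [_ Hoc]; intros y Hy; rewrite Hoc, Hj2; auto.
      * intros Y' y HY Hy; destruct (Hsee Y' y HY Hy) as (j' & ? & ? & ?).
        exists j'; ands; auto; lia.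
      * intros ->; contradiction.
    + destruct Hoc as [Hb Hoc]; rewrite length_app in Hoc.
      destruct (in_split _ _ Hin) as (R1 & R2 & ER).
      destruct (Hbin R1 X Y Z R2 ER) as [HY HZ].
      assert (BY : before R X Y) by (exists R1, (Bin Y Z), R2; auto).
      assert (BZ : before R X Z) by (exists R1, (Bin Y Z), R2; auto).
      assert (O1 : occurs u b v1).
      { split; auto; intros i Hi; rewrite Hoc by lia; apply app_nth1; auto. }
      assert (O2 : occurs u (b + length v1) v2).
      { split; [lia|]; intros i Hi; rewrite <- Nat.add_assoc, Hoc by lia.
        rewrite app_nth2_plus; auto. }
      destruct (IH1 b k S Hr O1 HS Hsee) as (k1 & S1 & A1 & A2 & A3 & A4 & A5 & A6 & A7 & A8).
      destruct (IH2 _ k1 S1 A1 O2 A2 A6) as (k2 & S2 & B1 & B2 & B3 & B4 & B5 & B6 & B7 & B8).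
      (* Everything met in the two subtrees comes earlier in the list of rules than [X], so [X] is
         new and can be charged. *)
      assert (HXn : ~ In X S2).
      { intros HX2; destruct (B5 X HX2) as [HX1|[E|HB]].
        - destruct (A5 X HX1) as [HX0|[E|HB]]; [contradiction| |].
          + subst Y; eapply before_irrefl; eauto.
          + apply (before_irrefl R X Hnd (before_trans R X Y X Hnd BY HB)).
        - subst Z; eapply before_irrefl; eauto.
        - apply (before_irrefl R X Hnd (before_trans R X Z X Hnd BZ HB)). }
      exists k2, (X :: S2); rewrite length_app, Nat.add_assoc; ands; auto.
      * constructor; auto.
      * left; auto.
      * intros; right; auto.
      * intros Y' [<-|HY']; auto.
        destruct (B5 Y' HY') as [HY1|[->|HB]].
        -- destruct (A5 Y' HY1) as [HY0|[->|HB]]; auto.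
           right; right; exact (before_trans R X Y Y' Hnd BY HB).
        -- auto.
        -- right; right; exact (before_trans R X Z Y' Hnd BZ HB).
      * rewrite <- Nat.add_assoc, <- length_app; apply (Hseen X (v1 ++ v2)).
        -- eapply derives_bin; eauto.
        -- split; auto; rewrite length_app; auto.
        -- rewrite length_app, Nat.add_assoc; auto.
      (* Each subtree may exceed its new nonterminals by one phrase; charging [X] brings the excess
         of the two back to one. *)
      * simpl; lia.
      (* At the very beginning of the word the left subtree has no excess: its leftmost leaf is a
         terminal rule met for the first time. *)
      * intros E; specialize (A8 E); rewrite E in *; simpl in *; lia.
Qed.

Lemma lz77_le_slp u F G : smallest_lz77 u F -> slp_generates G u -> length F <= slp_size G.
Proof.
  intros [_ HF] [Hwf Hd]; destruct G as [R X]; simpl in Hd.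
  destruct (slp_reach R u X u Hwf Hd 1 0 []) as (k & S & A1 & A2 & A3 & A4 & A5 & A6 & A7 & A8).
  - constructor.
  - split; auto; intros k Hk; unfold letter; f_equal; lia.
  - constructor.
  - intros Y y [].
  - rewrite Nat.add_comm in A1.
    destruct (reach_factorisation u _ _ A1 (le_n _)) as (F' & E & HV & HF' & _).
    rewrite Nat.add_sub, firstn_all in E.
    assert (HL : is_lz77 u F') by (split; auto).
    specialize (HF F' HL); specialize (A8 eq_refl).
    enough (length S <= slp_size (SLP R X)) by lia.
    unfold slp_size; simpl; rewrite <- (length_map fst).
    apply NoDup_incl_length; auto.
    intros Y HY; destruct (A5 Y HY) as [[]|[->|(R1 & r & R2 & -> & HB)]].
    + inversion Hd as [? a Hin|? ? ? ? ? Hin]; subst; apply (in_map fst) in Hin; auto.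
    + rewrite map_app; apply in_or_app; auto.
Qed.

Lemma lz77_le_length u F : smallest_lz77 u F -> length F <= length u.
Proof.
  intros [_ HF].
  assert (Hr : forall k, reach (letter u) (k + 1) k).
  { induction k as [|k IH]; [constructor|].
    replace (S k) with (k + 1) by lia; apply reach_free; auto. }
  destruct (reach_factorisation u _ _ (Hr (length u)) ltac:(lia)) as (F' & E & HV & HF' & _).
  rewrite Nat.add_sub, firstn_all in E.
  specialize (HF F' (conj (eq_sym E) HV)); lia.
Qed.

(** * The whole algorithm *)

(** A run stays valid under a larger word bound, so the exponent of the subroutine and the one for
    the rounds are combined by their maximum. In [c + 8] three powers are added to those for the
    child table to absorb additive constants. *)
Lemma main_correct c lz :
  linear_lz77 c lz ->
  exists T k : nat, forall w, admissible c w -> exists t s F,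
    exec (word_bound k (length w)) (main lz) (init w) t s /\ t <= T * length w /\
    slp_generates (output s) w /\ smallest_lz77 w F /\
    exists ns q, slp_size (output s) = ns + q /\ ns <= length F /\ ns <= length w /\
      q <= length w /\
      forall r, exists x, x * 3 ^ r <= length w * 2 ^ r /\
        q <= length F + 5 * length F * r + x.
Proof.
  intros (T & k & H).
  exists (T + 700), (Nat.max k (c + 8)); intros w Hw.
  destruct (H w Hw) as (t1 & s1 & F & HE & Ht & Hst & HF & HS).
  pose proof (init_bounded c w (Nat.max k (c + 8)) Hw ltac:(lia)) as HB.
  destruct Hw as [Hne Hw].
  assert (HN : 1 <= length w) by (destruct w; simpl; [congruence|lia]).
  assert (HE' : exec (word_bound (Nat.max k (c + 8)) (length w)) lz (init w) t1 s1).
  { eapply exec_mono; [|exact HE]; apply Nat.pow_le_mono_r; lia. }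
  destruct (rounds_correct (word_bound (Nat.max k (c + 8)) (length w)) w (length w ^ c) F s1)
    as (t2 & s2 & HE2 & Ht2 & HG & Hsize); auto.
  - apply Nat.lt_le_trans with (word_bound (c + 8) (length w));
      [|apply Nat.pow_le_mono_r; lia].
    pose proof (word_bound_large c (length w) HN) as Hl.
    unfold word_bound, stride in *; replace (c + 8) with (c + 5 + 3) by lia.
    rewrite (Nat.pow_add_r _ (c + 5) 3).
    assert (8 <= (length w + 1) ^ 3) by (change 8 with (2 ^ 3); apply Nat.pow_le_mono_l; lia).
    nia.
  - eapply exec_bounded; eauto.
  - intros x Hx; rewrite Forall_forall in Hw; apply Hw, nth_In; lia.
  - apply HF.
  - exists (t1 + t2), s2, F; split; [|split; [lia|auto]].
    apply exec_seq with s1; auto.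
Qed.

(** * Size bound and approximation ratio *)

(** This is the number of rounds after which the length bound [(2/3)^r N] has sunk to [l]. Its
    minimality makes it logarithmic in [N / l]. *)
Lemma least_power N l : 1 <= N -> 1 <= l -> exists r, N * 2 ^ r <= l * 3 ^ r /\
  (r = 0 \/ l * 3 ^ (r - 1) < N * 2 ^ (r - 1)).
Proof.
  intros HN Hl.
  assert (H : exists r, N * 2 ^ r <= l * 3 ^ r).
  { enough (exists r, N * 2 ^ r <= 3 ^ r) as [r Hr] by (exists r; nia).
    clear l Hl; induction N as [|N IH]; [lia|].
    destruct (Nat.eq_dec N 0) as [->|]; [exists 0; simpl; lia|].
    (* Two further rounds gain a factor of 9/4, enough to pass from [N] to [N + 1], which is at most
       [2 N]. *)
    destruct IH as [r Hr]; [lia|]; exists (r + 2); rewrite !Nat.pow_add_r; simpl; nia. }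
  destruct H as [r Hr]; induction r as [|r IH]; [exists 0; auto|].
  destruct (le_lt_dec (N * 2 ^ r) (l * 3 ^ r)) as [Hle|Hlt]; auto.
  exists (S r); split; auto; right; now rewrite Nat.sub_1_r.
Qed.

Local Open Scope R_scope.

Lemma ln_le_sub x : 0 < x -> ln x <= x - 1.
Proof.
  intros Hx; pose proof (exp_ineq1_le (ln x)) as H; rewrite exp_ln in H by auto; lra.
Qed.

Lemma ln_ge_sub x : 0 < x -> 1 - / x <= ln x.
Proof.
  intros Hx; pose proof (ln_le_sub (/ x) (Rinv_0_lt_compat _ Hx)) as H.
  rewrite ln_Rinv in H by auto; lra.
Qed.

Lemma rounds_log (N l r : nat) :
  (1 <= N)%nat -> (1 <= l)%nat -> (l * 3 ^ r < N * 2 ^ r)%nat ->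
  INR r <= 3 * ln (INR N / INR l).
Proof.
  intros HN Hl H.
  assert (Hl' : 0 < INR l) by (apply lt_0_INR; lia).
  apply lt_INR in H; rewrite !mult_INR, !pow_INR in H.
  replace (INR 3) with 3 in H by (simpl; lra); replace (INR 2) with 2 in H by (simpl; lra).
  assert (H2 : 0 < 2 ^ r) by (apply pow_lt; lra).
  assert (Hlt : (3 / 2) ^ r < INR N / INR l).
  { apply Rmult_lt_reg_r with (INR l * 2 ^ r); [apply Rmult_lt_0_compat; auto|].
    replace ((3 / 2) ^ r * (INR l * 2 ^ r)) with (INR l * ((3 / 2) ^ r * 2 ^ r)) by ring.
    rewrite <- Rpow_mult_distr; replace (3 / 2 * 2) with 3 by lra.
    replace (INR N / INR l * (INR l * 2 ^ r)) with (INR N * 2 ^ r) by (field; lra); auto. }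
  apply ln_increasing in Hlt; [|apply pow_lt; lra].
  rewrite ln_pow in Hlt by lra.
  (* The factor 3 comes from [ln (3/2) >= 1 - 2/3 = 1/3]. *)
  pose proof (ln_ge_sub (3 / 2) ltac:(lra)) as H3.
  replace (1 - / (3 / 2)) with (/ 3) in H3 by field.
  pose proof (pos_INR r); nra.
Qed.

(** The alphabet, the initial free letters and the letters left after [r] rounds contribute at most
    [l] each, the rounds at most [5 l r] with [r <= 1 + 3 ln (N / l)]. This makes
    [8 l + 15 l ln (N / l)]. *)
Lemma size_bound (N l ns q : nat) :
  (1 <= l <= N)%nat -> (ns <= l)%nat ->
  (forall r, exists x, (x * 3 ^ r <= N * 2 ^ r /\ q <= l + 5 * l * r + x)%nat) ->
  INR (ns + q) <= 18 * (INR l + INR l * ln (INR N / INR l)).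
Proof.
  intros Hl Hns Hq.
  destruct (least_power N l) as (r & Hr & Hr'); try lia.
  destruct (Hq r) as (x & Hx & Hqx).
  assert (Hxl : (x <= l)%nat).
  { assert (0 < 3 ^ r)%nat by (apply Nat.neq_0_lt_0, Nat.pow_nonzero; lia); nia. }
  assert (HlR : 1 <= INR l) by (apply (le_INR 1); lia).
  assert (Hln : 0 <= ln (INR N / INR l)).
  { rewrite <- ln_1.
    destruct (Req_dec (INR N / INR l) 1) as [->|Hne]; [lra|].
    left; apply ln_increasing; [lra|].
    assert (1 <= INR N / INR l); [|lra].
    apply Rmult_le_reg_r with (INR l); [lra|].
    replace (INR N / INR l * INR l) with (INR N) by (field; lra).
    rewrite Rmult_1_l; apply le_INR; lia. }
  assert (HrR : INR r <= 1 + 3 * ln (INR N / INR l)).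
  { destruct Hr' as [->|Hr']; [simpl; lra|].
    destruct r as [|r]; [simpl; lra|].
    rewrite Nat.sub_1_r in Hr'; simpl pred in Hr'.
    pose proof (rounds_log N l r ltac:(lia) ltac:(lia) Hr').
    rewrite S_INR; lra. }
  assert (Hsz : INR (ns + q) <= 3 * INR l + 5 * INR l * INR r).
  { apply Rle_trans with (INR (3 * l + 5 * l * r)); [apply le_INR; lia|].
    rewrite plus_INR, !mult_INR; simpl; lra. }
  nra.
Qed.

(** For [g <= N] the bound in [l] is passed on to [g] by [l ln (g / l) <= g - l]. For [g > N] the
    logarithm is negative and that comparison is replaced by [z <= 2 N]; since [g <= z], the
    quotient [N / g] is at least 1/2. *)
Lemma ratio_bound (N l g z : nat) :
  (1 <= l)%nat -> (l <= g)%nat -> (l <= N)%nat -> (g <= z)%nat -> (z <= 2 * N)%nat ->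
  INR z <= 18 * (INR l + INR l * ln (INR N / INR l)) ->
  INR z / INR g <= 18 * (1 + ln (INR N / INR g)).
Proof.
  intros Hl Hlg HlN Hgz HzN Hz.
  assert (HlR : 1 <= INR l) by (apply (le_INR 1); lia).
  assert (HgR : INR l <= INR g) by (apply le_INR; lia).
  apply Rmult_le_reg_r with (INR g); [lra|].
  replace (INR z / INR g * INR g) with (INR z) by (field; lra).
  destruct (le_lt_dec g N) as [HgN|HgN].
  - apply le_INR in HgN.
    assert (H1 : ln (INR N / INR l) = ln (INR N / INR g) + ln (INR g / INR l)).
    { rewrite <- ln_mult; [f_equal; field; lra|apply Rdiv_lt_0_compat; lra|
        apply Rdiv_lt_0_compat; lra]. }
    assert (H2 : INR l * ln (INR g / INR l) <= INR g - INR l).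
    { pose proof (ln_le_sub (INR g / INR l) ltac:(apply Rdiv_lt_0_compat; lra)) as H.
      apply Rmult_le_compat_l with (r := INR l) in H; [|lra].
      replace (INR l * (INR g / INR l - 1)) with (INR g - INR l) in H by (field; lra); auto. }
    assert (H3 : 0 <= ln (INR N / INR g)).
    { pose proof (ln_ge_sub (INR N / INR g) ltac:(apply Rdiv_lt_0_compat; lra)) as H.
      replace (/ (INR N / INR g)) with (INR g / INR N) in H by (field; lra).
      assert (INR g / INR N <= 1); [|lra].
      apply Rmult_le_reg_r with (INR N); [lra|].
      replace (INR g / INR N * INR N) with (INR g) by (field; lra); lra. }
    nra.
  - assert (HzR : INR z <= 2 * INR N).
    { replace 2 with (INR 2) by (simpl; lra); rewrite <- mult_INR; apply le_INR; lia. }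
    assert (HgR2 : INR g <= 2 * INR N).
    { replace 2 with (INR 2) by (simpl; lra); rewrite <- mult_INR; apply le_INR; lia. }
    apply lt_INR in HgN.
    (* [ln (N / g) >= ln (1 / 2)], and [exp 1 > 9 / 4] *)
    assert (He : 9 / 4 < exp 1).
    { pose proof (exp_ineq1 (1 / 2) ltac:(lra)) as H.
      replace (exp 1) with (exp (1 / 2) * exp (1 / 2)) by (rewrite <- exp_plus; f_equal; lra).
      nra. }
    assert (H1 : / 9 <= 1 + ln (INR N / INR g)).
    { rewrite <- (ln_exp 1) at 1.
      rewrite <- ln_mult; [|lra|apply Rdiv_lt_0_compat; lra].
      assert (Hx : 9 / 8 <= exp 1 * (INR N / INR g)).
      { apply Rmult_le_reg_r with (INR g); [lra|].
        replace (exp 1 * (INR N / INR g) * INR g) with (exp 1 * INR N) by (field; lra); nra. }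
      eapply Rle_trans; [|apply ln_ge_sub; lra].
      assert (/ (exp 1 * (INR N / INR g)) <= / (9 / 8)) by (apply Rinv_le_contravar; lra).
      lra. }
    (* Now [z <= 2 N < 2 g = 18 g / 9], which is where the constant 18 comes from. *)
    nra.
Qed.

Local Close Scope R_scope.

Theorem theorem3 :
  exists C : R,
  forall c : nat,
    (exists lz : com, linear_lz77 c lz) /\
    (forall lz : com, linear_lz77 c lz ->
     exists T k : nat, forall w : word, admissible c w ->
       exists (t : nat) (s : state),
         exec (word_bound k (length w)) (main lz) (init w) t s /\
         (t <= T * length w)%nat /\
         slp_generates (output s) w /\
         (forall F : list phrase, smallest_lz77 w F ->
            let N := INR (length w) in
            let l := INR (length F) in
            (INR (slp_size (output s)) <= C * (l + l * ln (N / l)))%R) /\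
         (forall G : slp, smallest_slp w G ->
            let N := INR (length w) in
            let g := INR (slp_size G) in
            (INR (slp_size (output s)) / g <= C * (1 + ln (N / g)))%R)).
Proof.
  exists 18%R; intros c; split; [exists lz77; apply lz77_linear|].
  intros lz Hlz; destruct (main_correct c lz Hlz) as (T & k & H).
  exists T, k; intros w Hw.
  destruct (H w Hw) as (t & s & F & HE & Ht & HG & HF & ns & q & Esz & Hns & Hns' & Hq' & Hq).
  pose proof (lz77_le_length w F HF) as HlN.
  assert (Hl1 : 1 <= length F).
  { destruct F as [|f F]; [|simpl; lia].
    destruct HF as [[E _] _]; destruct Hw as [Hne _]; contradiction. }
  assert (Hbound : (INR (slp_size (output s)) <=
    18 * (INR (length F) + INR (length F) * ln (INR (length w) / INR (length F))))%R).
  { rewrite Esz; apply size_bound; auto; lia. }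
  exists t, s; repeat (split; [assumption|]); split.
  - intros F' HF' N l.
    assert (E : length F' = length F) by (apply Nat.le_antisymm; [apply HF', HF|apply HF, HF']).
    unfold N, l; rewrite E; exact Hbound.
  - intros G [HG1 HG2] N g; unfold N, g.
    apply ratio_bound with (length F); auto; try lia.
    eapply lz77_le_slp; eauto.
Qed.
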